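(* Let $\mathbb{K}\in\{\mathbb{R},\mathbb{C}\}$ and let $\Sigma=(E,A,B,C,D)$ be a descriptor system over $\mathbb{K}$ with $(E,A)$ regular and system space $\mathcal{V}_{\rm sys}$. Then, with the properties defined in the context, $$\text{(Pa)}\iff(\text{KYP}\mid\mathcal{V}_{\rm sys})\iff(\text{KYP}_E\mid\mathcal{V}_{\rm sys})\implies\text{(PR)}.$$ Moreover, if the system is behaviorally controllable, i.e. $\operatorname{rk}[\lambda E-A,\,B]=n$ for all $\lambda\in\mathbb{C}$, then (PR) implies (Pa).
   Context: A descriptor system $\Sigma=(E,A,B,C,D)$ over $\mathbb{K}$ is given by $E,A\in\mathbb{K}^{n\times n}$, $B\in\mathbb{K}^{n\times m}$, $C\in\mathbb{K}^{m\times n}$, $D\in\mathbb{K}^{m\times m}$ and stands for $$\tfrac{d}{dt}Ex(t)=Ax(t)+Bu(t),\quad x(0)=x_0,\qquad y(t)=Cx(t)+Du(t). \quad ( * )$$ $(E,A)$ is regular if $\lambda E-A$ is invertible for some $\lambda\in\mathbb{C}$. $M^H$ is the conjugate transpose; $M\ge 0$ means Hermitian positive semidefinite. The transfer function is $\mathcal{T}(s)=C(sE-A)^{-1}B+D$. System space: $\mathcal{V}_{\rm sys}$ is the smallest subspace of $\mathbb{K}^{n+m}$ such that every solution $(x,u)\in L^2_{loc}(\mathbb{R},\mathbb{K}^{n+m})$ of $\tfrac{d}{dt}Ex=Ax+Bu$ (meaning $Ex$ is absolutely continuous with $\tfrac{d}{dt}Ex\in L^2_{loc}(\mathbb{R},\mathbb{K}^n)$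 and the equation holds almost everywhere) satisfies $(x,u)\in L^2_{loc}(\mathbb{R},\mathcal{V}_{\rm sys})$. For a subspace $\mathcal{V}\subseteq\mathbb{K}^{n+m}$: $(\text{KYP}\mid\mathcal{V})$: there exists $Q\in\mathbb{K}^{n\times n}$ with $E^HQ=Q^HE$ and $$\operatorname{Re}\begin{bmatrix} Qx \\ u \end{bmatrix}^H\begin{bmatrix} A & B \\ -C & -D \end{bmatrix}\begin{bmatrix} x \\ u \end{bmatrix}\le 0,\qquad x^HE^HQx\ge 0\qquad\text{for all }\begin{bmatrix} x \\ u \end{bmatrix}\in\mathcal{V}.$$ $(\text{KYP}_E\mid\mathcal{V})$: there exists $Y=Y^H\in\mathbb{K}^{n\times n}$ such that these conditions hold for $Q=YE$. (Pa) (passivity): there is $Q\in\mathbb{K}^{n\times n}$ such that $\mathcal{S}(x)=\tfrac12x^HQ^HEx$ (called a storage function) satisfies, for all $T\ge 0$, $$\mathcal{S}(x(T))-\mathcal{S}(x(0))\le\int_0^T\operatorname{Re}\,y(\tau)^Hu(\tau)\,d\tau,\qquad \mathcal{S}(x(T))\ge 0,$$ for all consistent initial values $x_0$ and all infinitely differentiable functions $x,u,y$ fulfilling $( * )$ with $x(0)=x_0$. (An initial value $x_0$ is consistent if such a solution exists.) (PR) (positive real): $\mathcal{T}$ has no poles in $\{s\in\mathbb{C}:\operatorname{Re}s>0\}$ and $\mathcal{T}(s)+\mathcal{T}(s)^H\ge 0$ for all $s\in\mathbb{C}$ with $\operatorname{Re}s>0$. *)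

(* Defs.v *)
From HB Require Import structures.
From mathcomp Require Import all_boot all_order all_algebra.
From mathcomp Require Import all_classical all_reals all_analysis.
From mathcomp Require Import complex.

Set Implicit Arguments.
Unset Strict Implicit.
Unset Printing Implicit Defensive.

Import Order.TTheory GRing.Theory Num.Theory.
Import numFieldNormedType.Exports.

Local Open Scope classical_set_scope.
Local Open Scope ring_scope.
Local Open Scope complex_scope.
Local Open Scope quotient_scope.
Local Open Scope sesquilinear_scope.

Inductive scalar_kind := RealScalars | ComplexScalars.

Definition base_field (R : realType) (k : scalar_kind) : numFieldType :=
  match k with
  | RealScalars => R
  | ComplexScalars => R[i]
  end.

Section Scalars.
Context (R : realType) (k : scalar_kind).
Local Notation K := (base_field R k).

Definition toC : K -> R[i] :=
  match k return base_field R k -> R[i] with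
  | RealScalars => fun a : R => a%:C
  | ComplexScalars => fun z => z
  end.

Definition conjK : K -> K :=
  match k return base_field R k -> base_field R k with
  | RealScalars => fun a => a
  | ComplexScalars => fun z => Num.conj z
  end.

Definition reK (z : K) : R := complex.Re (toC z).

Definition imK (z : K) : R := complex.Im (toC z).

Definition adjmx (p q : nat) (M : 'M[K]_(p, q)) : 'M[K]_(q, p) :=
  map_mx conjK M^T.

Definition mxC (p q : nat) (M : 'M[K]_(p, q)) : 'M[R[i]]_(p, q) :=
  map_mx toC M.

End Scalars.

(** In the order of [R[i]], [0 <= z] means that [z] is real and nonnegative. *)
Definition psdmx (R : realType) (p : nat) (M : 'M[R[i]]_p) : Prop :=
  M \is hermsymmx /\
  forall v : 'cV[R[i]]_p, 0 <= (v ^t* *m M *m v) ord0 ord0.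

Definition smooth (R : realType) (g : R -> R) : Prop :=
  forall (j : nat) (t : R), derivable (derive1n j g) t 1.

Definition L2loc (R : realType) (g : R -> R) : Prop :=
  measurable_fun [set: R] g /\
  locally_integrable [set: R] (fun t => g t ^+ 2).

Definition abs_cont_on (R : realType) (a b : R) (g : R -> R) : Prop :=
  forall e : R, 0 < e -> exists2 d : R, 0 < d &
    forall (N : nat) (l r : 'I_N -> R),
      (forall i, [/\ a <= l i, l i <= r i & r i <= b]) ->
      trivIset [set: 'I_N] (fun i => `]l i, r i[%classic) ->
      \sum_(i < N) (r i - l i) < d ->
      \sum_(i < N) `|g (r i) - g (l i)| < e.

(** On the whole line, absolute continuity is required on each compact
    interval. *)
Definition abs_cont (R : realType) (g : R -> R) : Prop :=
  forall a b : R, abs_cont_on a b g.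

Section VectorFunctions.
Context (R : realType) (k : scalar_kind) (p : nat).
Local Notation K := (base_field R k).

(** [R[i]] carries no normed-module structure over [R] in the libraries, so the
    regularity of functions of time with values in K^p is imposed on the real
    and imaginary parts of the entries; the latter vanish when K = R. *)
Definition coordwise (P : (R -> R) -> Prop) (f : R -> 'cV[K]_p) : Prop :=
  forall i, P (fun t => reK (f t i ord0)) /\ P (fun t => imK (f t i ord0)).

Definition is_vderive (f : R -> 'cV[K]_p) (t : R) (v : 'cV[K]_p) : Prop :=
  forall i,
    is_derive t 1 (fun s => reK (f s i ord0)) (reK (v i ord0)) /\
    is_derive t 1 (fun s => imK (f s i ord0)) (imK (v i ord0)).

End VectorFunctions.

Record descriptor_system (R : realType) (k : scalar_kind) (n m : nat) :=
  DescriptorSystem {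
    sysE : 'M[base_field R k]_n;
    sysA : 'M[base_field R k]_n;
    sysB : 'M[base_field R k]_(n, m);
    sysC : 'M[base_field R k]_(m, n);
    sysD : 'M[base_field R k]_m }.

Section Systems.
Context (R : realType) (k : scalar_kind) (n m : nat)
  (S : descriptor_system R k n m).
Local Notation K := (base_field R k).

Definition regular : Prop :=
  exists lambda : R[i], lambda *: mxC (sysE S) - mxC (sysA S) \in unitmx.

Definition behaviorally_controllable : Prop :=
  forall lambda : R[i],
    \rank (row_mx (lambda *: mxC (sysE S) - mxC (sysA S)) (mxC (sysB S))) = n.

Definition L2loc_solution (x : R -> 'cV[K]_n) (u : R -> 'cV[K]_m) : Prop :=
  [/\ coordwise (@L2loc R) x,
      coordwise (@L2loc R) u,
      coordwise (@abs_cont R) (fun t => sysE S *m x t) &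
      exists z : R -> 'cV[K]_n,
        [/\ coordwise (@L2loc R) z,
            {ae @lebesgue_measure R, forall t,
              is_vderive (fun s => sysE S *m x s) t (z t)} &
            {ae @lebesgue_measure R, forall t,
              z t = sysA S *m x t + sysB S *m u t}]].

Definition contains_solutions (V : {vspace 'cV[K]_(n + m)}) : Prop :=
  forall x u, L2loc_solution x u ->
    {ae @lebesgue_measure R, forall t, col_mx (x t) (u t) \in V}.

Definition is_system_space (V : {vspace 'cV[K]_(n + m)}) : Prop :=
  contains_solutions V /\
  forall W : {vspace 'cV[K]_(n + m)},
    contains_solutions W -> (V <= W)%VS.

Lemma system_space_exists :
  exists V : {vspace 'cV[K]_(n + m)}, is_system_space V.
Proof.
have capP (V W : {vspace 'cV[K]_(n + m)}) :
    contains_solutions V -> contains_solutions W ->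
    contains_solutions (V :&: W)%VS.
  move=> HV HW x u xu; have F := ae_filter_ringOfSetsType (@lebesgue_measure R).
  apply: (@filterS2 _ _ F _ _ _ _ (HV _ _ xu) (HW _ _ xu)) => t tV tW.
  by rewrite memv_cap tV tW.
have : exists V : {vspace 'cV[K]_(n + m)}, contains_solutions V.
  by exists fullv => x u _; apply: aeW => t; rewrite memvf.
case=> V; have [d] := ubnP (\dim V).
elim: d V => // d IHd V; rewrite ltnS => dV HV.
have [[W [HW nVW]]|noW] :=
    pselect (exists W, contains_solutions W /\ ~~ (V <= W)%VS).
  apply: (IHd (V :&: W)%VS); last exact: capP.
  apply: leq_trans dV; rewrite (ltn_leqif (dimv_leqif_sup (capvSl V W))).
  by apply: contra nVW => /subv_trans; apply; exact: capvSr.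
exists V; split=> // W HW.
by have [//|nVW] := boolP (V <= W)%VS; case: noW; exists W.
Qed.

Lemma system_space_unique (V W : {vspace 'cV[K]_(n + m)}) :
  is_system_space V -> is_system_space W -> V = W.
Proof.
by move=> [HV minV] [HW minW]; apply/eqP; rewrite eqEsubv minV// minW.
Qed.

Definition KYP_conditions (V : {vspace 'cV[K]_(n + m)}) (Q : 'M[K]_n) : Prop :=
  adjmx (sysE S) *m Q = adjmx Q *m sysE S /\
  forall (x : 'cV[K]_n) (u : 'cV[K]_m), col_mx x u \in V ->
    reK ((adjmx (col_mx (Q *m x) u) *m
          block_mx (sysA S) (sysB S) (- sysC S) (- sysD S) *m
          col_mx x u) ord0 ord0) <= 0 /\
    0 <= (adjmx x *m adjmx (sysE S) *m Q *m x) ord0 ord0.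

Definition KYP (V : {vspace 'cV[K]_(n + m)}) : Prop :=
  exists Q : 'M[K]_n, KYP_conditions V Q.

Definition KYP_E (V : {vspace 'cV[K]_(n + m)}) : Prop :=
  exists Y : 'M[K]_n,
    Y = adjmx Y /\ KYP_conditions V (Y *m sysE S).

Definition smooth_solution (x0 : 'cV[K]_n)
    (x : R -> 'cV[K]_n) (u y : R -> 'cV[K]_m) : Prop :=
  [/\ coordwise (@smooth R) x,
      coordwise (@smooth R) u,
      coordwise (@smooth R) y,
      x 0 = x0 &
      forall t,
        is_vderive (fun s => sysE S *m x s) t
          (sysA S *m x t + sysB S *m u t) /\
        y t = sysC S *m x t + sysD S *m u t].

Definition consistent (x0 : 'cV[K]_n) : Prop :=
  exists x u y, smooth_solution x0 x u y.

(** Complex-valued, since nothing forces [Q^H E] to be Hermitian. *)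
Definition storage (Q : 'M[K]_n) (x : 'cV[K]_n) : R[i] :=
  toC (2^-1 * (adjmx x *m adjmx Q *m sysE S *m x) ord0 ord0).

(** The inequalities are those of [R[i]], hence also say that the storage
    function takes real values along the trajectories. *)
Definition passive : Prop :=
  exists Q : 'M[K]_n,
    forall T : R, 0 <= T ->
    forall x0 : 'cV[K]_n, consistent x0 ->
    forall (x : R -> 'cV[K]_n) (u y : R -> 'cV[K]_m),
      smooth_solution x0 x u y ->
      storage Q (x T) - storage Q (x 0) <=
        (\int[@lebesgue_measure R]_(tau in `[0, T])
            reK ((adjmx (y tau) *m u tau) ord0 ord0))%:C /\
      0 <= storage Q (x T).

End Systems.

Section RationalFunctions.
Context (R : realType).

Definition ratfun := {fraction {poly R[i]}}.

Definition ratX : ratfun := FracField.tofrac 'X.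

Definition ratC (c : R[i]) : ratfun := FracField.tofrac c%:P.

(** [repr f] need not be in lowest terms. *)
Definition ratnum (f : ratfun) : {poly R[i]} :=
  (repr f).1 %/ gcdp (repr f).1 (repr f).2.

Definition ratden (f : ratfun) : {poly R[i]} :=
  (repr f).2 %/ gcdp (repr f).1 (repr f).2.

Definition ratpole (f : ratfun) (s : R[i]) : Prop :=
  root (ratden f) s.

(** Removable singularities are removed; the value at a pole is irrelevant. *)
Definition rateval (s : R[i]) (f : ratfun) : R[i] :=
  (ratnum f).[s] / (ratden f).[s].

End RationalFunctions.

Section Transfer.
Context (R : realType) (k : scalar_kind) (n m : nat)
  (S : descriptor_system R k n m).
Local Notation K := (base_field R k).

Definition transfer : 'M[ratfun R]_m :=
  let rat p q (M : 'M[K]_(p, q)) := map_mx (@ratC R) (mxC M) in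
  rat _ _ (sysC S) *m invmx (ratX R *: rat _ _ (sysE S) - rat _ _ (sysA S))
    *m rat _ _ (sysB S) + rat _ _ (sysD S).

Definition transfer_at (s : R[i]) : 'M[R[i]]_m :=
  map_mx (rateval s) transfer.

Definition positive_real : Prop :=
  (forall s : R[i], 0 < complex.Re s ->
     forall i j, ~ ratpole (transfer i j) s) /\
  (forall s : R[i], 0 < complex.Re s ->
     psdmx (transfer_at s + (transfer_at s) ^t* )).

End Transfer.

(* Main.v *)
(** Along the system space V, [d/dt E x = A x + B u] is solved by exponential
    curves [x = X0 c, u = U0 c, c' = F c], where [X0, U0] parametrize V and F is a
    lift of [A B] through E.  A storage function is thus a positive semidefinite
    Hermitian form G on the parameters c which vanishes where [E X0 c = 0], so that
    it factors through E as [Y], and dissipativity is a pointwise inequality; this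
    gives (Pa) <-> (KYP) <-> (KYP_E).

    If (KYP_E) holds, the complex solutions [e^(s t) (x, u)] give Re T(s) >= 0 for
    Re s > 0 wherever the pencil is invertible, and a rational matrix function with
    nonnegative real part near a point has no pole there.

    Conversely, the Cayley transform [s = al (1 + z) / (1 - z)] turns the system into
    an ordinary discrete-time one whose transfer function is positive real on the
    unit disc.  By Caratheodory-Toeplitz, the energy supplied along each trajectory
    from rest is nonnegative, so the least energy needed to reach a state is a storage
    function on the reachable space, and controllability places V in that space. *)

(* The difficulty throughout is that [E] may be singular: solutions pass only through [V], a storage
   function must depend on [E x] alone, and the transfer function may grow at infinity. The matrix
   [F] settles the first point: an exponential solution starts at every parameter, so integral
   inequalities can be differentiated at time 0. The second is met each time by showing that a form
   vanishes on [ker (E X0)]. For the third, the Cayley transform sends infinity to [z = 1], on the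
   boundary of the disc, where positivity is not asked for; the pencil turns into [1 - z Ah], which
   is invertible at 0. One discrete step is exactly the original equation when [xi' - xi] is read as
   [x] and [al (xi' + xi)] as its derivative, so a discrete storage inequality becomes a pointwise
   one without any limit in the step size. The number [al] is real and positive so that the disc is
   mapped into the right half-plane. The construction runs over C; for K = R the real part of the
   form so found is kept. *)
Require Import Defs.
From mathcomp Require Import all_boot all_order all_algebra.
From mathcomp Require Import all_classical all_reals all_analysis.
From HB Require Import structures.
From mathcomp Require Import complex cyclic separable cyclotomic ring lra zify.

Set Implicit Arguments.
Unset Strict Implicit.
Unset Printing Implicit Defensive.

Import Order.TTheory GRing.Theory Num.Theory.
Import numFieldNormedType.Exports.

Local Open Scope classical_set_scope.
Local Open Scope ring_scope.

(** * Hermitian forms *)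

Section HermitianForms.
Context (K : numFieldType) (cj : {rmorphism K -> K}).
Hypotheses (cjK : involutive cj) (cj_norm : forall z, cj z * z = `|z| ^+ 2).

(** The conjugation [cj] is abstract so that the same lemmas serve R, where it is the identity, and
    C. *)
Definition hadj (p q : nat) (M : 'M[K]_(p, q)) : 'M[K]_(q, p) :=
  map_mx cj M^T.

Local Notation "M ^A" := (hadj M) (at level 8, format "M ^A").

Lemma hadjK p q (M : 'M[K]_(p, q)) : M^A^A = M.
Proof. by apply/matrixP=> i j; rewrite !mxE cjK. Qed.

Lemma hadjM p q r (M : 'M[K]_(p, q)) (N : 'M[K]_(q, r)) :
  (M *m N)^A = N^A *m M^A.
Proof. by rewrite /hadj trmx_mul map_mxM. Qed.

Lemma hadjD p q (M N : 'M[K]_(p, q)) : (M + N)^A = M^A + N^A.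
Proof. by rewrite /hadj linearD /= map_mxD. Qed.

Lemma hadjZ p q a (M : 'M[K]_(p, q)) : (a *: M)^A = cj a *: M^A.
Proof. by apply/matrixP=> i j; rewrite !mxE rmorphM. Qed.

Lemma hadj0 p q : (0 : 'M[K]_(p, q))^A = 0.
Proof. by rewrite /hadj trmx0 map_mx0. Qed.

Definition hform p (G : 'M[K]_p) (v w : 'cV[K]_p) : K :=
  (v^A *m G *m w) ord0 ord0.

Lemma hformDl p (G : 'M[K]_p) v1 v2 w :
  hform G (v1 + v2) w = hform G v1 w + hform G v2 w.
Proof. by rewrite /hform hadjD !mulmxDl mxE. Qed.

Lemma hformDr p (G : 'M[K]_p) v w1 w2 :
  hform G v (w1 + w2) = hform G v w1 + hform G v w2.
Proof. by rewrite /hform mulmxDr mxE. Qed.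

Lemma hformZl p (G : 'M[K]_p) a v w : hform G (a *: v) w = cj a * hform G v w.
Proof. by rewrite /hform hadjZ -!scalemxAl mxE. Qed.

Lemma hformZr p (G : 'M[K]_p) a v w : hform G v (a *: w) = a * hform G v w.
Proof. by rewrite /hform -!scalemxAr mxE. Qed.

Lemma hformE p (G : 'M[K]_p) (v w : 'cV[K]_p) :
  hform G v w = \sum_j \sum_i cj (v i ord0) * G i j * w j ord0.
Proof.
rewrite /hform mxE; apply: eq_bigr => j _; rewrite mxE mulr_suml.
by apply: eq_bigr => i _; rewrite !mxE.
Qed.

Lemma hformM p q (G : 'M[K]_p) (L : 'M[K]_(p, q)) v w :
  hform G (L *m v) (L *m w) = hform (L^A *m G *m L) v w.
Proof. by rewrite /hform hadjM !mulmxA. Qed.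

Lemma hform_conj p (G : 'M[K]_p) v w : cj (hform G v w) = hform G^A w v.
Proof.
rewrite /hform; have -> : w^A *m G^A *m v = (v^A *m G *m w)^A.
  by rewrite !hadjM hadjK mulmxA.
by rewrite [in RHS]/hadj [in RHS]mxE [in RHS]mxE.
Qed.

Lemma hform_entry p (G : 'M[K]_p) (i j : 'I_p) :
  G i j = hform G (delta_mx i ord0) (delta_mx j ord0).
Proof.
rewrite /hform (_ : _^A = delta_mx ord0 i); last first.
  by apply/matrixP=> a b; rewrite !mxE rmorph_nat andbC.
by rewrite -rowE -colE !mxE.
Qed.

Definition hpsd p (G : 'M[K]_p) : Prop :=
  G^A = G /\ forall v, 0 <= hform G v v.

Lemma hadj_mul_self_ge0 p (v : 'cV[K]_p) : 0 <= (v^A *m v) ord0 ord0.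
Proof.
by rewrite mxE; apply: sumr_ge0 => i _; rewrite !mxE cj_norm exprn_ge0.
Qed.

Lemma hadj_mul_self_eq0 p (v : 'cV[K]_p) : (v^A *m v) ord0 ord0 = 0 -> v = 0.
Proof.
rewrite mxE => /eqP; rewrite psumr_eq0; last first.
  by move=> i _; rewrite !mxE cj_norm exprn_ge0.
move=> /allP v0; apply/colP => i; rewrite mxE.
have := v0 i; rewrite mem_index_enum => /(_ isT) /=.
by rewrite !mxE cj_norm expf_eq0 /= normr_eq0 => /eqP.
Qed.

Lemma cj_real (t : K) : 0 <= t -> cj t = t.
Proof.
rewrite le_eqVlt => /predU1P [<-|t0]; first by rewrite rmorph0.
have := cj_norm t; rewrite gtr0_norm // expr2.
by move/mulIf; apply; rewrite gt_eqF.
Qed.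

Lemma hpsd_ker p (G : 'M[K]_p) v : hpsd G -> hform G v v = 0 -> G *m v = 0.
Proof.
move=> [GH G0] vv; set w := G *m v.
apply: hadj_mul_self_eq0; set a := (_ *m _) _ _.
have a_ge0 : 0 <= a by exact: hadj_mul_self_ge0.
have wv : hform G w v = a by rewrite /hform -mulmxA.
have vw : hform G v w = a by rewrite -{1}GH -hform_conj wv cj_real.
set b := hform G w w; have b_ge0 : 0 <= b := G0 w.
have b1 : 0 < b + 1 by rewrite ltr_wpDl.
(* At this vector the form equals [- a^2 (b + 2)], which is negative unless [a = 0]. *)
have := G0 ((b + 1) *: v - a *: w).
rewrite -scaleNr !(hformDl, hformDr, hformZl, hformZr) vv vw wv -/b.
rewrite !rmorphN !(cj_real a_ge0) (cj_real (ltW b1)).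
rewrite [X in 0 <= X](_ : _ = - (a ^+ 2 * (b + 2))); last by ring.
rewrite oppr_ge0 => le0; apply/eqP; apply: contraT => a_neq0.
have a_gt0 : 0 < a by rewrite lt_def a_neq0.
have b2 : 0 < b + 2 by rewrite ltr_wpDl.
by have := lt_le_trans (mulr_gt0 (exprn_gt0 2 a_gt0) b2) le0; rewrite ltxx.
Qed.

Lemma mulmx_col_eq0 p q (G : 'M[K]_(p, q)) :
  (forall v : 'cV_q, G *m v = 0) -> G = 0.
Proof.
move=> G0; apply/matrixP=> i j; have /colP/(_ i) := G0 (delta_mx j ord0).
by rewrite -colE !mxE.
Qed.

(** A right kernel, spanned by columns; [kermx] speaks of rows, hence the two transposes. *)
Definition colker p q (L : 'M[K]_(p, q)) : 'M[K]_q := (kermx L^T)^T.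

Lemma mulmx_colker p q (L : 'M[K]_(p, q)) : L *m colker L = 0.
Proof. by apply: trmx_inj; rewrite trmx_mul trmxK mulmx_ker trmx0. Qed.

Lemma colker_sol p q (L : 'M[K]_(p, q)) (v : 'cV_q) :
  L *m v = 0 -> exists c, v = colker L *m c.
Proof.
move=> Lv; have /sub_kermxP : v^T *m L^T = 0 by rewrite -trmx_mul Lv trmx0.
by move=> /submxP [D vD]; exists D^T; rewrite /colker -trmx_mul -vD trmxK.
Qed.

Lemma submx_ker p q r (G : 'M[K]_(p, q)) (L : 'M[K]_(r, q)) :
  (forall v : 'cV_q, L *m v = 0 -> G *m v = 0) -> (G <= L)%MS.
Proof.
move=> GL; rewrite submxE; apply/eqP; apply: mulmx_col_eq0 => v.
by rewrite -mulmxA; apply: GL; rewrite mulmxA mulmx_coker mul0mx.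
Qed.

Lemma mulmx_pinvmxK p q (L : 'M[K]_(p, q)) : L *m pinvmx L *m L = L.
Proof. exact: mulmxKpV. Qed.

Lemma ker_mulmx_pinvmxK p q r (G : 'M[K]_(p, q)) (L : 'M[K]_(r, q)) :
  (forall v : 'cV_q, L *m v = 0 -> G *m v = 0) -> G *m pinvmx L *m L = G.
Proof. by move=> /submx_ker; exact: mulmxKpV. Qed.

(** Since [G] kills [ker L], it absorbs the projection [pinvmx L *m L] on the right and, being
    Hermitian, the adjoint projection on the left. *)
Lemma herm_factor p q (G : 'M[K]_q) (L : 'M[K]_(p, q)) :
  G^A = G -> (forall v : 'cV_q, L *m v = 0 -> G *m v = 0) ->
  G = L^A *m ((pinvmx L)^A *m G *m pinvmx L) *m L.
Proof.
move=> GH /ker_mulmx_pinvmxK GL.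
have GL' : (pinvmx L *m L)^A *m G = G.
  by rewrite -{1}GH -hadjM mulmxA GL.
transitivity ((pinvmx L *m L)^A *m (G *m pinvmx L *m L)).
  by rewrite GL GL'.
by rewrite hadjM !mulmxA.
Qed.

Lemma hpsd_conjmx p q (G : 'M[K]_p) (L : 'M[K]_(p, q)) :
  hpsd G -> hpsd (L^A *m G *m L).
Proof.
by move=> [GH G0]; split=> [|v]; rewrite ?hadjM ?hadjK ?GH ?mulmxA // -hformM.
Qed.

(** Semidefiniteness upgrades the vanishing of the quadratic form on [ker L] to [G] killing [ker L].
    With [L = E X0], the factor [P] is the matrix [Y] of (KYP_E). *)
Lemma hpsd_factor p q (G : 'M[K]_q) (L : 'M[K]_(p, q)) :
  hpsd G -> (forall v : 'cV_q, L *m v = 0 -> hform G v v = 0) ->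
  exists2 P : 'M[K]_p, hpsd P & G = L^A *m P *m L.
Proof.
move=> Gpsd GL; exists ((pinvmx L)^A *m G *m pinvmx L).
  exact: hpsd_conjmx.
by apply: herm_factor => [|v /GL]; [case: Gpsd | exact: hpsd_ker].
Qed.

(** A generalized Schur complement: the minimum of [J] over a fibre of [L] is attained, even for
    degenerate [J], and is again a quadratic form in the common value [L w]. For [reach N] and
    [supply N] it is the least energy reaching a state. *)
Lemma hpsd_fiber_min p q (J : 'M[K]_q) (L : 'M[K]_(p, q)) : hpsd J ->
  exists2 P : 'M[K]_p, hpsd P &
    (forall w, hform P (L *m w) (L *m w) <= hform J w w) /\
    (forall w, exists w',
       L *m w' = L *m w /\ hform P (L *m w) (L *m w) = hform J w' w').
Proof.
move=> Jpsd; have [JH J0] := Jpsd; set N := colker L.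
set H := N^A *m J *m N; have Hpsd : hpsd H by exact: hpsd_conjmx.
(* [H] may be singular, but [H v = 0] makes [N v] null for [J], so that [J N v = 0] and the
   pseudo-inverse acts as an inverse here. *)
have : J *m N *m pinvmx H *m H = J *m N.
  apply: ker_mulmx_pinvmxK => v Hv; rewrite -mulmxA; apply: hpsd_ker => //.
  by rewrite hformM -/H /hform -mulmxA Hv mulmx0 mxE.
set D := _ *m pinvmx H => JN.
(* Pi projects along ker L onto its J-orthogonal complement. *)
pose Pi := 1%:M - N *m D^A.
have NJPi : N^A *m J *m Pi = 0.
  have NJ : N^A *m J = H *m D^A.
    by rewrite -[X in X *m D^A](proj1 Hpsd) -hadjM JN hadjM JH.
  by rewrite mulmxBr mulmx1 mulmxA -/H NJ subrr.
have LPi w : L *m (Pi *m w) = L *m w.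
  by rewrite mulmxA mulmxBr mulmx1 mulmxA mulmx_colker mul0mx subr0.
have [P Ppsd GP] : exists2 P : 'M[K]_p, hpsd P & Pi^A *m J *m Pi = L^A *m P *m L.
  apply: hpsd_factor; first exact: hpsd_conjmx.
  move=> w Lw; have [c Pc] : exists c, Pi *m w = N *m c.
    by apply: colker_sol; rewrite LPi.
  by rewrite -hformM {1}Pc /hform hadjM -!mulmxA [J *m _]mulmxA [N^A *m _]mulmxA
    [N^A *m (_ *m _)]mulmxA NJPi mul0mx mulmx0 mxE.
have PL w : hform P (L *m w) (L *m w) = hform J (Pi *m w) (Pi *m w).
  by rewrite !hformM GP.
exists P => //; split=> w; last by exists (Pi *m w); rewrite LPi PL.
have {3 4}-> : w = Pi *m w + N *m (D^A *m w).
  by rewrite mulmxBl mul1mx mulmxA subrK.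
rewrite hformDl !hformDr PL.
have NJ0 : hform J (N *m (D^A *m w)) (Pi *m w) = 0.
  by rewrite /hform hadjM -!mulmxA [J *m _]mulmxA [N^A *m _]mulmxA
    [N^A *m (_ *m _)]mulmxA NJPi mul0mx mulmx0 mxE.
have JN0 : hform J (Pi *m w) (N *m (D^A *m w)) = 0.
  by rewrite -{1}JH -hform_conj NJ0 rmorph0.
by rewrite NJ0 JN0 addr0 add0r lerDl.
Qed.

End HermitianForms.

(** Here [a], [b], [c], [d] stand for the values of the form at [(v,v)], [(v,w)], [(w,v)], [(w,w)];
    the coefficients are left as the expansion by sesquilinearity produces them. *)
Lemma polarization_identity (F : numFieldType) (a b c d j : F) : j * j = -1 ->
  b = 4^-1 * (a + b + (c + d) - (a + -1 * b + (-1 * c + -1 * (-1 * d))) -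
    j * (a + j * b + (- j * c + - j * (j * d)) -
         (a + - j * b + (- - j * c + - - j * (- j * d))))).
Proof.
move=> j2; transitivity (4^-1 * (2 * b + 2 * c - (2 * (j * j) * b - 2 * (j * j) * c))).
  by rewrite j2; field.
by congr (_ * _); ring.
Qed.

Lemma hform_polarization (K : numFieldType) (cj : {rmorphism K -> K}) (j : K)
    p (G : 'M[K]_p) (v w : 'cV[K]_p) : j * j = -1 -> cj j = - j ->
  hform cj G v w = 4^-1 * (hform cj G (v + w) (v + w) - hform cj G (v - w) (v - w)
    - j * (hform cj G (v + j *: w) (v + j *: w)
         - hform cj G (v - j *: w) (v - j *: w))).
Proof.
move=> j2 cjj.
rewrite -[- (j *: w)]scaleNr -[- w]scaleN1r !(hformDl, hformDr, hformZl, hformZr).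
by rewrite !rmorphN rmorph1 cjj; exact: polarization_identity.
Qed.

(** * Complex numbers and monotone limits of Hermitian forms *)

Section Complexes.
Context (R : realType).
Local Notation C := (R[i]%C).
Local Notation Re := (@complex.Re R).
Local Notation Im := (@complex.Im R).

Definition conjC_rmorphism : {rmorphism C -> C} := (@Num.conj C).

Lemma conjC_rmorphismE z : conjC_rmorphism z = (z^*)%C.
Proof. by []. Qed.

Lemma conjC_rmorphismK : involutive conjC_rmorphism.
Proof. exact: conjCK. Qed.

Lemma conjC_rmorphism_norm z : conjC_rmorphism z * z = `|z| ^+ 2.
Proof. by rewrite normCKC. Qed.

Lemma ReD z w : Re (z + w) = Re z + Re w. Proof. by case: z w => [? ?] [? ?]. Qed.
Lemma ReN z : Re (- z) = - Re z. Proof. by case: z. Qed.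
Lemma ReB z w : Re (z - w) = Re z - Re w. Proof. by rewrite ReD ReN. Qed.
Lemma ImD z w : Im (z + w) = Im z + Im w. Proof. by case: z w => [? ?] [? ?]. Qed.
Lemma ReM z w : Re (z * w) = Re z * Re w - Im z * Im w.
Proof. by case: z w => [? ?] [? ?]. Qed.
Lemma ImM z w : Im (z * w) = Re z * Im w + Im z * Re w.
Proof. by case: z w => [? ?] [? ?]. Qed.
Lemma Re_conj z : Re (z^*)%C = Re z. Proof. by case: z. Qed.
Lemma Im_conj z : Im (z^*)%C = - Im z. Proof. by case: z. Qed.

Lemma Re_sum (I : Type) (r : seq I) (P : pred I) (F : I -> C) :
  Re (\sum_(i <- r | P i) F i) = \sum_(i <- r | P i) Re (F i).
Proof. by apply: (big_morph Re ReD). Qed.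

Lemma Im_sum (I : Type) (r : seq I) (P : pred I) (F : I -> C) :
  Im (\sum_(i <- r | P i) F i) = \sum_(i <- r | P i) Im (F i).
Proof. by apply: (big_morph Im ImD). Qed.

Lemma complex_ext z w : Re z = Re w -> Im z = Im w -> z = w.
Proof. by case: z w => [a b] [c d] /= -> ->. Qed.

Lemma ge0_complexE z : (0 <= z) = (Im z == 0) && (0 <= Re z).
Proof. by rewrite lecE. Qed.

Lemma Re_ge0 z : 0 <= z -> 0 <= Re z.
Proof. by rewrite ge0_complexE => /andP []. Qed.

Lemma Im_ge0 z : 0 <= z -> Im z = 0.
Proof. by rewrite ge0_complexE => /andP [/eqP]. Qed.

Definition ccvg (u : nat -> C) (l : C) : Prop :=
  (fun k => Re (u k)) @ \oo --> Re l /\ (fun k => Im (u k)) @ \oo --> Im l.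

Lemma ccvg_cst l : ccvg (fun=> l) l.
Proof. by split; exact: cvg_cst. Qed.

Lemma ccvgD u v a b : ccvg u a -> ccvg v b -> ccvg (fun k => u k + v k) (a + b).
Proof.
move=> [ua ua'] [vb vb']; split.
  by under eq_fun do rewrite ReD; rewrite ReD; exact: cvgD.
by under eq_fun do rewrite ImD; rewrite ImD; exact: cvgD.
Qed.

Lemma ccvgM u v a b : ccvg u a -> ccvg v b -> ccvg (fun k => u k * v k) (a * b).
Proof.
move=> [ua ua'] [vb vb']; split.
  by under eq_fun do rewrite ReM; rewrite ReM; apply: cvgB; exact: cvgM.
by under eq_fun do rewrite ImM; rewrite ImM; apply: cvgD; exact: cvgM.
Qed.

Lemma ccvg_sum (I : Type) (r : seq I) (u : I -> nat -> C) (l : I -> C) :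
  (forall i, ccvg (u i) (l i)) ->
  ccvg (fun k => \sum_(i <- r) u i k) (\sum_(i <- r) l i).
Proof.
move=> ul; elim: r => [|i r IH].
  by rewrite big_nil; under eq_fun do rewrite big_nil; exact: ccvg_cst.
by rewrite big_cons; under eq_fun do rewrite big_cons; exact: ccvgD.
Qed.

Lemma ccvg_unique u a b : ccvg u a -> ccvg u b -> a = b.
Proof.
move=> [ua ua'] [ub ub']; apply: complex_ext.
  by rewrite -(cvg_lim _ ua) // -(cvg_lim _ ub).
by rewrite -(cvg_lim _ ua') // -(cvg_lim _ ub').
Qed.

Local Notation hadjC := (hadj conjC_rmorphism).
Local Notation hformC := (hform conjC_rmorphism).
Local Notation hpsdC := (hpsd conjC_rmorphism).

Lemma hformC_polarization p (G : 'M[C]_p) (v w : 'cV[C]_p) :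
  hformC G v w = 4^-1 * (hformC G (v + w) (v + w) - hformC G (v - w) (v - w)
    - 'i%C * (hformC G (v + 'i%C *: w) (v + 'i%C *: w)
         - hformC G (v - 'i%C *: w) (v - 'i%C *: w))).
Proof.
apply: hform_polarization; first by rewrite -expr2 sqr_i.
by apply: complex_ext => /=; rewrite ?oppr0.
Qed.

(** At each vector the values decrease and are bounded below by 0, hence converge; polarization
    writes every entry as a fixed combination of four such values, so the matrices converge too. *)
Lemma hpsd_cvg p (H : nat -> 'M[C]_p) :
  (forall k, hpsdC (H k)) ->
  (forall k v, hformC (H k.+1) v v <= hformC (H k) v v) ->
  exists2 G : 'M[C]_p, hpsdC G &
    forall v, ccvg (fun k => hformC (H k) v v) (hformC G v v).
Proof.
move=> Hpsd Hdec.
have cq v : exists l, ccvg (fun k => hformC (H k) v v) l.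
  have Hv k : 0 <= hformC (H k) v v by case: (Hpsd k).
  have cr : cvgn (fun k => Re (hformC (H k) v v)).
    apply: nonincreasing_is_cvgn.
      apply/nonincreasing_seqP => k.
      by have := Hdec k v; rewrite lecE => /andP [].
    by exists 0 => _ [k _ <-]; exact: Re_ge0.
  exists ((limn (fun k => Re (hformC (H k) v v)))%:C%C); split; first exact: cr.
  by under eq_fun do rewrite (Im_ge0 (Hv _)); exact: cvg_cst.
have cE (i j : 'I_p) : exists l, ccvg (fun k => H k i j) l.
  set e := delta_mx i ord0 : 'cV[C]_p; set f := delta_mx j ord0 : 'cV[C]_p.
  have [a ca] := cq (e + f); have [b cb] := cq (e - f).
  have [c cc] := cq (e + 'i%C *: f); have [d cd] := cq (e - 'i%C *: f).
  exists (4^-1 * (a + -1 * b + - 'i%C * (c + -1 * d))).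
  have -> : (fun k => H k i j) = (fun k =>
     4^-1 * (hformC (H k) (e + f) (e + f) + -1 * hformC (H k) (e - f) (e - f)
    + - 'i%C * (hformC (H k) (e + 'i%C *: f) (e + 'i%C *: f)
         + -1 * hformC (H k) (e - 'i%C *: f) (e - 'i%C *: f)))).
    apply: funext => k; rewrite (hform_entry conjC_rmorphism).
    by rewrite hformC_polarization !mulN1r mulNr.
  have lc x y k u u' : ccvg u x -> ccvg u' y ->
      ccvg (fun n => u n + k * u' n) (x + k * y).
    by move=> ? ?; apply: ccvgD => //; apply: ccvgM => //; exact: ccvg_cst.
  by apply: ccvgM; [exact: ccvg_cst | by apply: (lc); apply: lc].
pose G := \matrix_(i, j) sval (cid (cE i j)).
have cG i j : ccvg (fun k => H k i j) (G i j).
  by rewrite mxE; case: (cid (cE i j)).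
have cform v : ccvg (fun k => hformC (H k) v v) (hformC G v v).
  rewrite hformE; under [X in ccvg X]eq_fun do rewrite hformE.
  apply: ccvg_sum => j; apply: ccvg_sum => i.
  by do ![exact: ccvg_cst | apply: ccvgM | exact: cG].
exists G => //; split; last first.
  move=> v; rewrite ge0_complexE.
  have [cr ci] := cform v; have Hv k : 0 <= hformC (H k) v v by case: (Hpsd k).
  apply/andP; split.
    move: ci; under eq_fun do rewrite (Im_ge0 (Hv _)).
    by move=> /(cvg_lim _) <- //; rewrite lim_cst.
  rewrite -(cvg_lim _ cr) //; apply: limr_ge; first by apply: cvgP cr.
  by near=> k; exact: Re_ge0.
apply/matrixP => i j; rewrite !mxE; apply: (ccvg_unique (u := fun k => H k i j)).
  have -> : (fun k => H k i j) = (fun k => conjC_rmorphism (H k j i)).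
    by apply: funext => k; rewrite -{1}(proj1 (Hpsd k)) !mxE.
  have [cr ci] := cG j i; rewrite mxE in cr ci; split.
    by rewrite Re_conj; under eq_fun do rewrite Re_conj.
  by rewrite Im_conj; under eq_fun do rewrite Im_conj; exact: cvgN.
by have := cG i j; rewrite mxE.
Unshelve. all: by end_near.
Qed.

End Complexes.

(** * Required supply of a discrete-time system *)

Section DiscreteStorage.
Context (R : realType) (n m : nat).
Local Notation C := (R[i]%C).
Local Notation Re := (@complex.Re R).
Local Notation hadjC := (hadj (conjC_rmorphism R)).
Local Notation hformC := (hform (conjC_rmorphism R)).
Local Notation hpsdC := (hpsd (conjC_rmorphism R)).
Context (A : 'M[C]_n) (B : 'M[C]_(n, m)) (Cm : 'M[C]_(m, n)) (D : 'M[C]_m).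

(* Input-to-state map from rest, and energy supplied, over N steps; the most
   recent input comes first. *)
Fixpoint reach (N : nat) : 'M[C]_(n, N * m) :=
  if N is N'.+1 then row_mx B (A *m reach N') else 0.

Fixpoint supply (N : nat) : 'M[C]_(N * m) :=
  if N is N'.+1 then
    block_mx (2^-1 *: (D + hadjC D)) (2^-1 *: (Cm *m reach N'))
             (2^-1 *: hadjC (Cm *m reach N')) (supply N')
  else 0.

Definition reachable (xi : 'cV[C]_n) : Prop :=
  exists N (w : 'cV[C]_(N * m)), xi = reach N *m w.

Lemma hadj_col_mx p q (u : 'cV[C]_p) (w : 'cV[C]_q) :
  hadjC (col_mx u w) = row_mx (hadjC u) (hadjC w).
Proof. by rewrite /hadj tr_col_mx map_row_mx. Qed.

Lemma half_addcJ (z : C) : 2^-1 * (z + conjC_rmorphism R z) = ((Re z)%:C)%C.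
Proof.
have -> : z + conjC_rmorphism R z = 2 * ((Re z)%:C)%C.
  by rewrite conjC_rmorphismE addcJ.
by rewrite mulKf // pnatr_eq0.
Qed.

Lemma reachS N u w : reach N.+1 *m (col_mx u w : 'cV_(m + N * m)) =
  B *m u + A *m (reach N *m w).
Proof. by rewrite /= mul_row_col mulmxA. Qed.

Lemma supply_herm N : hadjC (supply N) = supply N.
Proof.
elim: N => [|N IH] /=; first by rewrite hadj0.
have h2 : conjC_rmorphism R 2^-1 = 2^-1 by rewrite fmorphV rmorph_nat.
rewrite /hadj tr_block_mx map_block_mx -!/(hadj _ _) IH !hadjZ !h2 hadjD.
by rewrite !(hadjK (@conjC_rmorphismK R)) [hadjC D + D]addrC.
Qed.

Lemma supplyS N u w : hformC (supply N.+1) (col_mx u w : 'cV_(m + N * m)) (col_mx u w) =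
  hformC (supply N) w w +
  ((Re ((hadjC u *m (Cm *m (reach N *m w) + D *m u)) ord0 ord0))%:C)%C.
Proof.
rewrite -half_addcJ.
set z := (_ *m (_ + _)) ord0 ord0.
have -> : conjC_rmorphism R z = (hadjC (Cm *m (reach N *m w) + D *m u) *m u) ord0 ord0.
  rewrite /z; set y := _ + _.
  have := hform_conj (@conjC_rmorphismK R) (1%:M) u y.
  by rewrite /hform !mulmx1 => ->; rewrite /hadj trmx1 map_mx1 mulmx1.
rewrite /hform /= hadj_col_mx mul_row_block mul_row_col /z.
rewrite -!scalemxAr !mulmxDl -!scalemxAl.
rewrite !(hadjD, hadjM) !(mulmxDl, mulmxDr) !mulmxA.
have regroup (F : numFieldType) (h : F) (a b c d e : 'M[F]_1) :
  (h *: (a + b) + h *: c + (h *: d + e)) ord0 ord0 =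
  e ord0 ord0 + h * ((d + a) ord0 ord0 + (c + b) ord0 ord0).
  by rewrite !mxE; ring.
exact: regroup.
Qed.

(** Staying at rest for one step first costs no energy. The zero input belongs at the far end of the
    stack, the most recent input being on top, hence the induction. *)
Lemma supply_prepend0 N (w : 'cV[C]_(N * m)) : exists w',
  reach N.+1 *m w' = reach N *m w /\
  hformC (supply N.+1) w' w' = hformC (supply N) w w.
Proof.
elim: N w => [|N IH] w.
  exists (col_mx 0 0); rewrite reachS supplyS hadj0 !mul0mx !mulmx0 addr0.
  by rewrite mxE addr0 /hform !mulmx0 !mul0mx mxE.
pose w1 : 'cV_(m + N * m) := w; have -> : w = w1 by [].
rewrite -(vsubmxK w1); move: (usubmx w1) (dsubmx w1) => u v.
have [v' [rv' sv']] := IH v.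
by exists (col_mx u v'); rewrite !reachS !supplyS rv' sv'.
Qed.

End DiscreteStorage.

(** * Stabilization of the reachable spaces *)

Section Reachability.
Context (R : realType) (n m : nat).
Local Notation C := (R[i]%C).
Local Notation Re := (@complex.Re R).
Local Notation hadjC := (hadj (conjC_rmorphism R)).
Local Notation hformC := (hform (conjC_rmorphism R)).
Local Notation hpsdC := (hpsd (conjC_rmorphism R)).
Context (A : 'M[C]_n) (B : 'M[C]_(n, m)).

Lemma reach_subset N N' (w : 'cV[C]_(N * m)) : (N <= N')%N ->
  exists w', reach A B N *m w = reach A B N' *m w'.
Proof.
move=> /subnK <-; elim: (N' - N)%N => [|k [w' ->]]; first by exists w.
by have [w'' [<- _]] := supply_prepend0 A B 0 0 w'; exists w''.
Qed.

Lemma col_subP p q r (L1 : 'M[C]_(p, q)) (L2 : 'M[C]_(p, r)) :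
  (forall w : 'cV[C]_q, exists w' : 'cV_r, L1 *m w = L2 *m w') <-> (L1^T <= L2^T)%MS.
Proof.
split=> [sub|/submxP [X LX] w]; last first.
  by exists (X^T *m w); rewrite mulmxA -[L1]trmxK LX trmx_mul trmxK.
apply/row_subP => i; have [w' /(congr1 trmx)] := sub (delta_mx i ord0).
by rewrite -colE tr_col => ->; rewrite trmx_mul submxMl.
Qed.

(** Otherwise each step would raise the rank, which would exceed [n] after [n + 1] steps. *)
Lemma reach_stabilizes : exists N0, forall w : 'cV[C]_(N0.+1 * m), exists w' : 'cV_(N0 * m),
  reach A B N0.+1 *m w = reach A B N0 *m w'.
Proof.
have sub N : ((reach A B N)^T <= (reach A B N.+1)^T)%MS.
  by apply/col_subP => w; exact: reach_subset.
suff [N0 rN0] : exists N0, (\rank (reach A B N0.+1) <= \rank (reach A B N0))%N.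
  exists N0; apply/col_subP.
  by rewrite -(geq_leqif (mxrank_leqif_sup (sub N0))) !mxrank_tr.
apply: contrapT => /forallNP growth.
have rk N : (N <= \rank (reach A B N))%N.
  elim: N => // N IH; apply: leq_ltn_trans IH _.
  by rewrite ltnNge; apply/negP; exact: growth.
by have := leq_trans (rk n.+1) (rank_leq_row _); rewrite ltnn.
Qed.

(** A single horizon [N0] suffices, so the reachable set is the range of one matrix and admits a
    linear projection. *)
Lemma reachable_stable : exists N0,
  (forall xi, reachable A B xi -> exists w : 'cV_(N0 * m), xi = reach A B N0 *m w) /\
  (forall xi u, reachable A B xi -> reachable A B (A *m xi + B *m u)).
Proof.
have [N0 stab] := reach_stabilizes.
have stabk k (w : 'cV[C]_((k + N0) * m)) : exists w' : 'cV_(N0 * m),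
    reach A B (k + N0) *m w = reach A B N0 *m w'.
  elim: k w => [|k IH] w; first by exists w.
  pose w1 : 'cV_(m + (k + N0) * m) := w; have -> : w = w1 by [].
  rewrite -(vsubmxK w1) reachS.
  have [v ->] := IH (dsubmx w1); rewrite -reachS; exact: stab.
exists N0; split=> [_ [N [w ->]]|_ u [N [w ->]]]; last first.
  by exists N.+1, (col_mx u w); rewrite reachS addrC.
by have [w' ->] := reach_subset w (leq_addr N0 N); exact: stabk.
Qed.

End Reachability.

Section RequiredSupply.
Context (R : realType) (n m : nat).
Local Notation C := (R[i]%C).
Local Notation Re := (@complex.Re R).
Local Notation hadjC := (hadj (conjC_rmorphism R)).
Local Notation hformC := (hform (conjC_rmorphism R)).
Local Notation hpsdC := (hpsd (conjC_rmorphism R)).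
Context (A : 'M[C]_n) (B : 'M[C]_(n, m)) (Cm : 'M[C]_(m, n)) (D : 'M[C]_m).

(* The storage is the required supply: P N is the least energy reaching a state
   from rest in N steps, which decreases with N since the input can be preceded
   by 0. *)
Lemma storage_exists :
  (forall N (w : 'cV_(N * m)), 0 <= hformC (supply A B Cm D N) w w) ->
  exists2 P : 'M[C]_n, hpsdC P & forall xi u, reachable A B xi ->
    Re (hformC P (A *m xi + B *m u) (A *m xi + B *m u)) - Re (hformC P xi xi)
      <= Re ((hadjC u *m (Cm *m xi + D *m u)) ord0 ord0).
Proof.
move=> J0; have [N0 [N0P stabA]] := reachable_stable A B.
have Jpsd N : hpsdC (supply A B Cm D N) by split; [exact: supply_herm | exact: J0].
have minP N := cid2 (hpsd_fiber_min (@conjC_rmorphismK R)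
  (@conjC_rmorphism_norm R) (reach A B N) (Jpsd N)).
pose P N : 'M[C]_n := s2val (minP N).
have Ppsd N : hpsdC (P N) := s2valP (minP N).
have Ple N (w : 'cV_(N * m)) :
    hformC (P N) (reach A B N *m w) (reach A B N *m w) <=
    hformC (supply A B Cm D N) w w.
  by have [+ _] := s2valP' (minP N); apply.
have Pmin N (w : 'cV_(N * m)) : exists w', reach A B N *m w' = reach A B N *m w /\
    hformC (P N) (reach A B N *m w) (reach A B N *m w) = hformC (supply A B Cm D N) w' w'.
  have [_ /(_ w) [w' [ww' e]]] := s2valP' (minP N).
  by exists w'; rewrite ww'.
pose Pi := reach A B N0 *m pinvmx (reach A B N0).
have PiE xi : reachable A B xi -> Pi *m xi = xi.
  by move=> /N0P [w ->]; rewrite mulmxA mulmx_pinvmxK.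
have Pireach (xi : 'cV_n) : exists w : 'cV_(N0 * m), Pi *m xi = reach A B N0 *m w.
  by exists (pinvmx (reach A B N0) *m xi); rewrite mulmxA.
(* [P N] is known to decrease with [N] only at states reachable in [N] steps, so the forms are
   compressed by the projection [Pi] and the horizon starts at [N0]. *)
pose H k := hadjC Pi *m P (k + N0) *m Pi.
have [] := @hpsd_cvg R n H.
- by move=> k; apply: (hpsd_conjmx (@conjC_rmorphismK R)); exact: Ppsd.
- move=> k v; rewrite /H -!hformM; have [w ->] := Pireach v.
  have [w1 ->] := reach_subset A B w (leq_addl k N0).
  have [w2 [<- ->]] := Pmin (k + N0) w1.
  by have [w3 [<- <-]] := supply_prepend0 A B Cm D w2; exact: Ple.
move=> G Gpsd cG; exists G => // xi u rxi.
have [cG1 _] := cG (A *m xi + B *m u); have [cG2 _] := cG xi.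
pose q k := Re (hformC (H k) (A *m xi + B *m u) (A *m xi + B *m u)).
(* The successor state is reached one step later than [xi], so its energy is compared at the next
   horizon; the limit is the same. *)
have {}cG1 : (fun k => q k.+1) @ \oo --> Re (hformC G (A *m xi + B *m u) (A *m xi + B *m u)).
  by rewrite (cvg_shiftS q).
apply: (ler_cvg_to (cvgB cG1 cG2) (cvg_cst _)); near=> k; rewrite !fctE.
rewrite /q /H -!hformM !PiE //; last exact: stabA.
have [w0 xiE] := N0P _ rxi; have [w1 w1E] := reach_subset A B w0 (leq_addl k N0).
have [w2 [w2E PE]] := Pmin (k + N0) w1.
have xiE' : xi = reach A B (k + N0) *m w2 by rewrite xiE w1E w2E.
have PxiE : hformC (P (k + N0)) xi xi = hformC (supply A B Cm D (k + N0)) w2 w2.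
  by rewrite {1 2}xiE' w2E.
have := Ple (k + N0).+1 (col_mx u w2).
rewrite reachS supplyS -xiE' [B *m u + _]addrC -PxiE lecE => /andP [_].
by rewrite ReD /= -lerBlDl.
Unshelve. all: by end_near.
Qed.

End RequiredSupply.

(** * Positive real functions on the disc *)

Section Modulus.
Context (R : realType).
Local Notation C := (R[i]%C).
Local Notation Re := (@complex.Re R).

(** The modulus as an element of [R], where limits and estimates are taken; [|z|] itself lies in
    [R[i]]. *)
Definition cabs (z : C) : R := Re `|z|.

Lemma cabsE z : ((cabs z)%:C)%C = `|z|.
Proof. by rewrite /cabs normc_def. Qed.

Lemma cabs_ge0 z : 0 <= cabs z.
Proof. by rewrite -lecR cabsE; exact: normr_ge0. Qed.

Lemma cabsD z w : cabs (z + w) <= cabs z + cabs w.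
Proof. by rewrite -lecR rmorphD /= !cabsE ler_normD. Qed.

Lemma cabsM z w : cabs (z * w) = cabs z * cabs w.
Proof. by apply: complexI; rewrite rmorphM /= !cabsE normrM. Qed.

Lemma cabsN z : cabs (- z) = cabs z.
Proof. by rewrite /cabs normrN. Qed.

Lemma cabs0 : cabs 0 = 0. Proof. by rewrite /cabs normr0 /=. Qed.
Lemma cabs1 : cabs 1 = 1. Proof. by rewrite /cabs normr1. Qed.

Lemma cabsX z k : cabs (z ^+ k) = cabs z ^+ k.
Proof.
by elim: k => [|k IH]; [rewrite cabs1 | rewrite !exprS cabsM IH].
Qed.

Lemma cabsV z : cabs z^-1 = (cabs z)^-1.
Proof. by apply: complexI; rewrite fmorphV /= !cabsE normfV. Qed.

Lemma cabs_real (x : R) : cabs (x%:C)%C = `|x|.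
Proof. by rewrite /cabs normc_def /= expr0n addr0 sqrtr_sqr. Qed.

Lemma cabs_conj z : cabs (z^*)%C = cabs z.
Proof. by rewrite /cabs norm_conjC. Qed.

Lemma cabs_eq0 z : (cabs z == 0) = (z == 0).
Proof. by rewrite -(inj_eq (@complexI R)) cabsE normr_eq0. Qed.

Lemma cabs_gt0 z : (0 < cabs z) = (z != 0).
Proof. by rewrite lt_def cabs_ge0 cabs_eq0 andbT. Qed.

Lemma cabs_sum (I : Type) (r : seq I) (P : pred I) (F : I -> C) :
  cabs (\sum_(i <- r | P i) F i) <= \sum_(i <- r | P i) cabs (F i).
Proof.
elim/big_rec2: _ => [|i x y _ xy]; first by rewrite cabs0.
by apply: le_trans (cabsD _ _) _; rewrite lerD2l.
Qed.

Lemma Re_cabs z : `|Re z| <= cabs z.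
Proof. by rewrite -lecR cabsE; exact: normc_ge_Re. Qed.

Lemma cabs_B_ge z w : cabs z - cabs w <= cabs (z - w).
Proof.
by rewrite lerBlDr -{1}(subrK w z); exact: cabsD.
Qed.

End Modulus.

(** * Roots of unity and positivity of Toeplitz forms *)

Section Toeplitz.
Context (R : realType).
Local Notation C := (R[i]%C).
Local Notation Re := (@complex.Re R).
Local Notation hadjC := (hadj (conjC_rmorphism R)).
Local Notation hformC := (hform (conjC_rmorphism R)).

(** In characteristic 0, [X^L - 1] is separable, so it has [L] distinct roots; these form a cyclic
    group. *)
Lemma prim_rootC_exists L : (0 < L)%N -> exists w : C, L.-primitive_root w.
Proof.
move=> L0; have [rs rsE] := closed_field_poly_normal ('X^L - 1%:P : {poly C}).
have lc : lead_coef ('X^L - 1%:P : {poly C}) = 1.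
  by apply/monicP; exact: monicXnsubC.
rewrite lc scale1r in rsE.
have size_rs : size rs = L.
  have := congr1 (fun p : {poly C} => size p) rsE.
  by rewrite size_prod_XsubC size_XnsubC // => -[].
have uniq_rs : uniq rs.
  rewrite -separable_prod_XsubC -rsE polyC1; apply: separable_Xn_sub_1.
  by rewrite pnatr_eq0 -lt0n.
have allr : all L.-unity_root rs.
  apply/allP => z; rewrite -root_prod_XsubC -rsE => zr.
  exact: zr.
have := has_prim_root L0 allr uniq_rs; rewrite size_rs leqnn => /(_ isT).
by move=> /hasP [w _ ww]; exists w.
Qed.

(** For [k <> j] this is a geometric sum whose ratio [t] satisfies [t <> 1] and [t^L = 1]. *)
Lemma sum_root_of_unity L (w : C) k j : L.-primitive_root w ->
  (k < L)%N -> (j < L)%N ->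
  \sum_(i < L) (w ^+ i) ^+ k * (((w ^+ i) ^+ j)^*)%C = L%:R * (k == j)%:R.
Proof.
move=> wL kL jL; have L0 := prim_order_gt0 wL.
have w_norm : w * (w^*)%C = 1.
  have : `|w| = 1.
    apply/eqP; rewrite -(@pexpr_eq1 _ `|w| L) //.
    by rewrite -normrX (prim_expr_order wL) normr1.
  by move=> w1; have := sqr_normc w; rewrite w1 expr1n => <-.
have [-> | kj] := eqVneq k j.
  rewrite mulr1 (eq_bigr (fun=> 1)) ?sumr_const ?card_ord // => i _.
  by rewrite rmorphXn rmorphXn /= -exprMn -exprMn w_norm !expr1n.
pose t := w ^+ k * ((w ^+ j)^*)%C.
have tE (i : 'I_L) : (w ^+ i) ^+ k * (((w ^+ i) ^+ j)^*)%C = t ^+ i.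
  by rewrite /t exprMn -rmorphXn /= -!exprM ![(i * _)%N]mulnC.
under eq_bigr do rewrite tE.
have tL : t ^+ L = 1.
  by rewrite /t exprMn -rmorphXn /= -!exprM ![(_ * L)%N]mulnC !exprM
    (prim_expr_order wL) !expr1n rmorph1 mulr1.
have t1 : t - 1 != 0.
  rewrite subr_eq0; apply: contra kj => /eqP t1.
  have : w ^+ k = w ^+ j.
    rewrite -[LHS]mulr1 -(expr1n _ j) -w_norm exprMn -rmorphXn /=.
    by rewrite mulrCA -/t t1 mulr1.
  move/eqP; rewrite (eq_prim_root_expr wL) !modn_small //.
apply/eqP; rewrite mulr0 -(inj_eq (mulfI t1)) mulr0 -subrX1 tL subrr //.
Qed.

Lemma horner_continuous (p : {poly R}) : continuous (fun y => p.[y]).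
Proof.
elim/poly_ind: p => [|p c IH] x.
  by under eq_fun do rewrite horner0; exact: cvg_cst.
under eq_fun do rewrite hornerMXaddC.
apply: cvgD; last exact: cvg_cst.
by apply: cvgM; [exact: IH | exact: cvg_id].
Qed.

(** Continuity at the end point. It serves for two limits: the radius tending to 1 in the Toeplitz
    form, and [s] tending to a possible pole along a ray. *)
Lemma poly_ge0_right (p : {poly R}) (d : R) : 0 < d ->
  (forall r, 0 < r < d -> 0 <= p.[r]) -> 0 <= p.[0].
Proof.
move=> d0 p0; rewrite leNgt; apply/negP => pn.
have /cvgrPdist_lt /(_ (- p.[0])) := @horner_continuous p 0.
rewrite oppr_gt0 => /(_ pn) /nbhs_ballP [e /= e0 ball_e].
pose r := Num.min d e / 2.
have r0 : 0 < r by rewrite divr_gt0 // lt_min d0.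
have re : r < Num.min d e by rewrite ltr_pdivrMr // ltr_pMr ?lt_min ?d0 ?ltr1n.
have [rd re'] : r < d /\ r < e by move: re; rewrite lt_min => /andP.
have : ball 0 e r by rewrite /ball /= sub0r normrN gtr0_norm.
move=> /ball_e; have := p0 r; rewrite r0 rd => /(_ isT) pr.
by rewrite ltr_norml => /andP [+ _]; lra.
Qed.

Lemma poly_ge0_at1 (p : {poly R}) :
  (forall r, 0 < r < 1 -> 0 <= p.[r]) -> 0 <= p.[1].
Proof.
move=> p0; have := @poly_ge0_right (p \Po (1 - 'X)) 1 ltr01.
rewrite horner_comp !hornerE subr0; apply=> r /andP [r0 r1].
by rewrite horner_comp !hornerE; apply: p0; lra.
Qed.

End Toeplitz.

Section ToeplitzForm.
Context (R : realType) (m : nat).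
Local Notation C := (R[i]%C).
Local Notation Re := (@complex.Re R).
Local Notation hadjC := (hadj (conjC_rmorphism R)).
Local Notation hformC := (hform (conjC_rmorphism R)).

Lemma hform_sumr p (G : 'M[C]_p) v N (w : 'I_N -> 'cV_p) :
  hformC G v (\sum_i w i) = \sum_i hformC G v (w i).
Proof. by rewrite /hform mulmx_sumr summxE. Qed.

Lemma hform_suml p (G : 'M[C]_p) w N (v : 'I_N -> 'cV_p) :
  hformC G (\sum_i v i) w = \sum_i hformC G (v i) w.
Proof. by rewrite /hform /hadj linear_sum map_mx_sum !mulmx_suml summxE. Qed.

Lemma hform_summ p N (G : 'I_N -> 'M[C]_p) v w :
  hformC (\sum_i G i) v w = \sum_i hformC (G i) v w.
Proof. by rewrite /hform mulmx_sumr mulmx_suml summxE. Qed.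

Lemma hform_scalem p a (G : 'M[C]_p) v w :
  hformC (a *: G) v w = a * hformC G v w.
Proof. by rewrite /hform -scalemxAr -scalemxAl mxE. Qed.

Lemma cabs_hform_le p (G : 'M[C]_p) v (e : R) :
  (forall i j, cabs (G i j) <= e) ->
  cabs (hformC G v v) <= e * (\sum_i cabs (v i ord0)) ^+ 2.
Proof.
move=> Ge; rewrite hformE; apply: le_trans (cabs_sum _ _ _) _.
rewrite expr2 mulr_sumr mulr_sumr; apply: ler_sum => j _.
apply: le_trans (cabs_sum _ _ _) _.
rewrite mulrCA mulr_suml; apply: ler_sum => i _.
rewrite !cabsM cabs_conj -mulrA ler_wpM2l ?cabs_ge0 //.
by rewrite ler_wpM2r ?cabs_ge0.
Qed.

Context (M : nat -> 'M[C]_m) (T : C -> 'M[C]_m).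
Hypothesis T_pos : forall z v, cabs z < 1 -> 0 <= Re (hformC (T z) v v).
Hypothesis T_series : forall r e : R, 0 < r < 1 -> 0 < e ->
  exists L0 : nat, forall L z, (L0 <= L)%N -> cabs z = r ->
  forall i j, cabs (T z i j - \sum_(l < L) M l i j * z ^+ l) <= e.

Let psum L z : 'M[C]_m := \sum_(l < L) z ^+ l *: M l.

Let trig N (u : nat -> 'cV[C]_m) (z : C) : 'cV_m := \sum_(k < N) z ^+ k *: u k.

Lemma psum_trig L N u (r z : C) :
  hformC (psum L (r * z)) (trig N u z) (trig N u z) =
  \sum_(k < N) \sum_(j < N) \sum_(l < L)
    (z ^+ (l + j) * ((z ^+ k)^*)%C) * (r ^+ l * hformC (M l) (u k) (u j)).
Proof.
rewrite hform_suml; apply: eq_bigr => k _; rewrite hform_sumr; apply: eq_bigr => j _.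
rewrite hform_summ; apply: eq_bigr => l _.
rewrite hform_scalem hformZl hformZr conjC_rmorphismE exprMn exprD; ring.
Qed.

(** The average keeps the terms with [l + j = k]. The order [L + N] exceeds all exponents, so
    nothing wraps around, and [N <= L] ensures that [l = k - j] occurs in the truncated series. *)
Lemma psum_trig_average L N u (r w : C) : (N <= L)%N ->
  (L + N).-primitive_root w ->
  \sum_(i < L + N) hformC (psum L (r * w ^+ i)) (trig N u (w ^+ i)) (trig N u (w ^+ i))
  = (L + N)%:R *
    \sum_(k < N) \sum_(j < N | (j <= k)%N) r ^+ (k - j) * hformC (M (k - j)) (u k) (u j).
Proof.
move=> NL wL; under eq_bigr do rewrite psum_trig.
rewrite exchange_big mulr_sumr; apply: eq_bigr => k _ /=.
rewrite exchange_big mulr_sumr [RHS]big_mkcond; apply: eq_bigr => j _ /=.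
rewrite exchange_big /=.
have kL : (k < L + N)%N by rewrite ltn_addl.
under eq_bigr => l _.
  rewrite -mulr_suml (sum_root_of_unity wL) //; last first.
    by rewrite -addSn leq_add // ltnW.
  over.
case: ifPn => [jk | jk].
  have kjL : (k - j < L)%N.
    by apply: leq_ltn_trans (leq_subr _ _) _; apply: leq_trans NL.
  rewrite (bigD1 (Ordinal kjL)) //= subnK // eqxx mulr1 big1 ?addr0 //.
  move=> l; rewrite -val_eqE /= => lkj.
  by rewrite -[X in _ == X](subnK jk) eqn_add2r (negPf lkj) mulr0 mul0r.
rewrite big1 // => l _; rewrite (_ : (_ == _) = false) ?mulr0 ?mul0r //.
by apply/negP => /eqP lj; move: jk; rewrite -lj leq_addl.
Qed.

(* Caratheodory-Toeplitz: at radius r < 1, the Toeplitz form is the average over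
   roots of unity z of large order of the form T (r z) at a trigonometric
   polynomial. *)
Lemma toeplitz_ge0 N (u : nat -> 'cV[C]_m) :
  0 <= \sum_(k < N) \sum_(j < N | (j <= k)%N) Re (hformC (M (k - j)) (u k) (u j)).
Proof.
pose a (k j : nat) := Re (hformC (M (k - j)) (u k) (u j)).
pose p : {poly R} := \sum_(k < N) \sum_(j < N | (j <= k)%N) (a k j) *: 'X^(k - j).
have pE r : p.[r] = \sum_(k < N) \sum_(j < N | (j <= k)%N) a k j * r ^+ (k - j).
  rewrite horner_sum; apply: eq_bigr => k _; rewrite horner_sum; apply: eq_bigr => j _.
  by rewrite hornerZ hornerXn.
suff : 0 <= p.[1].
  rewrite pE; congr (_ <= _); apply: eq_bigr => k _; apply: eq_bigr => j _.
  by rewrite expr1n mulr1.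
apply: poly_ge0_at1 => r r01; have /andP [r0 r1] := r01.
pose b := \sum_(i < m) \sum_(k < N) cabs (u k i ord0).
have b0 : 0 <= b by do 2![apply: sumr_ge0 => ? _]; exact: cabs_ge0.
(* On the unit circle [b] bounds the sum of the moduli of the entries of the trigonometric
   polynomial, so an error [e] in the series costs at most [e b^2], however many roots of unity are
   averaged. *)
suff eP e : 0 < e -> - (e * b ^+ 2) <= p.[r].
  rewrite leNgt; apply/negP => pn.
  have b21 : 0 < b ^+ 2 + 1 by rewrite ltr_wpDl // exprn_ge0.
  have := eP (- p.[r] / (b ^+ 2 + 1)); rewrite divr_gt0 ?oppr_gt0 // => /(_ isT).
  set x := p.[r]; set y := b ^+ 2.
  rewrite (_ : - (- x / (y + 1) * y) = x * y / (y + 1)); last by ring.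
  by rewrite ler_pdivrMr // mulrDr mulr1 lerDl leNgt pn.
move=> e0; have [L0 L0P] := T_series r01 e0.
pose L := maxn (maxn L0 N) 1; pose L1 := (L + N)%N.
have L1_gt0 : (0 < L1)%N by rewrite addn_gt0 leq_max orbT.
have [w wL] := prim_rootC_exists R L1_gt0.
have w1 i : cabs (w ^+ i) = 1.
  apply/eqP; rewrite -(@pexpr_eq1 _ _ L1) ?cabs_ge0 //.
  by rewrite -cabsX -exprM mulnC exprM (prim_expr_order wL) expr1n cabs1.
have NL : (N <= L)%N by rewrite /L; lia.
have L0L : (L0 <= L)%N by rewrite /L; lia.
have avg := psum_trig_average u ((r%:C)%C) NL wL.
have le_av (i : 'I_L1) : - (e * b ^+ 2) <=
  Re (hformC (psum L ((r%:C)%C * w ^+ i)) (trig N u (w ^+ i)) (trig N u (w ^+ i))).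
  set z := (r%:C)%C * w ^+ i; set v := trig N u (w ^+ i).
  have zr : cabs z = r by rewrite cabsM w1 mulr1 cabs_real gtr0_norm.
  have psumE : psum L z = T z - (T z - psum L z) by rewrite opprB addrC subrK.
  have -> : hformC (psum L z) v v = hformC (T z) v v - hformC (T z - psum L z) v v.
    by rewrite /hform {1}psumE mulmxBr mulmxBl [LHS]mxE [X in _ + X = _]mxE.
  rewrite ReB; apply: le_trans (_ : - Re (hformC (T z - psum L z) v v) <= _).
    rewrite lerN2; apply: le_trans (ler_norm _) _; apply: le_trans (Re_cabs _) _.
    apply: le_trans (cabs_hform_le _ (e := e) _) _ => [i1 j1|].
      rewrite !mxE summxE; under eq_bigr do rewrite mxE mulrC.
      by apply: L0P.
    apply: ler_wpM2l; first exact: ltW.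
    apply: lerXn2r; rewrite ?nnegrE //; first by apply: sumr_ge0 => ? _; exact: cabs_ge0.
    apply: ler_sum => i1 _; rewrite summxE; apply: le_trans (cabs_sum _ _ _) _.
    by apply: ler_sum => k _; rewrite mxE cabsM cabsX w1 expr1n mul1r.
  by rewrite lerDr T_pos // zr.
have L1R : 0 < L1%:R :> R by rewrite ltr0n.
rewrite -(ler_pM2l L1R) pE.
have := congr1 Re avg; rewrite Re_sum => avgR.
have -> : L1%:R * (\sum_(k < N) \sum_(j < N | (j <= k)%N) a k j * r ^+ (k - j)) =
   \sum_(i < L1) Re (hformC (psum L ((r%:C)%C * w ^+ i))
     (trig N u (w ^+ i)) (trig N u (w ^+ i))).
  rewrite avgR -[L1%:R in RHS](rmorph_nat (real_complex R)) ReM /= mul0r subr0.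
  congr (_ * _); rewrite Re_sum; apply: eq_bigr => k _; rewrite Re_sum; apply: eq_bigr => j _.
  by rewrite -rmorphXn ReM /= mul0r subr0 mulrC.
apply: le_trans (ler_sum _ (fun i _ => le_av i)).
by rewrite sumr_const card_ord mulr_natl.
Qed.

End ToeplitzForm.

(** * Taylor series of rational functions on the disc *)

Section RationalSeries.
Context (R : realType).
Local Notation C := (R[i]%C).
Implicit Types (q p : {poly C}) (M : nat -> C).

(** The coefficients of [q] times the formal power series with coefficients [M]. *)
Definition cauchy_conv q M (l : nat) : C := \sum_(i < l.+1) q`_i * M (l - i)%N.

Lemma cauchy_convE q M L l : (l < L)%N ->
  cauchy_conv q M l = (q * \poly_(i < L) M i)`_l.
Proof.
move=> lL; rewrite coefM; apply: eq_bigr => i _; rewrite coef_poly.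
by rewrite (leq_ltn_trans (leq_subr _ _) lL).
Qed.

Lemma cauchy_convM q1 q2 M l :
  cauchy_conv (q1 * q2) M l = cauchy_conv q1 (cauchy_conv q2 M) l.
Proof.
rewrite (cauchy_convE _ _ (ltnSn l)) -mulrA coefM; apply: eq_bigr => i _.
by rewrite -cauchy_convE // ltnS leq_subr.
Qed.

Lemma cauchy_convZ c q M l : cauchy_conv (c *: q) M l = c * cauchy_conv q M l.
Proof. by rewrite /cauchy_conv mulr_sumr; apply: eq_bigr => i _; rewrite coefZ mulrA. Qed.

Lemma cauchy_conv1 M l : cauchy_conv 1 M l = M l.
Proof.
rewrite /cauchy_conv big_ord_recl big1 ?addr0 => [|i _].
  by rewrite coef1 eqxx mul1r subn0.
by rewrite coef1 mul0r.
Qed.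

Lemma cauchy_conv_XsubC z M l :
  cauchy_conv ('X - z%:P) M l = (if l is l'.+1 then M l' else 0) - z * M l.
Proof.
rewrite (cauchy_convE _ _ (ltnSn l)) mulrBl coefB coefXM coefCM !coef_poly.
by case: l => [|l] /=; rewrite ?ltnS ?leqnn ?leqnSn.
Qed.

(* Subexponential growth: the radius of convergence is at least 1. *)
Definition subexp M : Prop := forall rho : R, 0 < rho < 1 ->
  exists c, forall l, cabs (M l) * rho ^+ l <= c.

(** Solving [g_l = M_(l-1) - z M_l] for [M_l] divides by [z], which enlarges nothing; the bound then
    adds up along the recursion. *)
Lemma cabs_le_sum_conv z M l : 1 <= cabs z ->
  cabs (M l) <= \sum_(i < l.+1) cabs (cauchy_conv ('X - z%:P) M i).
Proof.
move=> z1; have le_z x : cabs x <= cabs (z * x) by rewrite cabsM ler_peMl ?cabs_ge0.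
elim: l => [|l IH].
  by rewrite big_ord1 cauchy_conv_XsubC sub0r cabsN.
rewrite big_ord_recr /= cauchy_conv_XsubC.
have := cabsD (M l) (- (M l - z * M l.+1)).
rewrite cabsN opprB addrCA subrr addr0 => /(le_trans (le_z _)) /le_trans; apply.
by rewrite lerD2r.
Qed.

Lemma subexp_XsubC z M : 1 <= cabs z ->
  subexp (cauchy_conv ('X - z%:P) M) -> subexp M.
Proof.
move=> z1 grow rho /andP [r0 r1].
(* The room between [rho] and [s] turns the accumulated sum into a geometric series of ratio
   [rho / s < 1]. *)
pose s := (rho + 1) / 2; have s0 : 0 < s by rewrite /s; lra.
have rs : rho < s by rewrite /s; lra.
have s1 : s < 1 by rewrite /s; lra.
have [|c cP] := grow s; first by rewrite s0.
have c0 : 0 <= c by apply: le_trans (cP 0%N); rewrite mulr_ge0 ?cabs_ge0.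
have t1 : 0 < 1 - rho / s by rewrite subr_gt0 ltr_pdivrMr // mul1r.
exists (c / (1 - rho / s)) => l; rewrite ler_pdivlMr //.
apply: le_trans (_ : c * (\sum_(i < l.+1) (rho / s) ^+ i) * (1 - rho / s) <= _); last first.
  rewrite -mulrA ler_piMr // mulrC -opprB mulNr -subrX1 opprB gerBl.
  by rewrite exprn_ge0 // divr_ge0 // ltW.
rewrite ler_wpM2r ?(ltW t1) // mulr_sumr.
apply: le_trans (_ : (\sum_(i < l.+1) cabs (cauchy_conv ('X - z%:P) M i)) * rho ^+ l <= _).
  by rewrite ler_wpM2r ?exprn_ge0 ?(ltW r0) //; exact: cabs_le_sum_conv.
rewrite mulr_suml; apply: ler_sum => i _.
rewrite exprMn exprVn mulrA; rewrite ler_pdivlMr ?exprn_gt0 // mulrAC.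
apply: le_trans (_ : c * rho ^+ l <= _).
  by rewrite ler_wpM2r ?exprn_ge0 ?(ltW r0).
by rewrite ler_wpM2l // ler_wiXn2l ?(ltW r0) ?(ltW r1) // -ltnS.
Qed.

Lemma subexp_coef p : subexp (fun l => p`_l).
Proof.
move=> rho /andP [r0 r1]; exists (\sum_(i < size p) cabs p`_i) => l.
have [pl|lp] := leqP (size p) l.
  rewrite nth_default // cabs0 mul0r; apply: sumr_ge0 => i _; exact: cabs_ge0.
rewrite (bigD1 (Ordinal lp)) //=; apply: ler_wpDr.
  by apply: sumr_ge0 => i _; exact: cabs_ge0.
by rewrite ler_piMr ?cabs_ge0 // exprn_ile1 // ltW.
Qed.

(** Dividing by [q] is dividing by its linear factors one at a time. Roots on the circle itself are
    allowed, which is why growth is measured at every [rho < 1] and not at 1. *)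
Lemma subexp_cauchy_conv q M : (forall z, root q z -> 1 <= cabs z) -> q != 0 ->
  subexp (cauchy_conv q M) -> subexp M.
Proof.
move=> q_root q0; have [zs qE] := closed_field_poly_normal q.
have lc0 : lead_coef q != 0 by rewrite lead_coef_eq0.
have zs1 z : z \in zs -> 1 <= cabs z.
  by move=> zzs; apply: q_root; rewrite qE rootZ // root_prod_XsubC.
rewrite qE => grow.
have {grow} : subexp (cauchy_conv (\prod_(z <- zs) ('X - z%:P)) M).
  move=> rho rho01; have [c cP] := grow rho rho01.
  exists (c / cabs (lead_coef q)) => l.
  rewrite ler_pdivlMr ?cabs_gt0 //; have := cP l.
  by rewrite cauchy_convZ cabsM -mulrA mulrC.
elim: zs zs1 M {qE} => [|z zs IH] zs1 M.
  by rewrite big_nil => grow rho /grow [c cP]; exists c => l; rewrite -cauchy_conv1.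
rewrite big_cons mulrC => grow; apply: (@subexp_XsubC z).
  by apply: zs1; rewrite mem_head.
apply: IH => [y yzs|rho /grow [c cP]].
  by apply: zs1; rewrite inE yzs orbT.
by exists c => l; rewrite -cauchy_convM.
Qed.

(** [q] times the truncated series agrees with [p] below degree [L] and has at most [size q] further
    coefficients. The one of index [l] is bounded by a multiple of [rho^-l] with [r < rho < 1], so
    at [|z| = r] the error decays like [(r / rho)^L]. *)
Lemma rat_series_cvg p q M :
  (forall L, 'X^L %| q * \poly_(l < L) M l - p) ->
  (forall z, root q z -> 1 <= cabs z) -> q != 0 ->
  forall r e : R, 0 < r < 1 -> 0 < e ->
  exists L0 : nat, forall L z, (L0 <= L)%N -> cabs z = r ->
  cabs (p.[z] / q.[z] - \sum_(l < L) M l * z ^+ l) <= e.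
Proof.
move=> dvd q_root q0 r e r01 e0; have /andP [r0 r1] := r01.
have lowE L l : (l < L)%N -> (q * \poly_(l < L) M l - p)`_l = 0.
  by move=> lL; have /dvdpP [h ->] := dvd L; rewrite coefMXn lL.
have convE l : cauchy_conv q M l = p`_l.
  rewrite (cauchy_convE _ _ (ltnSn l)); apply/eqP; rewrite -subr_eq0 -coefB.
  by rewrite lowE.
have Mgrow : subexp M.
  apply: (subexp_cauchy_conv q_root q0) => rho /(subexp_coef p) [c cP].
  by exists c => l; rewrite convE.
pose rho := (r + 1) / 2; have rr : r < rho by rewrite /rho; lra.
have rho01 : 0 < rho < 1 by rewrite /rho; lra.
have rho0 : 0 < rho by case/andP: rho01.
have [c cP] := Mgrow _ rho01.
have c0 : 0 <= c by apply: le_trans (cP 0%N); rewrite mulr_ge0 ?cabs_ge0.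
pose c' := c * \sum_(i < size q) cabs q`_i.
have c'0 : 0 <= c' by rewrite mulr_ge0 // sumr_ge0 // => i _; exact: cabs_ge0.
have coef_le L l : cabs (q * \poly_(l < L) M l)`_l * rho ^+ l <= c'.
  have {1}-> : q = \sum_(i < size q) q`_i *: 'X^i by rewrite -poly_def coefK.
  rewrite mulr_suml coef_sum.
  apply: le_trans (_ : (\sum_(i < size q) cabs q`_i * c) <= _); last first.
    by rewrite -mulr_suml mulrC.
  apply: le_trans (ler_wpM2r _ (cabs_sum _ _ _)) _; first by rewrite exprn_ge0 ?ltW.
  rewrite mulr_suml; apply: ler_sum => i _.
  rewrite -scalerAl coefZ cabsM -mulrA ler_wpM2l ?cabs_ge0 // coefXnM.
  case: ltnP => [_|il]; first by rewrite cabs0 mul0r.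
  rewrite coef_poly; case: ifP => _; last by rewrite cabs0 mul0r.
  apply: le_trans (cP (l - i)%N); rewrite ler_wpM2l ?cabs_ge0 //.
  by rewrite ler_wiXn2l ?leq_subr ?ltW //; case/andP: rho01.
pose t := r / rho; have t0 : 0 < t by rewrite divr_gt0.
have t1 : t < 1 by rewrite ltr_pdivrMr // mul1r.
have err_le L z : (size p <= L)%N -> cabs z = r ->
    cabs (q * \poly_(l < L) M l - p).[z] <= (size q)%:R * c' * t ^+ L.
  move=> pL zr; rewrite (@horner_coef_wide _ (L + size q)); last first.
    apply: leq_trans (size_polyD _ _) _; rewrite geq_max size_polyN.
    rewrite (leq_trans pL) ?leq_addr // andbT.
    apply: leq_trans (size_polyMleq _ _) _.
    apply: leq_trans (leq_pred _) _; rewrite addnC leq_add2r.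
    exact: size_poly.
  rewrite big_split_ord /= big1 ?add0r => [|i _]; last by rewrite lowE ?mul0r.
  apply: le_trans (cabs_sum _ _ _) _.
  rewrite -mulrA mulr_natl -[X in _ *+ X]card_ord -sumr_const.
  apply: ler_sum => i _; have pi0 : p`_(L + i) = 0.
    by rewrite nth_default // (leq_trans pL) ?leq_addr.
  rewrite cabsM cabsX zr coefB pi0 subr0.
  apply: le_trans (_ : c' * t ^+ (L + i) <= _).
    rewrite exprMn exprVn mulrA ler_pdivlMr ?exprn_gt0 // mulrAC.
    by apply: ler_wpM2r; [rewrite exprn_ge0 // ltW | exact: coef_le].
  by rewrite ler_wpM2l // ler_wiXn2l ?leq_addr ?ltW.
(* Every root of [q] is at distance at least [1 - r] from the circle of radius [r]. *)
have [mu mu0 muP] : exists2 mu : R, 0 < mu & forall z, cabs z = r -> mu <= cabs q.[z].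
  have [zs qE] := closed_field_poly_normal q.
  have lc0 : lead_coef q != 0 by rewrite lead_coef_eq0.
  have zs1 z : z \in zs -> 1 <= cabs z.
    by move=> zzs; apply: q_root; rewrite qE rootZ // root_prod_XsubC.
  exists (cabs (lead_coef q) * (1 - r) ^+ size zs) => [|z zr].
    by rewrite mulr_gt0 ?cabs_gt0 ?exprn_gt0 ?subr_gt0.
  rewrite {2}qE hornerZ cabsM ler_wpM2l ?cabs_ge0 //.
  elim: zs zs1 {qE} => [|y zs IH] zs1; first by rewrite big_nil hornerC cabs1.
  rewrite big_cons hornerM cabsM /= exprS.
  apply: ler_pM; rewrite ?exprn_ge0 ?subr_ge0 ?(ltW r1) //.
    rewrite !hornerE -cabsN opprB; apply: le_trans (cabs_B_ge _ _).
    by rewrite zr lerB // zs1 // mem_head.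
  by apply: IH => x xzs; apply: zs1; rewrite inE xzs orbT.
pose B := (size q)%:R * c' / mu.
have B0 : 0 <= B.
  by apply: divr_ge0; [apply: mulr_ge0; [exact: ler0n | exact: c'0] | exact: ltW].
have /cvgrPdist_le /(_ (e / (B + 1))) : (GRing.exp t) @ \oo --> (0 : R).
  by apply: cvg_expr; rewrite gtr0_norm.
have B1 : 0 < B + 1 by rewrite ltr_wpDl.
rewrite divr_gt0 // => /(_ isT) [L0 _ L0P].
exists (maxn L0 (size p)) => L z; rewrite geq_max => /andP [L0L pL] zr.
have qz0 : q.[z] != 0 by rewrite -cabs_gt0 (lt_le_trans mu0) ?muP.
have -> : p.[z] / q.[z] - \sum_(l < L) M l * z ^+ l =
    - ((q * \poly_(l < L) M l - p).[z] / q.[z]).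
  rewrite hornerD hornerN hornerM mulrBl opprB mulrAC divff // mul1r.
  by congr (_ - _); rewrite horner_poly.
rewrite cabsN cabsM cabsV ler_pdivrMr ?cabs_gt0 //.
apply: le_trans (err_le _ _ pL zr) _.
apply: le_trans (_ : e * mu <= _); last by rewrite ler_wpM2l ?muP // ltW.
rewrite -ler_pdivrMr // mulrAC -/B.
have := L0P L L0L; rewrite /= sub0r normrN ger0_norm ?exprn_ge0 ?(ltW t0) //.
rewrite ler_pdivlMr // => tL; apply: le_trans tL.
by rewrite mulrDr mulr1 mulrC lerDl exprn_ge0 ?ltW.
Qed.

End RationalSeries.

(** * Markov parameters and nonnegativity of the supply *)

Section MarkovParameters.
Context (R : realType) (n m : nat).
Local Notation C := (R[i]%C).
Local Notation Re := (@complex.Re R).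
Local Notation hadjC := (hadj (conjC_rmorphism R)).
Local Notation hformC := (hform (conjC_rmorphism R)).
Context (A : 'M[C]_n) (B : 'M[C]_(n, m)) (Cm : 'M[C]_(m, n)) (D : 'M[C]_m).

Definition markov (l : nat) : 'M[C]_m :=
  if l is l'.+1 then Cm *m A ^+ l' *m B else D.

Lemma mulmx_exprS l : A *m A ^+ l = A ^+ l.+1.
Proof. by rewrite exprS. Qed.

(** Unstacks [w] into inputs in chronological order, which turns the recursively defined supply into
    a Toeplitz form. *)
Lemma reach_sequence N (w : 'cV[C]_(N * m)) : exists u : nat -> 'cV[C]_m,
  reach A B N *m w = \sum_(j < N) A ^+ (N - j).-1 *m (B *m u j) /\
  hformC (supply A B Cm D N) w w = ((\sum_(k < N) \sum_(j < N | (j <= k)%N)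
    Re (hformC (markov (k - j)) (u k) (u j)))%:C)%C.
Proof.
elim: N w => [|N IH] w.
  by exists (fun=> 0); rewrite !big_ord0 /hform !(mulmx0, mul0mx) !mxE.
pose w1 : 'cV_(m + N * m) := w; have -> : w = w1 by [].
rewrite -(vsubmxK w1); move: (usubmx w1) (dsubmx w1) => a v.
have [u [uE sE]] := IH v.
pose u' k := if k == N then a else u k.
have u'E (j : 'I_N) : u' j = u j by rewrite /u' ltn_eqF.
have u'N : u' N = a by rewrite /u' eqxx.
have rE : reach A B N *m v = \sum_(j < N) A ^+ (N - j).-1 *m (B *m u' j).
  by rewrite uE; apply: eq_bigr => j _; rewrite u'E.
exists u'; split.
  rewrite reachS big_ord_recr /= u'N subSnn expr0 mul1mx addrC rE; congr (_ + _).
  rewrite mulmx_sumr; apply: eq_bigr => j _.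
  by rewrite mulmxA mulmx_exprS subSn ?prednK ?subn_gt0 // ltnW.
rewrite supplyS sE -rmorphD /=; congr ((_)%:C)%C.
rewrite big_ord_recr /=; congr (_ + _).
  apply: eq_bigr => k _; rewrite [RHS]big_mkcond big_ord_recr /= leqNgt ltn_ord /= addr0.
  by rewrite [LHS]big_mkcond; apply: eq_bigr => j _; rewrite !u'E.
rewrite rE [RHS]big_mkcond big_ord_recr /= leqnn subnn u'N /= mulmxDr !mulmx_sumr.
have addE (X Y : 'M[C]_1) : (X + Y) ord0 ord0 = X ord0 ord0 + Y ord0 ord0.
  by rewrite mxE.
rewrite addE ReD summxE Re_sum /hform [_ *m (D *m a)]mulmxA; congr (_ + _).
apply: eq_bigr => j _; rewrite ltnW // -(prednK (_ : 0 < N - j)%N) ?subn_gt0 //=.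
by rewrite !mulmxA.
Qed.

Let Q : 'M[{poly C}]_n := 1%:M - 'X *: map_mx polyC A.

(** The numerator of [D + z C (1 - z A)^-1 B] over the denominator [det (1 - z A)]. *)
Definition statespace_num : 'M[{poly C}]_m := \det Q *: map_mx polyC D +
  'X *: (map_mx polyC Cm *m \adj Q *m map_mx polyC B).

(** The geometric sum satisfies [Q S = 1 - X^L A^L]; multiplied by the adjugate of [Q] and by the
    outer [X], its error is divisible by [X^(L+1)]. *)
Lemma mul_delta_markov i j L :
  'X^L %| \det Q * \poly_(l < L) markov l i j - statespace_num i j.
Proof.
rewrite /statespace_num.
case: L => [|L]; first by rewrite expr0 dvd1p.
pose pA := map_mx (@polyC C) A; pose S_ k := \sum_(l < k) 'X^l *: pA ^+ l.
pose S := S_ L; have QS : Q *m S = 1%:M - 'X^L *: pA ^+ L.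
  rewrite /S /S_; elim: L {S} => [|L IH].
    by rewrite big_ord0 mulmx0 expr0 scale1r expr0 subrr.
  rewrite big_ord_recr mulmxDr IH /= [Q *m _]mulmxBl mul1mx -scalemxAl -scalemxAr scalerA.
  by rewrite -exprS -[pA *m _]exprS addrA subrK.
have dS : \det Q *: S = \adj Q *m (1%:M - 'X^L *: pA ^+ L).
  by rewrite -QS mulmxA mul_adj_mx -mul_scalar_mx.
have polyE : \poly_(l < L.+1) markov l i j =
   (map_mx polyC D + 'X *: (map_mx polyC Cm *m S *m map_mx polyC B)) i j.
  have pAX l : pA ^+ l = map_mx (@polyC C) (A ^+ l).
    elim: l => [|l IH]; first by rewrite !expr0 map_mx1.
    by rewrite !exprS IH; exact/esym/map_mxM.
  rewrite poly_def big_ord_recl /= expr0 alg_polyC [RHS]mxE.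
  rewrite [X in X + _ = _](_ : _ = map_mx polyC D i j); last by rewrite mxE.
  congr (_ + _); rewrite mulmx_sumr mulmx_suml scaler_sumr summxE.
  apply: eq_bigr => l _; rewrite -scalemxAr -scalemxAl scalerA -exprS pAX -!map_mxM.
  by rewrite [RHS]mxE [map_mx _ _ _ _]mxE -mul_polyC mulrC.
rewrite polyE.
have -> : \det Q * (map_mx polyC D + 'X *: (map_mx polyC Cm *m S *m map_mx polyC B)) i j =
  (\det Q *: (map_mx polyC D + 'X *: (map_mx polyC Cm *m S *m map_mx polyC B))) i j.
  by rewrite [RHS]mxE.
rewrite -[X in _ %| X](_ : (\det Q *: (map_mx polyC D +
      'X *: (map_mx polyC Cm *m S *m map_mx polyC B)) -
    (\det Q *: map_mx polyC D +
      'X *: (map_mx polyC Cm *m \adj Q *m map_mx polyC B))) i j = _); last first.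
  by rewrite mxE [X in _ + X = _]mxE.
have -> : \det Q *: (map_mx polyC D + 'X *: (map_mx polyC Cm *m S *m map_mx polyC B)) =
    \det Q *: map_mx polyC D + 'X *: (map_mx polyC Cm *m (\det Q *: S) *m map_mx polyC B).
  by rewrite scalerDr -scalemxAr -scalemxAl !scalerA ['X * _]mulrC.
rewrite dS opprD addrACA subrr add0r -scalerBr.
rewrite mulmxBr mulmx1 mulmxBr mulmxBl addrAC subrr add0r.
rewrite -scalemxAr -scalemxAr -scalemxAl scalerN scalerA -exprS.
by rewrite [X in _ %| X]mxE dvdpNr [X in _ %| X]mxE dvdp_mulr.
Qed.

Lemma coprimep_XL_detQ L : coprimep 'X^L (\det Q).
Proof.
rewrite coprimep_expl // coprimep_sym.
have := coprimep_XsubC (\det Q) 0; rewrite polyC0 subr0 => ->.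
have -> : root (\det Q) 0 = (\det (map_mx (horner_eval 0) Q) == 0) by rewrite det_map_mx.
rewrite (_ : map_mx _ _ = 1%:M) ?det1 ?oner_eq0 //.
apply/matrixP => i j.
rewrite !mxE /horner_eval !hornerE subr0.
by case: eqP => _; rewrite ?mulr1n ?mulr0n !hornerE.
Qed.

Context (p q : 'I_m -> 'I_m -> {poly C}).
Hypothesis pqE : forall i j, p i j * \det Q = q i j * statespace_num i j.
Hypothesis q_root : forall i j z, root (q i j) z -> 1 <= cabs z.
Hypothesis q_neq0 : forall i j, q i j != 0.
Hypothesis pq_pos : forall (z : C) v, cabs z < 1 ->
  0 <= Re (hformC (\matrix_(i, j) ((p i j).[z] / (q i j).[z])) v v).

Lemma supply_ge0 N (w : 'cV[C]_(N * m)) : 0 <= hformC (supply A B Cm D N) w w.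
Proof.
have [u [_ ->]] := reach_sequence w; rewrite ler0c.
apply: (toeplitz_ge0 (T := fun z => \matrix_(i, j) ((p i j).[z] / (q i j).[z]))).
  exact: pq_pos.
move=> r e r01 e0.
have cvg_ij i j : exists L0 : nat, forall L (z : C), (L0 <= L)%N -> cabs z = r ->
    cabs ((p i j).[z] / (q i j).[z] - \sum_(l < L) markov l i j * z ^+ l) <= e.
  have qr z : root (q i j) z -> 1 <= cabs z by exact: q_root.
  apply: (rat_series_cvg (p := p i j) (M := fun l => markov l i j)
    _ qr (q_neq0 i j) r01 e0) => L.
  (* [det Q] may vanish inside the disc at points where the transfer function has no pole, so the
     series is compared with [p / q]; [det Q] is 1 at 0 and can be cancelled modulo [X^L]. *)
  rewrite -(Gauss_dvdpr _ (coprimep_XL_detQ L)).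
  have -> : \det Q * (q i j * \poly_(l < L) markov l i j - p i j) =
      q i j * (\det Q * \poly_(l < L) markov l i j - statespace_num i j).
    by rewrite !mulrBr -pqE mulrCA [p i j * _]mulrC.
  by rewrite dvdp_mull // mul_delta_markov.
pose L0 i j := sval (cid (cvg_ij i j)).
exists (\max_i \max_j L0 i j)%N => L z LL zr i j.
rewrite mxE; apply: (svalP (cid (cvg_ij i j))) => //.
apply: leq_trans LL.
apply: leq_trans (leq_bigmax (F := fun i => (\max_j L0 i j)%N) i).
exact: (leq_bigmax (F := L0 i) j).
Qed.

Lemma discrete_storage_exists :
  exists2 P : 'M[C]_n, hpsd (conjC_rmorphism R) P & forall xi u, reachable A B xi ->
    Re (hformC P (A *m xi + B *m u) (A *m xi + B *m u)) - Re (hformC P xi xi)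
      <= Re ((hadjC u *m (Cm *m xi + D *m u)) ord0 ord0).
Proof. by apply: storage_exists => N w; exact: supply_ge0. Qed.

End MarkovParameters.

(** * The Cayley transform *)

Section Controllability.
Context (R : realType).
Local Notation C := (R[i]%C).

Lemma nilpotent_of_eigenvalue r (H : 'M[C]_r.+1) :
  (forall a (v : 'rV_r.+1), v != 0 -> v *m H = a *: v -> a = 1) ->
  (H - 1%:M) ^+ r.+1 = 0.
Proof.
move=> eig; have [zs charE] := closed_field_poly_normal (char_poly H).
rewrite (monicP (char_poly_monic H)) scale1r in charE.
have zs1 z : z \in zs -> z = 1.
  rewrite -root_prod_XsubC -charE -eigenvalue_root_char => /eigenvalueP [v vH v0].
  exact: eig vH.
have size_zs : size zs = r.+1.
  by have := size_char_poly H; rewrite charE size_prod_XsubC => -[].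
have charE1 : char_poly H = ('X - 1) ^+ r.+1.
  rewrite charE -size_zs (eq_big_seq (fun=> 'X - 1)) => [|z /zs1 ->]; last by rewrite polyC1.
  by rewrite big_const_seq count_predT iter_mulr_1.
have := Cayley_Hamilton H; rewrite charE1 rmorphXn rmorphB /= rmorph1.
by rewrite horner_mx_X.
Qed.

(* By nilpotency of H - 1: if (H - 1)^(k+1) Z = 0 then 2 (H - 1)^k Z = 0. *)
Lemma unipotent_relation r d (H : 'M[C]_r) (Z : 'M[C]_(r, d)) (F : 'M[C]_d) :
  (forall a (v : 'rV_r), v != 0 -> v *m H = a *: v -> a = 1) ->
  (H - 1%:M) *m Z *m F = (H + 1%:M) *m Z -> Z = 0.
Proof.
case: r H Z => [|r] H Z eig rel; first by apply/matrixP => -[].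
have nil := nilpotent_of_eigenvalue eig.
set N := H - 1%:M in rel nil.
have down k : N ^+ k.+1 *m Z = 0 -> N ^+ k *m Z = 0.
  move=> Z0; have := congr1 (mulmx (N ^+ k)) rel.
  have NS : N ^+ k *m N = N ^+ k.+1 by rewrite exprSr.
  have -> : H + 1%:M = N + 2%:M.
    by rewrite /N -addrA; congr (_ + _); rewrite -[2]/(1 + 1) raddfD /= addKr.
  rewrite !mulmxA NS Z0 mul0mx mulmxDr mulmxDl NS Z0 add0r mul_mx_scalar -scalemxAl.
  by move=> /esym/eqP; rewrite scaler_eq0 pnatr_eq0 => /eqP.
have {}down k : N ^+ k *m Z = 0 -> Z = 0.
  by elim: k => [|k IH /down //]; rewrite expr0 mul1mx.
by apply: (down r.+1); rewrite nil mul0mx.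
Qed.

End Controllability.

Section CayleyTransform.
Context (R : realType) (n m d : nat).
Local Notation C := (R[i]%C).
Local Notation Re := (@complex.Re R).
Local Notation hadjC := (hadj (conjC_rmorphism R)).
Local Notation hformC := (hform (conjC_rmorphism R)).
Context (E A : 'M[C]_n) (B : 'M[C]_(n, m)) (Cm : 'M[C]_(m, n)) (D : 'M[C]_m).
Context (X0 : 'M[C]_(n, d)) (U0 : 'M[C]_(m, d)) (F : 'M[C]_d).
Hypothesis data : A *m X0 + B *m U0 = E *m X0 *m F.
Context (al : C).
Hypotheses (al_gt0 : 0 < al) (al_unit : al *: E - A \in unitmx).

Let Rv := invmx (al *: E - A).
Let Ah := - (Rv *m (al *: E + A)).
Let Bh := Rv *m B.

Lemma al_neq0 : al != 0. Proof. by rewrite gt_eqF. Qed.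

Lemma pencil_cayleyA : (al *: E - A) *m Ah = - (al *: E + A).
Proof. by rewrite /Ah mulmxN (mulKVmx al_unit). Qed.

Lemma pencil_cayleyB : (al *: E - A) *m Bh = B.
Proof. by rewrite /Bh (mulKVmx al_unit). Qed.

(** With [xi = z xi'], the vectors [xi' - xi] and [al (xi' + xi)] are [x] and [s x] for
    [s = al (1 + z) / (1 - z)]. *)
Lemma cayleyE xi xi' u : al *: (E *m (xi' + xi)) = A *m (xi' - xi) + B *m u ->
  xi' = Ah *m xi + Bh *m u :> 'cV_n.
Proof.
move=> rel; apply: (can_inj (mulKmx al_unit)).
rewrite mulmxDr [_ *m (Ah *m _)]mulmxA [_ *m (Bh *m _)]mulmxA.
rewrite pencil_cayleyA pencil_cayleyB mulNmx.
rewrite mulmxBl mulmxDl -!scalemxAl.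
move: rel; rewrite mulmxDr scalerDr mulmxBr.
move: (al *: (E *m xi')) (al *: (E *m xi)) (A *m xi') (A *m xi) (B *m u).
move=> a b a' b' f rel; apply/matrixP => i j.
have := congr1 (fun M : 'cV_n => M i j) rel; rewrite !mxE => relij.
apply/eqP; rewrite -subr_eq0.
rewrite [X in X == 0](_ : _ = a i j + b i j - (a' i j - b' i j + f i j)).
  by rewrite relij subrr.
by ring.
Qed.

Hypothesis ctrl : forall lambda : C, \rank (row_mx (lambda *: E - A) B) = n.

(** For [a <> 1] the row [w Rv] would annihilate both [mu E - A] and [B] at
    [mu = al (a + 1) / (a - 1)], against controllability. *)
Lemma cayley_left_eigenvalue a (w : 'rV[C]_n) :
  w != 0 -> w *m Ah = a *: w -> w *m Bh = 0 -> a = 1.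
Proof.
move=> w0 wA wB; apply/eqP; apply: contraNT w0 => a1.
pose g := w *m Rv; have wE : w = g *m (al *: E - A) by rewrite mulmxKV.
have a1' : a - 1 != 0 by rewrite subr_eq0.
pose mu := al * (a + 1) / (a - 1).
have gB : g *m B = 0 by rewrite -mulmxA.
have gE : g *m (mu *: E - A) = 0.
  apply: (scalerI a1'); rewrite scaler0 scalemxAr scalerBr scalerA.
  rewrite (_ : (a - 1) * mu = al * (a + 1)); last by rewrite /mu mulrC divfK.
  have : a *: w - w *m Ah = 0 by rewrite wA subrr.
  rewrite /Ah mulmxN opprK mulmxA -/g {1}wE scalemxAr -mulmxDr => <-.
  congr (_ *m _); rewrite scalerBr scalerA; apply/matrixP => i j; rewrite !mxE; ring.
have g0 : g = 0.
  have free : row_free (row_mx (mu *: E - A) B) by rewrite /row_free ctrl.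
  by apply: (row_free_inj free); rewrite mul0mx mul_mx_row gE gB row_mx0.
by rewrite wE g0 mul0mx.
Qed.

Lemma reachable_step xi u : reachable Ah Bh xi -> reachable Ah Bh (Ah *m xi + Bh *m u).
Proof. by have [_ [_ +]] := reachable_stable Ah Bh; apply. Qed.

(* The rows of W span the left annihilators of the reachable space; by
   controllability Ah acts on them with the sole eigenvalue 1, which stands for
   s = oo. *)
Lemma reachable_data c : reachable Ah Bh (X0 *m c).
Proof.
have [N0 [N0P _]] := reachable_stable Ah Bh.
pose L := reach Ah Bh N0; pose W := row_base (kermx L).
have WL : W *m L = 0 by apply/eqP; rewrite -sub_kermx eq_row_base.
have Wreach xi : reachable Ah Bh xi -> W *m xi = 0.
  by move=> /N0P [w ->]; rewrite mulmxA WL mul0mx.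
have reach0 : reachable Ah Bh 0 by exists 0%N, 0; rewrite mulmx0.
have WB : W *m Bh = 0.
  apply: mulmx_col_eq0 => u; rewrite -[W *m Bh *m u]mulmxA; apply: Wreach.
  by have := reachable_step u reach0; rewrite mulmx0 add0r.
have WA : (W *m Ah <= W)%MS.
  rewrite eq_row_base sub_kermx; apply/eqP; apply: mulmx_col_eq0 => w.
  have -> : W *m Ah *m L *m w = W *m (Ah *m (L *m w)) by rewrite !mulmxA.
  apply: Wreach; have := reachable_step 0 (ex_intro _ N0 (ex_intro _ w erefl)).
  by rewrite mulmx0 addr0.
have [H WAE] := submxP WA.
have WX0 : W *m X0 = 0.
  apply: (@unipotent_relation R _ _ H _ (al^-1 *: F)).
    move=> a v v0 vH; apply: (@cayley_left_eigenvalue a (v *m W)).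
    - apply: contra v0 => /eqP vW; apply/eqP.
      by apply: (row_free_inj (row_base_free (kermx L))); rewrite mul0mx.
    - by rewrite -mulmxA WAE mulmxA vH -scalemxAl.
    - by rewrite -mulmxA WB mulmx0.
  (* The relation [data] in Cayley form; [W] kills [Bh], which leaves the relation of
     [unipotent_relation] for [Z = W X0]. *)
  have rel : (Ah - 1%:M) *m X0 *m (al^-1 *: F) = (Ah + 1%:M) *m X0 - 2 *: (Bh *m U0).
    apply: (can_inj (mulKmx al_unit)).
    rewrite [RHS]mulmxBr -(scalemxAr 2) [_ *m (Bh *m U0)]mulmxA pencil_cayleyB.
    rewrite [_ *m ((Ah + _) *m _)]mulmxA -[_ *m X0 *m _]mulmxA [_ *m ((Ah - _) *m _)]mulmxA.
    rewrite [_ *m (Ah - _)]mulmxBr mulmxDr pencil_cayleyA mulmx1 -scalemxAr.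
    have -> : - (al *: E + A) - (al *: E - A) = - ((2 * al) *: E).
      by apply/matrixP => i j; rewrite !mxE; ring.
    have -> : - (al *: E + A) + (al *: E - A) = - (2 *: A).
      by apply/matrixP => i j; rewrite !mxE; ring.
    rewrite !mulNmx -!scalemxAl.
    have -> : (2 * al) *: (E *m (al^-1 *: (X0 *m F))) = 2 *: (E *m X0 *m F).
      by rewrite -scalemxAr scalerA mulfK ?al_neq0 // mulmxA.
    by rewrite -data scalerDr opprD.
  have WH a : (H + a%:M) *m W = W *m (Ah + a%:M).
    by rewrite mulmxDl mulmxDr WAE mul_mx_scalar mul_scalar_mx.
  have WH1 : (H - 1%:M) *m W = W *m (Ah - 1%:M).
    by rewrite mulmxBl mulmxBr WAE mul1mx mulmx1.
  have -> : (H - 1%:M) *m (W *m X0) *m (al^-1 *: F) =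
      W *m ((Ah - 1%:M) *m X0 *m (al^-1 *: F)).
    by rewrite [_ *m (W *m X0)]mulmxA WH1 !mulmxA.
  rewrite rel mulmxBr -(scalemxAr 2) [W *m (Bh *m U0)]mulmxA WB mul0mx scaler0 subr0.
  by rewrite [RHS]mulmxA WH mulmxA.
have /submxP [Y XY] : (X0^T <= L^T)%MS.
  apply: submx_ker => v Lv.
  have /submxP [Y vY] : (v^T <= W)%MS.
    by rewrite eq_row_base sub_kermx -[L]trmxK -trmx_mul Lv trmx0.
  by apply: trmx_inj; rewrite trmx_mul trmxK vY -mulmxA WX0 mulmx0 trmx0.
exists N0, (Y^T *m c); rewrite mulmxA -[X0]trmxK XY trmx_mul trmxK.
by [].
Qed.

End CayleyTransform.

(** * Polynomials under the substitution [s = al (1 + z) / (1 - z)] *)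

Section Polynomials.
Context (R : realType).
Local Notation C := (R[i]%C).
Local Notation Re := (@complex.Re R).

Lemma poly_eq0_of_values (f : {poly C}) : (forall z, f.[z] = 0) -> f = 0.
Proof.
move=> f0; apply/eqP; apply: contraT => fn0.
pose rs := [seq i%:R : C | i <- iota 0 (size f)].
have := max_poly_roots fn0 (rs := rs); rewrite size_map size_iota ltnn; apply.
  by apply/allP => z _; rewrite /root f0.
by rewrite map_inj_uniq ?iota_uniq // => i j /eqP; rewrite eqr_nat => /eqP.
Qed.

(** Regularity provides only some complex point where the pencil is invertible; this gives a
    positive real one to serve as [al]. *)
Lemma nonroot_nat (f : {poly C}) : f != 0 -> exists k : nat, f.[k.+1%:R] != 0.
Proof.
move=> f0; apply: contrapT => /forallNP H.
pose rs := [seq (i.+1)%:R : C | i <- iota 0 (size f)].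
have := max_poly_roots f0 (rs := rs); rewrite size_map size_iota ltnn => /(_ _ _)/negP.
apply=> //.
  by apply/allP => _ /mapP [i _ ->]; rewrite /root; apply/negPn/negP/H.
by rewrite map_inj_uniq ?iota_uniq // => i j /eqP; rewrite eqr_nat => /eqP [].
Qed.

(* (1 - z)^k f(al (1 + z) / (1 - z)) as a polynomial in z, for deg f <= k. *)
Definition moebius_poly (al : C) (k : nat) (f : {poly C}) : {poly C} :=
  \sum_(i < k.+1) (f`_i * al ^+ i) *: ((1 + 'X) ^+ i * (1 - 'X) ^+ (k - i)).

Definition moebius (al z : C) : C := al * (1 + z) / (1 - z).

Lemma moebius_polyE al k (f : {poly C}) z : (size f <= k.+1)%N -> z != 1 ->
  (moebius_poly al k f).[z] = (1 - z) ^+ k * f.[moebius al z].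
Proof.
move=> fk z1; have z1' : 1 - z != 0 by rewrite subr_eq0 eq_sym.
rewrite horner_sum (horner_coef_wide _ fk) mulr_sumr; apply: eq_bigr => i _.
have -> : (1 + 'X : {poly C}) = 'X + 1%:P by rewrite addrC.
have -> : (1 - 'X : {poly C}) = 1%:P - 'X by [].
rewrite hornerZ hornerM !horner_exp !hornerD hornerN !hornerX !hornerC /moebius.
rewrite !exprMn exprVn [z + 1]addrC.
have -> : (1 - z) ^+ k = (1 - z) ^+ (k - i) * (1 - z) ^+ i.
  by rewrite -exprD subnK // -ltnS.
have zi : (1 - z) ^+ i != 0 by rewrite expf_neq0.
by field.
Qed.

Lemma cabs2E (z : C) : cabs z ^+ 2 = Re z ^+ 2 + complex.Im z ^+ 2.
Proof.
by rewrite /cabs normc_def /= sqr_sqrtr // addr_ge0 ?sqr_ge0.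
Qed.

(** Multiplying above and below by the conjugate of [1 - z] gives the real part
    [al (1 - |z|^2) / |1 - z|^2]. *)
Lemma moebius_Re_gt0 (al : C) z : 0 < al -> cabs z < 1 ->
  z != 1 /\ 0 < Re (moebius al z).
Proof.
move=> al0 z1; have zn1 : z != 1.
  by apply/eqP => ze; move: z1; rewrite ze cabs1 ltxx.
split=> //; have z1' : 1 - z != 0 by rewrite subr_eq0 eq_sym.
have alR : al = ((Re al)%:C)%C by rewrite RRe_real // gtr0_real.
have Real0 : 0 < Re al by rewrite -ltcR -alR.
have c2 : cabs z ^+ 2 < 1 by rewrite expr_lt1 ?cabs_ge0.
have w2 : 0 < cabs (1 - z) ^+ 2 by rewrite exprn_gt0 ?cabs_gt0.
have -> : moebius al z = al * ((1 + z) * ((1 - z)^*)%C) / ((cabs (1 - z) ^+ 2)%:C)%C.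
  have -> : ((cabs (1 - z) ^+ 2)%:C)%C = (1 - z) * ((1 - z)^*)%C.
    by rewrite rmorphXn /= cabsE sqr_normc.
  have z1c : ((1 - z)^*)%C != 0 by rewrite conjc_eq0.
  rewrite /moebius; move: z1c; set w := ((1 - z)^*)%C => z1c.
  by field; rewrite z1' andbT; move: z1c; rewrite /w rmorphB rmorph1.
rewrite {1}alR -fmorphV mulrC ReM /= mul0r subr0 pmulr_rgt0 ?invr_gt0 //.
rewrite ReM /= mul0r subr0 pmulr_rgt0 //.
move: c2; rewrite cabs2E; case: z {zn1 z1' w2 z1} => a b /=.
move=> c2; rewrite (_ : _ - _ = 1 - (a ^+ 2 + b ^+ 2)); last by ring.
by rewrite subr_gt0.
Qed.

End Polynomials.

(** The discrete output is the original one with [xi' - xi] in the place of [x], so the supplied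
    power is unchanged. *)
Lemma cayley_output (K : pzRingType) n m (A : 'M[K]_n) (B : 'M[K]_(n, m))
    (Cm : 'M[K]_(m, n)) (D : 'M[K]_m) (x : 'cV[K]_n) (u : 'cV[K]_m) :
  Cm *m (A - 1%:M) *m x + (D + Cm *m B) *m u = Cm *m (A *m x + B *m u - x) + D *m u.
Proof.
rewrite mulmxDl -!mulmxA mulmxBl mul1mx !mulmxBr !mulmxDr.
by rewrite [D *m u + _]addrC addrA [X in X + _ = _]addrAC.
Qed.

(** * From the discrete storage back to the descriptor system *)

Section PositiveRealStorage.
Context (R : realType) (n m d : nat).
Local Notation C := (R[i]%C).
Local Notation Re := (@complex.Re R).
Local Notation hadjC := (hadj (conjC_rmorphism R)).
Local Notation hformC := (hform (conjC_rmorphism R)).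
Context (E A : 'M[C]_n) (B : 'M[C]_(n, m)) (Cm : 'M[C]_(m, n)) (D : 'M[C]_m).

Definition pencil : 'M[{poly C}]_n := 'X *: map_mx polyC E - map_mx polyC A.

Definition transfer_num : 'M[{poly C}]_m :=
  map_mx polyC Cm *m \adj pencil *m map_mx polyC B + \det pencil *: map_mx polyC D.

Lemma map_polyC_horner p q (M : 'M[C]_(p, q)) s :
  map_mx (horner_eval s) (map_mx polyC M) = M.
Proof. by apply/matrixP => i j; rewrite !mxE /horner_eval hornerC. Qed.

Lemma pencil_horner s : map_mx (horner_eval s) pencil = s *: E - A.
Proof.
by apply/matrixP => i j; rewrite !mxE /horner_eval !hornerE.
Qed.

Lemma det_pencil_horner s : (\det pencil).[s] = \det (s *: E - A).
Proof. by rewrite -pencil_horner det_map_mx. Qed.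

Lemma transfer_num_horner s i j : s *: E - A \in unitmx ->
  (transfer_num i j).[s] = (\det pencil).[s] * (Cm *m invmx (s *: E - A) *m B + D) i j.
Proof.
move=> unit_s; have -> : (transfer_num i j).[s] = map_mx (horner_eval s) transfer_num i j.
  by rewrite [RHS]mxE.
rewrite map_mxD map_mxZ !map_mxM map_mx_adj pencil_horner !map_polyC_horner.
have det0 : \det (s *: E - A) != 0 by rewrite -unitfE.
rewrite /= /horner_eval det_pencil_horner /invmx unit_s -scalemxAr -scalemxAl.
have -> : \det (s *: E - A) * ((\det (s *: E - A))^-1 *: (Cm *m \adj (s *: E - A) *m B) + D) i j
  = (\det (s *: E - A) *: ((\det (s *: E - A))^-1 *: (Cm *m \adj (s *: E - A) *m B) + D)) i j.
  by rewrite [RHS]mxE.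
by rewrite scalerDr scalerA divff // scale1r.
Qed.

Context (p q : 'I_m -> 'I_m -> {poly C}).
Hypothesis pqE : forall i j, transfer_num i j * q i j = p i j * \det pencil.
Hypothesis q_root : forall i j s, 0 < Re s -> ~~ root (q i j) s.
Hypothesis pq_pos : forall (s : C) v, 0 < Re s ->
  0 <= Re (hformC (\matrix_(i, j) ((p i j).[s] / (q i j).[s])) v v).

Lemma transfer_value i j s : s *: E - A \in unitmx ->
  (Cm *m invmx (s *: E - A) *m B + D) i j * (q i j).[s] = (p i j).[s].
Proof.
move=> unit_s; have := congr1 (fun f : {poly C} => f.[s]) (pqE i j).
rewrite !hornerM transfer_num_horner // -mulrA mulrC [RHS]mulrC.
have det0 : (\det pencil).[s] != 0 by rewrite det_pencil_horner -unitfE.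
by rewrite mulrC; apply: mulfI.
Qed.

Context (al : C).
Hypotheses (al_gt0 : 0 < al) (al_unit : al *: E - A \in unitmx).

Let Rv := invmx (al *: E - A).
Let Ah := - (Rv *m (al *: E + A)).
Let Bh := Rv *m B.
Let Ch := Cm *m (Ah - 1%:M).
Let Dh := D + Cm *m Bh.

(** A common exponent for both polynomials, so that the powers of [1 - z] cancel in [ph / qh]. *)
Let k i j := maxn (size (p i j)) (size (q i j)).
Let ph i j := moebius_poly al (k i j) (p i j).
Let qh i j := moebius_poly al (k i j) (q i j).

Lemma qh_neq0_at i j z : cabs z < 1 -> (qh i j).[z] != 0.
Proof.
move=> z1; have [zn1 s0] := moebius_Re_gt0 al_gt0 z1.
rewrite moebius_polyE ?leqW ?leq_maxr //.
have := q_root i j s0; rewrite rootE => qs.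
by rewrite mulf_neq0 // expf_neq0 // subr_eq0 eq_sym.
Qed.

Lemma cayley_factor z : z != 1 ->
  1%:M - z *: Ah = (1 - z) *: (Rv *m (moebius al z *: E - A)).
Proof.
move=> z1; have z1' : 1 - z != 0 by rewrite subr_eq0 eq_sym.
apply: (can_inj (mulKmx al_unit)).
rewrite -scalemxAr mulmxA (mulmxV al_unit) mul1mx mulmxBr mulmx1 -scalemxAr pencil_cayleyA //.
apply/matrixP => i j; rewrite !mxE /moebius; field.
exact: z1'.
Qed.

Lemma cayley_transfer z : z != 1 -> moebius al z *: E - A \in unitmx ->
  1%:M - z *: Ah \in unitmx /\
  Dh + z *: (Ch *m invmx (1%:M - z *: Ah) *m Bh) =
    Cm *m invmx (moebius al z *: E - A) *m B + D.
Proof.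
move=> z1 unit_s; have z1' : 1 - z != 0 by rewrite subr_eq0 eq_sym.
set s := moebius al z in unit_s *; set N := 1%:M - z *: Ah.
have NE := cayley_factor z1; rewrite -/s -/N in NE.
have unitN : N \in unitmx.
  by rewrite NE unitmxZ ?unitfE // unitmx_mul unitmx_inv al_unit.
split=> //.
have invB : invmx N *m Bh = (1 - z)^-1 *: (invmx (s *: E - A) *m B).
  apply: (can_inj (mulKmx unitN)); rewrite (mulKVmx unitN) NE.
  rewrite -scalemxAr -scalemxAl scalerA mulVf // scale1r -mulmxA (mulKVmx unit_s).
  by [].
rewrite -[Ch *m _ *m Bh]mulmxA invB /Dh /Ch.
set V := (1 - z)^-1 *: _.
have BhE : Bh = N *m V by rewrite -[LHS](mulKVmx unitN) invB.
transitivity (D + Cm *m ((N + z *: (Ah - 1%:M)) *m V)).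
  rewrite {1}BhE -addrA; congr (_ + _).
  rewrite mulmxDl [RHS]mulmxDr; congr (_ + _).
  by rewrite -(scalemxAl z (Ah - 1%:M) V) -(scalemxAr z) mulmxA.
have -> : N + z *: (Ah - 1%:M) = (1 - z)%:M.
  by rewrite /N scalerBr addrA subrK; apply/matrixP => i j; rewrite !mxE mulrnBl mulr_natr.
by rewrite mul_scalar_mx scalerA divff // scale1r addrC mulmxA.
Qed.

Let Q : 'M[{poly C}]_n := 1%:M - 'X *: map_mx polyC Ah.

Lemma statespace_num_horner z i j : 1%:M - z *: Ah \in unitmx ->
  (statespace_num Ah Bh Ch Dh i j).[z] =
  (\det Q).[z] * (Dh + z *: (Ch *m invmx (1%:M - z *: Ah) *m Bh)) i j.
Proof.
set N := 1%:M - z *: Ah => unitN.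
have QE : map_mx (horner_eval z) Q = N.
  apply/matrixP => a b; rewrite !mxE /horner_eval !hornerE.
  by case: eqP => _; rewrite ?mulr1n ?mulr0n !hornerE.
have detE : (\det Q).[z] = \det N by rewrite -QE det_map_mx.
have -> : (statespace_num Ah Bh Ch Dh i j).[z] =
    map_mx (horner_eval z) (statespace_num Ah Bh Ch Dh) i j by rewrite [RHS]mxE.
rewrite map_mxD !map_mxZ !map_mxM map_mx_adj -/Q QE !map_polyC_horner.
have det0 : \det N != 0 by rewrite -unitfE.
rewrite /= /horner_eval detE hornerX /invmx unitN -scalemxAr -scalemxAl.
have -> : \det N * (Dh + z *: ((\det N)^-1 *: (Ch *m \adj N *m Bh))) i j
  = (\det N *: (Dh + z *: ((\det N)^-1 *: (Ch *m \adj N *m Bh)))) i j.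
  by rewrite [RHS]mxE.
rewrite (scalerDr _ Dh (z *: _)) (_ : \det N *: (z *: _) = z *: (Ch *m \adj N *m Bh)) //.
by rewrite !scalerA [\det N * z]mulrC mulfK.
Qed.

(** The identity is checked at points. The extra factor [(X - 1) det Q] disposes of those where the
    substitution or the inverse is undefined. *)
Lemma moebius_statespace i j :
  ph i j * \det Q = qh i j * statespace_num Ah Bh Ch Dh i j.
Proof.
apply/eqP; rewrite -subr_eq0; apply/eqP; set f := _ - _.
have detQ0 : \det Q != 0.
  apply/eqP => Q0; have := coprimep_XL_detQ Ah 1.
  by rewrite -/Q Q0 coprimep0 -size_poly_eq1 expr1 size_polyX.
suff : f * (('X - 1%:P) * \det Q) = 0.
  by move/eqP; rewrite !mulf_eq0 polyXsubC_eq0 (negPf detQ0) !orbF => /eqP.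
apply: poly_eq0_of_values => z; rewrite !hornerM hornerXsubC.
have [->|z1] := eqVneq z 1; first by rewrite subrr mul0r mulr0.
have z1' : 1 - z != 0 by rewrite subr_eq0 eq_sym.
have detE : (\det Q).[z] = \det (1%:M - z *: Ah).
  have -> : (\det Q).[z] = \det (map_mx (horner_eval z) Q) by rewrite det_map_mx.
  congr (\det _); apply/matrixP => a b; rewrite !mxE /horner_eval !hornerE.
  by case: eqP => _; rewrite ?mulr1n ?mulr0n !hornerE.
have [->|detz] := eqVneq (\det Q).[z] 0; first by rewrite !mulr0.
have unitN : 1%:M - z *: Ah \in unitmx by rewrite unitmxE unitfE -detE.
have unit_s : moebius al z *: E - A \in unitmx.
  move: unitN; rewrite cayley_factor // unitmxZ; last by rewrite unitfE.
  by rewrite unitmx_mul => /andP [].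
have [_ cT] := cayley_transfer z1 unit_s.
suff -> : f.[z] = 0 by rewrite mul0r.
rewrite /f hornerD hornerN !hornerM statespace_num_horner // cT.
rewrite !moebius_polyE // ?leqW ?leq_maxl ?leq_maxr //.
by rewrite -(transfer_value i j unit_s); ring.
Qed.

Lemma cayley_storage_exists :
  exists2 P : 'M[C]_n, hpsd (conjC_rmorphism R) P & forall xi u, reachable Ah Bh xi ->
    Re (hformC P (Ah *m xi + Bh *m u) (Ah *m xi + Bh *m u)) - Re (hformC P xi xi)
      <= Re ((hadjC u *m (Ch *m xi + Dh *m u)) ord0 ord0).
Proof.
apply: (discrete_storage_exists (p := ph) (q := qh)).
- exact: moebius_statespace.
- move=> i j z; rewrite leNgt; apply: contraL; exact: qh_neq0_at.
- move=> i j; have := @qh_neq0_at i j 0; rewrite cabs0 ltr01 => /(_ isT).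
  by apply: contraNneq => ->; rewrite horner0.
move=> z v z1; have [zn1 s0] := moebius_Re_gt0 al_gt0 z1.
have z1' : 1 - z != 0 by rewrite subr_eq0 eq_sym.
rewrite (_ : \matrix_(_, _) _ =
  \matrix_(i, j) ((p i j).[moebius al z] / (q i j).[moebius al z])); first exact: pq_pos.
apply/matrixP => i j; rewrite !mxE !moebius_polyE // ?leqW ?leq_maxl ?leq_maxr //.
by rewrite -mulf_div divff ?mul1r // expf_neq0.
Qed.

Context (X0 : 'M[C]_(n, d)) (U0 : 'M[C]_(m, d)) (F : 'M[C]_d).
Hypothesis data : A *m X0 + B *m U0 = E *m X0 *m F.
Hypothesis ctrl : forall lambda : C, \rank (row_mx (lambda *: E - A) B) = n.

Lemma positive_real_storage_at : exists2 G : 'M[C]_d, hpsd (conjC_rmorphism R) G &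
  (forall c : 'cV_d, E *m X0 *m c = 0 -> hformC G c c = 0) /\
  (forall c : 'cV_d, Re (hformC G c (F *m c)) <=
     Re ((hadjC (U0 *m c) *m ((Cm *m X0 + D *m U0) *m c)) ord0 ord0)).
Proof.
have [P Ppsd Pdiss] := cayley_storage_exists; have [PH P0] := Ppsd.
have alR : al = ((Re al)%:C)%C by rewrite RRe_real // gtr0_real.
have Real0 : 0 < Re al by rewrite -ltcR -alR.
have reach := reachable_data data al_gt0 al_unit ctrl.
have hPR v : hformC P v v = ((Re (hformC P v v))%:C)%C.
  by rewrite RRe_real // ger0_real.
set M := hadjC X0 *m P *m X0.
have Mpsd : hpsd (conjC_rmorphism R) M by exact: (hpsd_conjmx (@conjC_rmorphismK R)).
have [MH M0] := Mpsd.
(* The states [X0 (y c + (t - 1/2) c)] and [X0 (y c + (t + 1/2) c)] differ by [X0 c], and [al E]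
   maps their sum to [E X0 F c] as soon as [t E X0 c = 0]; they are then consecutive under the input
   [U0 c]. *)
pose y (c : 'cV[C]_d) := (2^-1 * al^-1) *: (F *m c).
have half2 : 2^-1 + 2^-1 = 1 :> C by field.
have step (c : 'cV[C]_d) t : t *: (E *m X0 *m c) = 0 ->
    X0 *m (y c + (t + 2^-1) *: c) =
     Ah *m (X0 *m (y c + (t - 2^-1) *: c)) + Bh *m (U0 *m c).
  move=> tc0; apply: cayleyE => //; rewrite -!(mulmxDr X0) -(mulmxBr X0).
  have -> : y c + (t + 2^-1) *: c - (y c + (t - 2^-1) *: c) = c.
    rewrite opprD addrACA subrr add0r -scalerBl opprB addrC addrA subrK.
    by rewrite half2 scale1r.
  have -> : y c + (t + 2^-1) *: c + (y c + (t - 2^-1) *: c) =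
      al^-1 *: (F *m c) + (2 * t) *: c.
    rewrite addrACA -!scalerDl; congr (_ *: _ + _ *: _).
      by rewrite half2 scale1r.
    by ring.
  have -> : A *m (X0 *m c) + B *m (U0 *m c) = E *m X0 *m (F *m c).
    by rewrite !mulmxA -mulmxDl data.
  rewrite mulmxA mulmxDr -!scalemxAr -scalerA tc0 scaler0 addr0 scalerA divff ?scale1r //.
  by rewrite gt_eqF.
have diss (c : 'cV[C]_d) t : t *: (E *m X0 *m c) = 0 ->
  Re (hformC M (y c + (t + 2^-1) *: c) (y c + (t + 2^-1) *: c))
  - Re (hformC M (y c + (t - 2^-1) *: c) (y c + (t - 2^-1) *: c))
  <= Re ((hadjC (U0 *m c) *m ((Cm *m X0 + D *m U0) *m c)) ord0 ord0).
  move=> /step stepc; rewrite -!hformM stepc.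
  apply: le_trans (Pdiss _ _ (reach _)) _.
  suff -> : Ch *m (X0 *m (y c + (t - 2^-1) *: c)) + Dh *m (U0 *m c) =
     (Cm *m X0 + D *m U0) *m c by [].
  rewrite cayley_output -stepc -mulmxBr.
  rewrite opprD addrACA subrr add0r -scalerBl opprB [X in X *: _]addrC addrA subrK half2.
  by rewrite scale1r mulmxDl !mulmxA.
have hy (c : 'cV[C]_d) : hformC M c (y c) = 2^-1 * (al^-1 * hformC M c (F *m c)).
  by rewrite hformZr mulrA.
have Re2 (z : C) : Re (2 * z) = 2 * Re z.
  by rewrite -[2](rmorph_nat (real_complex R)) ReM /= mul0r subr0.
have expand (w c : 'cV[C]_d) (t : R) :
    Re (hformC M (w + ((t%:C)%C + 2^-1) *: c) (w + ((t%:C)%C + 2^-1) *: c))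
  - Re (hformC M (w + ((t%:C)%C - 2^-1) *: c) (w + ((t%:C)%C - 2^-1) *: c))
  = 2 * Re (hformC M c w) + 2 * t * Re (hformC M c c).
  have cjt : conjC_rmorphism R ((t%:C)%C) = (t%:C)%C.
    by apply: complex_ext => //=; rewrite oppr0.
  have cj2 : conjC_rmorphism R 2^-1 = 2^-1 by rewrite fmorphV rmorph_nat.
  have wc : hformC M w c = conjC_rmorphism R (hformC M c w).
    by rewrite (hform_conj (@conjC_rmorphismK R)) MH.
  rewrite -ReB !(hformDl, hformDr, hformZl, hformZr) rmorphD rmorphB /= cjt cj2.
  set a := hformC M w w; set b := hformC M w c.
  set b' := hformC M c w; set e := hformC M c c.
  rewrite (_ : _ - _ = b + b' + 2 * ((t%:C)%C * e)); last by field.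
  rewrite /b wc -/b' !ReD Re_conj Re2 ReM /= mul0r subr0; ring.
have Rehy c : 2 * Re (hformC M c (y c)) = Re (al^-1 * hformC M c (F *m c)).
  by rewrite hy -Re2 mulVKf // pnatr_eq0.
(* For [t = 0] the increment of [M] over one step is [Re (al^-1 M(c, F c))], hence the factor. *)
exists (al^-1 *: M).
  split; first by rewrite hadjZ MH fmorphV /= (cj_real (@conjC_rmorphism_norm R)) // ltW.
  by move=> c; rewrite hform_scalem mulr_ge0 // invr_ge0 ltW.
split=> c; last first.
  rewrite hform_scalem; have := diss c 0; rewrite scale0r => /(_ erefl).
  by have := expand (y c) c 0; rewrite rmorph0 mulr0 mul0r addr0 Rehy => ->.
(* Shifting by t c in ker E changes the left side of diss by 2 t (M c, c) but not
   the right one. *)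
move=> Ec0; rewrite hform_scalem.
have : hformC M c c = ((Re (hformC M c c))%:C)%C by rewrite RRe_real // ger0_real.
set h := Re _ => hE; rewrite hE.
suff -> : h = 0 by rewrite mulr0.
apply/eqP; apply: contraT => h0.
pose a := Re (al^-1 * hformC M c (F *m c)).
pose b := Re ((hadjC (U0 *m c) *m ((Cm *m X0 + D *m U0) *m c)) ord0 ord0).
(* This shift makes the left side of [diss] equal to [b + 1]. *)
have := diss c ((((b - a + 1) / (2 * h))%:C)%C).
rewrite Ec0 scaler0 => /(_ erefl); rewrite expand Rehy -/a -/b -/h.
rewrite (_ : 2 * _ * h = b - a + 1); last by field.
lra.
Qed.

End PositiveRealStorage.

Lemma positive_real_storage (R : realType) (n m d : nat)
    (E A : 'M[R[i]%C]_n) (B : 'M[R[i]%C]_(n, m)) (Cm : 'M[R[i]%C]_(m, n))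
    (D : 'M[R[i]%C]_m) (p q : 'I_m -> 'I_m -> {poly R[i]%C})
    (X0 : 'M[R[i]%C]_(n, d)) (U0 : 'M[R[i]%C]_(m, d)) (F : 'M[R[i]%C]_d) :
  (exists lambda, lambda *: E - A \in unitmx) ->
  (forall lambda, \rank (row_mx (lambda *: E - A) B) = n) ->
  (forall i j, transfer_num E A B Cm D i j * q i j = p i j * \det (pencil E A)) ->
  (forall i j s, 0 < complex.Re s -> ~~ root (q i j) s) ->
  (forall s v, 0 < complex.Re s -> 0 <= complex.Re (hform (conjC_rmorphism R)
     (\matrix_(i, j) ((p i j).[s] / (q i j).[s])) v v)) ->
  A *m X0 + B *m U0 = E *m X0 *m F ->
  exists2 G : 'M[R[i]%C]_d, hpsd (conjC_rmorphism R) G &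
  (forall c : 'cV_d, E *m X0 *m c = 0 -> hform (conjC_rmorphism R) G c c = 0) /\
  (forall c : 'cV_d, complex.Re (hform (conjC_rmorphism R) G c (F *m c)) <=
     complex.Re ((hadj (conjC_rmorphism R) (U0 *m c) *m
       ((Cm *m X0 + D *m U0) *m c)) ord0 ord0)).
Proof.
move=> [lambda unit_l] ctrl pqE q_root pq_pos data.
have det0 : \det (pencil E A) != 0.
  apply: contraTneq unit_l => det0; rewrite unitmxE unitfE -det_pencil_horner.
  by rewrite det0 horner0 eqxx.
have [k detk] := nonroot_nat det0.
have k0 : 0 < k.+1%:R :> R[i]%C by rewrite ltr0n.
move: detk k0; move: (k.+1%:R) => al detk k0.
have unit_k : al *: E - A \in unitmx.
  by rewrite unitmxE unitfE -det_pencil_horner.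
exact: (positive_real_storage_at pqE q_root pq_pos k0 unit_k data ctrl).
Qed.

(** * Forms over R and C, and the KYP inequality *)

Section ScalarMorphisms.
Context (R : realType) (k : scalar_kind).
Local Notation K := (base_field R k).

Lemma conjK_is_zmod_morphism : zmod_morphism (@conjK R k).
Proof. by case: k => // x y /=; rewrite rmorphB. Qed.

Lemma conjK_is_monoid_morphism : monoid_morphism (@conjK R k).
Proof. by case: k => /=; split=> // [|x y]; rewrite ?rmorph1 ?rmorphM. Qed.

HB.instance Definition _ :=
  GRing.isZmodMorphism.Build K K (@conjK R k) conjK_is_zmod_morphism.
HB.instance Definition _ :=
  GRing.isMonoidMorphism.Build K K (@conjK R k) conjK_is_monoid_morphism.

Lemma toC_is_zmod_morphism : zmod_morphism (@toC R k).
Proof. by case: k => // x y /=; rewrite rmorphB. Qed.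

Lemma toC_is_monoid_morphism : monoid_morphism (@toC R k).
Proof. by case: k => /=; split=> // x y; rewrite rmorphM. Qed.

HB.instance Definition _ :=
  GRing.isZmodMorphism.Build K R[i]%C (@toC R k) toC_is_zmod_morphism.
HB.instance Definition _ :=
  GRing.isMonoidMorphism.Build K R[i]%C (@toC R k) toC_is_monoid_morphism.

Definition conjK_rmorphism : {rmorphism K -> K} := @conjK R k.

Lemma conjK_rmorphismK : involutive conjK_rmorphism.
Proof. by rewrite /conjK_rmorphism /=; case: k => //= z; exact: conjCK. Qed.

Lemma conjK_rmorphism_norm z : conjK_rmorphism z * z = `|z| ^+ 2.
Proof.
rewrite /conjK_rmorphism /=; case: k z => /= z; last by rewrite normCKC.
by rewrite real_normK ?num_real // expr2.
Qed.

Lemma toC_conj (z : K) : toC (conjK z) = conjC_rmorphism R (toC z).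
Proof. by case: k z => //= z; apply: complex_ext => //=; rewrite oppr0. Qed.

Lemma toC_ge0 (z : K) : (0 <= toC z) = (0 <= z).
Proof. by case: k z => //= z; rewrite ler0c. Qed.

Lemma toC_eq0 (z : K) : (toC z == 0) = (z == 0).
Proof. exact: (fmorph_eq0 (@toC R k)). Qed.

Lemma reKD (z w : K) : reK (z + w) = reK z + reK w.
Proof. by rewrite /reK rmorphD ReD. Qed.

Lemma reKN (z : K) : reK (- z) = - reK z.
Proof. by rewrite /reK rmorphN ReN. Qed.

Lemma reKB (z w : K) : reK (z - w) = reK z - reK w.
Proof. by rewrite reKD reKN. Qed.

Lemma toC_ge0E (z : K) : 0 <= z -> toC z = ((reK z)%:C)%C.
Proof. by move=> z0; rewrite /reK RRe_real // ger0_real // toC_ge0. Qed.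

Local Notation hadjK := (hadj conjK_rmorphism).
Local Notation hformK := (hform conjK_rmorphism).
Local Notation hpsdK := (hpsd conjK_rmorphism).
Local Notation hadjC := (hadj (conjC_rmorphism R)).
Local Notation hformC := (hform (conjC_rmorphism R)).

Lemma adjmxE p q (M : 'M[K]_(p, q)) : adjmx M = hadjK M.
Proof. by []. Qed.

Lemma mxCM p q r (M : 'M[K]_(p, q)) (N : 'M[K]_(q, r)) : mxC (M *m N) = mxC M *m mxC N.
Proof. exact: map_mxM. Qed.

Lemma mxCD p q (M N : 'M[K]_(p, q)) : mxC (M + N) = mxC M + mxC N.
Proof. exact: map_mxD. Qed.

Lemma mxC_adj p q (M : 'M[K]_(p, q)) : mxC (adjmx M) = hadjC (mxC M).
Proof. by apply/matrixP => i j; rewrite !mxE toC_conj. Qed.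

Lemma toC_hform p (G : 'M[K]_p) v w : toC (hformK G v w) = hformC (mxC G) (mxC v) (mxC w).
Proof.
have -> : toC (hformK G v w) = (mxC (adjmx v *m G *m w)) ord0 ord0 by rewrite [RHS]mxE.
by rewrite !mxCM mxC_adj.
Qed.

End ScalarMorphisms.

(* For K = R, the real part of a complex Hermitian form takes the same values
   at real vectors. *)
Lemma descend_form (R : realType) (k : scalar_kind) p (G : 'M[R[i]%C]_p)
    (F : 'M[base_field R k]_p) : hpsd (conjC_rmorphism R) G ->
  exists2 H : 'M[base_field R k]_p, hpsd (conjK_rmorphism R k) H &
  forall c : 'cV_p,
    hform (conjC_rmorphism R) G (mxC c) (mxC c) = toC (hform (conjK_rmorphism R k) H c c) /\
    complex.Re (hform (conjC_rmorphism R) G (mxC c) (mxC F *m mxC c)) =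
      reK (hform (conjK_rmorphism R k) H c (F *m c)).
Proof.
move=> Gpsd; have [GH G0] := Gpsd.
case: k F => F; last first.
  exists G => // c; rewrite /reK /toC /=.
  have mxCE p' q' (M : 'M[R[i]%C]_(p', q')) : @mxC R ComplexScalars p' q' M = M.
    by apply/matrixP => i j; rewrite mxE.
  by rewrite !mxCE.
pose H : 'M[R]_p := map_mx (@complex.Re R) G.
have HE (v w : 'cV[R]_p) : complex.Re (hform (conjC_rmorphism R) G (@mxC R RealScalars _ _ v)
     (@mxC R RealScalars _ _ w)) = hform (conjK_rmorphism R RealScalars) H v w.
  rewrite !hformE Re_sum; apply: eq_bigr => j _; rewrite Re_sum; apply: eq_bigr => i _.
  have cR (x : R) : conjC_rmorphism R (x%:C)%C = (x%:C)%C.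
    by apply: complex_ext => //=; rewrite oppr0.
  by rewrite !mxE cR ReM /= mulr0 subr0 ReM /= mul0r subr0.
exists H => [|c]; last first.
  split; last by rewrite -mxCM HE.
  by rewrite /= -HE RRe_real // ger0_real.
split; last by move=> v; rewrite -HE; exact: Re_ge0.
by apply/matrixP => i j; rewrite !mxE -[in RHS]GH !mxE Re_conj.
Qed.

Section KYPAlgebra.
Context (R : realType) (k : scalar_kind) (n m : nat)
  (S : descriptor_system R k n m).
Local Notation K := (base_field R k).
Local Notation cj := (conjK_rmorphism R k).
Local Notation E := (sysE S).
Local Notation A := (sysA S).
Local Notation B := (sysB S).
Local Notation Cm := (sysC S).
Local Notation D := (sysD S).

Lemma adjmxM p q r (M : 'M[K]_(p, q)) (N : 'M[K]_(q, r)) :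
  adjmx (M *m N) = adjmx N *m adjmx M.
Proof. exact: (hadjM cj). Qed.

Lemma adjmxK p q (M : 'M[K]_(p, q)) : adjmx (adjmx M) = M.
Proof. exact: (hadjK (@conjK_rmorphismK R k)). Qed.

Lemma adjmx_col_mx p q r (M : 'M[K]_(p, r)) (N : 'M[K]_(q, r)) :
  adjmx (col_mx M N) = row_mx (adjmx M) (adjmx N).
Proof. by rewrite /adjmx tr_col_mx map_row_mx. Qed.

Lemma reK_conj (z : K) : reK (conjK z) = reK z.
Proof. by rewrite /reK toC_conj Re_conj. Qed.

Lemma reK_adj (M : 'M[K]_1) : reK (adjmx M ord0 ord0) = reK (M ord0 ord0).
Proof. by rewrite !mxE reK_conj. Qed.

Lemma KYP_lhsE (Q : 'M[K]_n) (x : 'cV[K]_n) (u : 'cV[K]_m) :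
  reK ((adjmx (col_mx (Q *m x) u) *m block_mx A B (- Cm) (- D) *m
        col_mx x u) ord0 ord0) =
  reK ((adjmx (Q *m x) *m (A *m x + B *m u)) ord0 ord0) -
  reK ((adjmx u *m (Cm *m x + D *m u)) ord0 ord0).
Proof.
rewrite -mulmxA mul_block_col adjmx_col_mx mul_row_col !mulNmx -opprD mulmxN.
by rewrite mxE reKD [X in _ + reK X = _]mxE reKN.
Qed.

(* X0, U0 parametrize V and F is a lift of [A B] through E: along V, the
   equation (d/dt) E x = A x + B u is solved by x = X0 c, u = U0 c, c' = F c. *)
Record parametrizes (V : {vspace 'cV[K]_(n + m)}) d (X0 : 'M[K]_(n, d))
    (U0 : 'M[K]_(m, d)) (F : 'M[K]_d) : Prop := Parametrizes {
  param_eq : A *m X0 + B *m U0 = E *m X0 *m F;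
  param_mem : forall c : 'cV_d, col_mx (X0 *m c) (U0 *m c) \in V;
  param_onto : forall x u, col_mx x u \in V -> exists c : 'cV_d, x = X0 *m c /\ u = U0 *m c }.

Section Parametrized.
Context (V : {vspace 'cV[K]_(n + m)}) (d : nat) (X0 : 'M[K]_(n, d))
    (U0 : 'M[K]_(m, d)) (F : 'M[K]_d).
Hypothesis VP : parametrizes V X0 U0 F.

Lemma param_deriv (c : 'cV_d) : A *m (X0 *m c) + B *m (U0 *m c) = E *m X0 *m (F *m c).
Proof. by rewrite !mulmxA -mulmxDl (param_eq VP). Qed.

(** The common exit of the implications from (KYP), (Pa) and (PR): each of them produces a form [G]
    on the parameters. *)
Lemma KYP_E_of_form (G : 'M[K]_d) : hpsd cj G ->
  (forall c : 'cV_d, E *m X0 *m c = 0 -> hform cj G c c = 0) ->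
  (forall c : 'cV_d, reK (hform cj G c (F *m c)) <=
     reK ((adjmx (U0 *m c) *m (Cm *m (X0 *m c) + D *m (U0 *m c))) ord0 ord0)) ->
  KYP_E S V.
Proof.
move=> Gpsd G0 Gdiss.
have [Y [YH Y0] GE] := hpsd_factor (@conjK_rmorphismK R k) (@conjK_rmorphism_norm R k) Gpsd G0.
exists Y; split=> //; split.
  by rewrite adjmxM adjmxE [adjmx Y]adjmxE YH mulmxA.
move=> x u /(param_onto VP) [c [-> ->]].
have GE' v w : hform cj G v w = hform cj Y (E *m X0 *m v) (E *m X0 *m w).
  by rewrite hformM -GE.
split; last first.
  suff -> : adjmx (X0 *m c) *m adjmx E *m (Y *m E) *m (X0 *m c) =
    adjmx (E *m X0 *m c) *m Y *m (E *m X0 *m c) by exact: Y0.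
  by rewrite !adjmxM !mulmxA.
rewrite KYP_lhsE subr_le0; apply: le_trans (Gdiss c).
rewrite GE' param_deriv /hform -mulmxA adjmxM adjmxE [adjmx Y]adjmxE YH.
by rewrite !mulmxA.
Qed.

Lemma KYP_E_KYP : KYP_E S V -> KYP S V.
Proof. by move=> [Y [YH YP]]; exists (Y *m E). Qed.

(** By [E^H Q = Q^H E], the form [X0^H E^H Q X0] vanishes on [ker (E X0)], so it factors through
    [E X0] although [Q] need not factor through [E]. *)
Lemma KYP_to_KYP_E : KYP S V -> KYP_E S V.
Proof.
move=> [Q [QH QP]].
pose G := adjmx X0 *m (adjmx E *m Q) *m X0.
have GE (v w : 'cV_d) : hform cj G v w = (adjmx (Q *m (X0 *m v)) *m (E *m X0 *m w)) ord0 ord0.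
  rewrite /hform /G QH -adjmxE !adjmxM; congr (_ ord0 ord0); by rewrite !mulmxA.
have Gpsd : hpsd cj G.
  split=> [|v].
    rewrite -adjmxE /G !adjmxM !adjmxK -QH; by rewrite !mulmxA.
  have [_] := QP _ _ (param_mem VP v); rewrite GE !adjmxM.
  by rewrite -!mulmxA [adjmx E *m _]mulmxA QH -!mulmxA.
apply: (KYP_E_of_form Gpsd) => c.
  by move=> Ec0; rewrite GE Ec0 mulmx0 mxE.
have [+ _] := QP _ _ (param_mem VP c); rewrite KYP_lhsE subr_le0; apply: le_trans.
by rewrite GE param_deriv.
Qed.

End Parametrized.

End KYPAlgebra.

(** * The transfer function *)

Section RationalFunctionLink.
Context (R : realType).
Local Notation C := (R[i]%C).
Local Open Scope quotient_scope.

Lemma repr_cross (f : ratfun R) (N D : {poly C}) : D != 0 ->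
  f = FracField.tofrac N / FracField.tofrac D ->
  (repr f).1 * D = N * (repr f).2.
Proof.
move=> D0 fE; have : f * FracField.tofrac D = FracField.tofrac N.
  by rewrite fE divfK // tofrac_eq0.
rewrite -{1}[f]reprK; set r := repr f.
have fracE (P : {poly C}) : FracField.tofrac P = \pi_(ratfun R) (Ratio P 1).
  by rewrite piE.
rewrite !fracE; have -> : \pi_(ratfun R) r * \pi_(ratfun R) (Ratio D 1) =
    \pi_(ratfun R) (FracField.mulf r (Ratio D 1)).
  exact/esym/(FracField.pi_mul r (Ratio D 1)).
move/eqP; rewrite FracField.equivf_def /FracField.mulf.
have r0 : r.2 != 0 := denom_ratioP r.
rewrite !numden_Ratio ?oner_neq0 ?mulf_neq0 ?oner_neq0 // !mulr1 => /eqP ->.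
by rewrite mulrC.
Qed.

(** Cross multiplication ties the explicit fraction to the reduced one and frees later arguments
    from the chosen representative. *)
Lemma ratnum_ratden (f : ratfun R) (N D : {poly C}) : D != 0 ->
  f = FracField.tofrac N / FracField.tofrac D ->
  [/\ N * ratden f = ratnum f * D, coprimep (ratnum f) (ratden f) & ratden f != 0].
Proof.
move=> D0 fE; have := repr_cross D0 fE.
have r0 : (repr f).2 != 0 := denom_ratioP (repr f).
set g := gcdp (repr f).1 (repr f).2.
have g0 : g != 0 by rewrite gcdp_eq0 (negPf r0) andbF.
have rp : (repr f).1 = ratnum f * g by rewrite /ratnum divpK // dvdp_gcdl.
have rq : (repr f).2 = ratden f * g by rewrite /ratden divpK // dvdp_gcdr.
rewrite {1}rp {1}rq => rel; split.
- by apply: (mulIf g0); rewrite -mulrA -rel mulrAC.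
- by apply: coprimep_div_gcd; rewrite r0 orbT.
- by move: r0; rewrite {1}rq mulf_eq0 negb_or => /andP [].
Qed.

End RationalFunctionLink.

Section TransferLink.
Context (R : realType) (k : scalar_kind) (n m : nat)
  (S : descriptor_system R k n m).
Local Notation C := (R[i]%C).
Local Notation Ec := (mxC (sysE S)).
Local Notation Ac := (mxC (sysA S)).
Local Notation Bc := (mxC (sysB S)).
Local Notation Cc := (mxC (sysC S)).
Local Notation Dc := (mxC (sysD S)).
Local Notation hadjC := (hadj (conjC_rmorphism R)).
Local Notation hformC := (hform (conjC_rmorphism R)).

Hypothesis reg : regular S.

Lemma det_pencil_neq0 : \det (pencil Ec Ac) != 0.
Proof.
have [l unit_l] := reg; apply: contraTneq unit_l => det0.
by rewrite unitmxE unitfE -det_pencil_horner det0 horner0 eqxx.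
Qed.

Lemma transfer_entryE i j : transfer S i j =
  FracField.tofrac (transfer_num Ec Ac Bc Cc Dc i j) / FracField.tofrac (\det (pencil Ec Ac)).
Proof.
pose tf := @FracField.tofrac {poly C}.
have ratE p q (M : 'M[C]_(p, q)) : map_mx (@ratC R) M = map_mx tf (map_mx polyC M).
  by apply/matrixP => a b; rewrite !mxE.
have pencilE : ratX R *: map_mx (@ratC R) Ec - map_mx (@ratC R) Ac = map_mx tf (pencil Ec Ac).
  by rewrite !ratE /pencil map_mxB map_mxZ.
have detE : \det (map_mx tf (pencil Ec Ac)) = tf (\det (pencil Ec Ac)) by rewrite det_map_mx.
have det0 : tf (\det (pencil Ec Ac)) != 0 by rewrite tofrac_eq0 det_pencil_neq0.
rewrite /transfer pencilE /invmx unitmxE unitfE detE det0 !ratE.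
rewrite -scalemxAr -scalemxAl -map_mx_adj.
apply: (canRL (mulfK det0)); rewrite mulrC.
set X := map_mx tf _ *m _ *m _; set Y := map_mx tf (map_mx _ Dc).
have -> : tf (\det (pencil Ec Ac)) * ((tf (\det (pencil Ec Ac)))^-1 *: X + Y) i j =
   (tf (\det (pencil Ec Ac)) *: ((tf (\det (pencil Ec Ac)))^-1 *: X + Y)) i j.
  by rewrite [RHS]mxE.
rewrite scalerDr scalerA divff // scale1r /X /Y -!map_mxM -map_mxZ -map_mxD.
by rewrite [LHS]mxE.
Qed.

Let p i j := ratnum (transfer S i j).
Let q i j := ratden (transfer S i j).

Lemma transfer_fracP i j :
  [/\ transfer_num Ec Ac Bc Cc Dc i j * q i j = p i j * \det (pencil Ec Ac),
      coprimep (p i j) (q i j) & q i j != 0].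
Proof. exact: ratnum_ratden det_pencil_neq0 (transfer_entryE i j). Qed.

Lemma Re_form_herm_sum (M : 'M[C]_m) v :
  hformC (M + hadjC M) v v = ((2 * complex.Re (hformC M v v))%:C)%C.
Proof.
have -> : hformC (M + hadjC M) v v = hformC M v v + conjC_rmorphism R (hformC M v v).
  by rewrite (hform_conj (@conjC_rmorphismK R)) /hform mulmxDr mulmxDl mxE.
by rewrite -[LHS](@mulVKf _ 2) ?pnatr_eq0 // half_addcJ rmorphM rmorph_nat.
Qed.

Lemma psdmx_herm_sum (M : 'M[C]_m) :
  psdmx (M + map_mx Num.conj M^T) <-> forall v, 0 <= complex.Re (hformC M v v).
Proof.
split=> [[_ Mpos] v|Mpos].
  have := Mpos v; rewrite -[X in 0 <= X]/(hformC (M + hadjC M) v v) Re_form_herm_sum.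
  by rewrite ler0c pmulr_rge0.
split=> [|v].
  apply/is_hermitianmxP; rewrite expr0 scale1r; apply/matrixP => i j.
  by rewrite !mxE rmorphD /= conjCK addrC.
by rewrite -[X in 0 <= X]/(hformC (M + hadjC M) v v) Re_form_herm_sum ler0c pmulr_rge0.
Qed.

Lemma transfer_atE s : transfer_at S s = \matrix_(i, j) ((p i j).[s] / (q i j).[s]).
Proof. by apply/matrixP => i j; rewrite [LHS]mxE [RHS]mxE. Qed.

End TransferLink.

Lemma positive_real_KYP_E (R : realType) (k : scalar_kind) (n m d : nat)
    (S : descriptor_system R k n m) (V : {vspace 'cV[base_field R k]_(n + m)})
    X0 U0 (F : 'M[base_field R k]_d) :
  regular S -> parametrizes S V X0 U0 F ->
  behaviorally_controllable S -> positive_real S -> KYP_E S V.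
Proof.
move=> reg VP ctrl [nopole pos].
have data : mxC (sysA S) *m mxC X0 + mxC (sysB S) *m mxC U0 =
    mxC (sysE S) *m mxC X0 *m mxC F.
  by rewrite -!mxCM -mxCD (param_eq VP).
have [|||G Gpsd [G0 Gdiss]] := positive_real_storage reg ctrl
  (p := fun i j => ratnum (transfer S i j)) (q := fun i j => ratden (transfer S i j))
  (Cm := mxC (sysC S)) (D := mxC (sysD S)) _ _ _ data.
- by move=> i j; have [] := transfer_fracP reg i j.
- by move=> i j s s0; apply/negP; exact: nopole.
- by move=> s v /pos /psdmx_herm_sum /(_ v); rewrite transfer_atE.
have [H Hpsd HE] := descend_form F Gpsd.
apply: (KYP_E_of_form VP Hpsd) => c.
  move=> Ec0; have [HG _] := HE c; apply/eqP; rewrite -toC_eq0 -HG.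
  by apply/eqP; apply: G0; rewrite -!mxCM Ec0; apply/matrixP => i j; rewrite !mxE rmorph0.
have [_ FE] := HE c; have := Gdiss (mxC c); rewrite FE; congr (_ <= _).
suff -> : hadj (conjC_rmorphism R) (mxC U0 *m mxC c) *m
  ((mxC (sysC S) *m mxC X0 + mxC (sysD S) *m mxC U0) *m mxC c) =
  mxC (adjmx (U0 *m c) *m (sysC S *m (X0 *m c) + sysD S *m (U0 *m c))).
  by rewrite [in LHS]mxE.
by rewrite !mxCM mxC_adj mxCD !mxCM mulmxDl !mulmxA.
Qed.

(** * From KYP to positive realness *)

Section NoPoles.
Context (R : realType).
Local Notation C := (R[i]%C).
Local Notation Re := (@complex.Re R).
Local Notation hformC := (hform (conjC_rmorphism R)).

Lemma Re_horner_real (F : {poly C}) (t : R) :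
  (map_poly Re F).[t] = Re F.[(t%:C)%C].
Proof.
rewrite horner_poly horner_coef Re_sum; apply: eq_bigr => i _.
by rewrite -rmorphXn ReM /= mulr0 subr0.
Qed.

Lemma conj_horner_real (F : {poly C}) (t : R) :
  (map_poly (conjC_rmorphism R) F).[(t%:C)%C] = conjC_rmorphism R F.[(t%:C)%C].
Proof.
have -> : (t%:C)%C = conjC_rmorphism R (t%:C)%C.
  by apply: complex_ext => //=; rewrite oppr0.
rewrite horner_map; congr (conjC_rmorphism R F.[_]).
by apply: complex_ext => //=; rewrite oppr0.
Qed.

(* Letting s tend to s0 along the ray of direction w isolates the leading
   coefficients, with an argument which is free when a > b. *)
Lemma halfplane_limit (N D N1 D1 : {poly C}) (s0 w : C) (a b : nat) :
  (forall s, 0 < Re s -> 0 <= Re (N.[s] * conjC_rmorphism R D.[s])) ->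
  0 < Re s0 -> w != 0 -> (b <= a)%N ->
  N = N1 * ('X - s0%:P) ^+ b -> D = D1 * ('X - s0%:P) ^+ a ->
  0 <= Re (conjC_rmorphism R w ^+ (a - b) * (N1.[s0] * conjC_rmorphism R D1.[s0])).
Proof.
move=> pos s0_gt0 w0 ba NE DE.
pose line := s0%:P + w *: 'X : {poly C}.
(* At real arguments the conjugate of a polynomial is the polynomial with conjugate coefficients, so
   along the ray the expression is a polynomial in the real parameter. *)
pose F := conjC_rmorphism R w ^+ (a - b) *:
  ((N1 \Po line) * map_poly (conjC_rmorphism R) (D1 \Po line)).
have lineE t : line.[t] = s0 + w * t by rewrite !hornerE.
have FE (t : R) : F.[(t%:C)%C] = conjC_rmorphism R w ^+ (a - b) *
   (N1.[s0 + w * (t%:C)%C] * conjC_rmorphism R D1.[s0 + w * (t%:C)%C]).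
  by rewrite hornerZ hornerM conj_horner_real !horner_comp !lineE.
(* Short enough that [s0 + w t] stays in the open half-plane for [0 < t < dl]. *)
pose dl := Re s0 / (cabs w + 1).
have w1 : 0 < cabs w + 1 by rewrite ltr_wpDl ?cabs_ge0.
have dl0 : 0 < dl by rewrite divr_gt0.
have := @poly_ge0_right R (map_poly Re F) dl dl0.
rewrite Re_horner_real FE rmorph0 mulr0 addr0; apply=> t /andP [t0 td].
rewrite Re_horner_real FE; set s := s0 + _.
have s_gt0 : 0 < Re s.
  rewrite /s ReD; have : `|Re (w * (t%:C)%C)| <= cabs w * t.
    by apply: le_trans (Re_cabs _) _; rewrite cabsM cabs_real gtr0_norm.
  rewrite ler_norml => /andP [+ _].
  have : t * (cabs w + 1) < Re s0 by rewrite -ltr_pdivlMr.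
  by have := cabs_ge0 w; nra.
have := pos s s_gt0; rewrite NE DE !hornerM !horner_exp !hornerXsubC.
have -> : s - s0 = w * (t%:C)%C by rewrite /s addrC addKr.
set n1 := N1.[s]; set d1 := D1.[s]; set c := conjC_rmorphism R w.
have cjt : conjC_rmorphism R (t%:C)%C = (t%:C)%C.
  by apply: complex_ext => //=; rewrite oppr0.
rewrite rmorphM rmorphXn rmorphM /= cjt -/c.
(* The positive factor [|w|^(2b) t^(a+b)] is split off; the rest has a limit as [t] tends to 0. *)
have -> : n1 * (w * (t%:C)%C) ^+ b * (conjC_rmorphism R d1 * (c * (t%:C)%C) ^+ a) =
   (((cabs w ^+ 2) ^+ b * t ^+ (a + b))%:C)%C * (c ^+ (a - b) * (n1 * conjC_rmorphism R d1)).
  rewrite rmorphM !rmorphXn /= cabsE -(conjC_rmorphism_norm w) -/c.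
  have ca : c ^+ a = c ^+ (a - b) * c ^+ b by rewrite -exprD subnK.
  by rewrite !exprMn exprD ca; ring.
rewrite ReM /= mul0r subr0 pmulr_rge0 //.
by rewrite mulr_gt0 ?exprn_gt0 ?cabs_gt0.
Qed.

(** If [N] vanished to a lower order [b < a], the direction [w] with [w^(a-b) = - ka] would make the
    limiting value [- |ka|^2 < 0]. *)
Lemma halfplane_mult (N D : {poly C}) (s0 : C) (a : nat) (D1 : {poly C}) :
  (forall s, 0 < Re s -> 0 <= Re (N.[s] * conjC_rmorphism R D.[s])) ->
  0 < Re s0 -> D = D1 * ('X - s0%:P) ^+ a -> ~~ root D1 s0 ->
  ('X - s0%:P) ^+ a %| N.
Proof.
move=> pos s0_gt0 DE D10.
have [->|Nn0] := eqVneq N 0; first exact: dvdp0.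
have [b [N1 /implyP /(_ Nn0) N10 NE]] := multiplicity_XsubC N s0.
have [ab|ba] := leqP a b.
  by rewrite NE dvdp_mull // dvdp_exp2l.
set ka := N1.[s0] * conjC_rmorphism R D1.[s0].
have ka0 : ka != 0 by rewrite mulf_neq0 // fmorph_eq0.
pose w := (a - b).-root (- ka).
have we : w ^+ (a - b) = - ka by rewrite rootCK // subn_gt0.
have w0 : w != 0.
  apply: contra_eq_neq we => ->; rewrite expr0n subn_eq0 leqNgt ba /= eq_sym oppr_eq0 //.
have := halfplane_limit pos s0_gt0 w0 (ltnW ba) NE DE.
rewrite -rmorphXn /= we rmorphN mulNr -/ka ReN conjC_rmorphism_norm.
rewrite oppr_ge0 -cabsE -rmorphXn /= leNgt exprn_gt0 // cabs_gt0 //.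
Qed.

End NoPoles.

Section ComplexSolutions.
Context (R : realType).
Local Notation C := (R[i]%C).
Local Notation hformC := (hform (conjC_rmorphism R)).
Local Notation hadjC := (hadj (conjC_rmorphism R)).

Lemma mxC_ComplexE p q (M : 'M[C]_(p, q)) : @mxC R ComplexScalars p q M = M.
Proof. by apply/matrixP => i j; rewrite mxE. Qed.

(* A complex eigensolution spans a real invariant plane when K = R. *)
Lemma eigensolution_data (k : scalar_kind) n m (S : descriptor_system R k n m)
    (x : 'cV[C]_n) (v : 'cV[C]_m) (s : C) :
  mxC (sysA S) *m x + mxC (sysB S) *m v = s *: (mxC (sysE S) *m x) ->
  exists d (X : 'M[base_field R k]_(n, d)) (U : 'M[base_field R k]_(m, d))
    (F : 'M[base_field R k]_d) (c : 'cV[C]_d),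
    [/\ sysA S *m X + sysB S *m U = sysE S *m X *m F, mxC X *m c = x & mxC U *m c = v].
Proof.
case: k S => S eig; last first.
  exists 1%N, x, v, (s%:M), 1%:M; rewrite !mxC_ComplexE !mulmx1; split=> //.
  by move: eig; rewrite !mxC_ComplexE mul_mx_scalar.
have split_mx p q (M : 'M[C]_(p, q)) :
    M = @mxC R RealScalars _ _ (map_mx (@complex.Re R) M) +
        'i%C *: @mxC R RealScalars _ _ (map_mx (@complex.Im R) M).
  by apply/matrixP => i j; rewrite !mxE -complexE.
pose re p q (M : 'M[C]_(p, q)) : 'M[R]_(p, q) := map_mx (@complex.Re R) M.
pose im p q (M : 'M[C]_(p, q)) : 'M[R]_(p, q) := map_mx (@complex.Im R) M.
pose a := complex.Re s; pose b := complex.Im s.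
pose F : 'M[R]_(1 + 1) := block_mx (a%:M) (b%:M) ((- b)%:M) (a%:M).
exists (1 + 1)%N, (row_mx (re _ _ x) (im _ _ x)), (row_mx (re _ _ v) (im _ _ v)), F.
exists (col_mx 1%:M ('i%C)%:M).
have comb p (M N : 'cV[R]_p) : @mxC R RealScalars _ _ (row_mx M N) *m col_mx 1%:M ('i%C)%:M =
   @mxC R RealScalars _ _ M + 'i%C *: @mxC R RealScalars _ _ N.
  by rewrite /mxC map_row_mx mul_row_col mulmx1 mul_mx_scalar.
split; last 2 first.
- by rewrite comb -split_mx.
- by rewrite comb -split_mx.
have ReMx p q (M : 'M[R]_(p, q)) (y : 'cV[C]_q) :
    re _ _ (@mxC R RealScalars _ _ M *m y) = M *m re _ _ y.
  apply/matrixP => i j; rewrite !mxE Re_sum; apply: eq_bigr => l _.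
  by rewrite !mxE ReM /= mul0r subr0.
have ImMx p q (M : 'M[R]_(p, q)) (y : 'cV[C]_q) :
    im _ _ (@mxC R RealScalars _ _ M *m y) = M *m im _ _ y.
  apply/matrixP => i j; rewrite !mxE Im_sum; apply: eq_bigr => l _.
  by rewrite !mxE ImM /= mul0r addr0.
have reD p (y z : 'cV[C]_p) : re _ _ (y + z) = re _ _ y + re _ _ z.
  by apply/matrixP => i j; rewrite !mxE ReD.
have imD p (y z : 'cV[C]_p) : im _ _ (y + z) = im _ _ y + im _ _ z.
  by apply/matrixP => i j; rewrite !mxE ImD.
have eqRe := congr1 (re _ _) eig; have eqIm := congr1 (im _ _) eig.
rewrite !mul_mx_row add_row_mx mul_row_block !mul_mx_scalar.
rewrite reD !ReMx in eqRe; rewrite imD !ImMx in eqIm; rewrite eqRe eqIm.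
rewrite -!ReMx -!ImMx; move: (_ *m x) => y.
by congr row_mx; apply/matrixP => i j; rewrite !mxE ?ReM ?ImM -/a -/b; ring.
Qed.

(** For K = R the value at [a + i b] is the sum of those at [a] and at [b], up to cross terms that
    are purely imaginary. *)
Lemma complexify_Re_ge0 (k : scalar_kind) p (G : 'M[base_field R k]_p) :
  (forall c, 0 <= reK (hform (conjK_rmorphism R k) G c c)) ->
  forall c, 0 <= complex.Re (hformC (mxC G) c c).
Proof.
case: k G => G G0 c; last first.
  by rewrite mxC_ComplexE; exact: G0.
have split_c : c = @mxC R RealScalars _ _ (map_mx (@complex.Re R) c) +
        'i%C *: @mxC R RealScalars _ _ (map_mx (@complex.Im R) c).
  by apply/matrixP => i j; rewrite !mxE -complexE.
have ci : conjC_rmorphism R 'i%C = - 'i%C.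
  by apply: complex_ext => /=; rewrite ?oppr0.
rewrite split_c !(hformDl, hformDr, hformZl, hformZr) -!toC_hform ci.
set a := hform _ G _ _; set b := hform _ G _ _; set d := hform _ G _ _.
set e := hform _ G _ _ => /=.
have a0 : 0 <= a := G0 _; have e0 : 0 <= e := G0 _.
by rewrite !(mul0r, mulr0, mul1r, subr0, add0r, addr0, oppr0, sub0r, mulN1r, opprK) addr_ge0.
Qed.

End ComplexSolutions.

Section KYPImpliesPositiveReal.
Context (R : realType) (k : scalar_kind) (n m : nat)
  (S : descriptor_system R k n m) (V : {vspace 'cV[base_field R k]_(n + m)}).
Local Notation K := (base_field R k).
Local Notation C := (R[i]%C).
Local Notation Re := (@complex.Re R).
Local Notation hadjC := (hadj (conjC_rmorphism R)).
Local Notation hformC := (hform (conjC_rmorphism R)).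
Local Notation Ec := (mxC (sysE S)).
Local Notation Ac := (mxC (sysA S)).
Local Notation Bc := (mxC (sysB S)).
Local Notation Cc := (mxC (sysC S)).
Local Notation Dc := (mxC (sysD S)).
Hypothesis reg : regular S.
Hypothesis kyp : KYP_E S V.
Hypothesis V_data : forall d (X : 'M[K]_(n, d)) (U : 'M[K]_(m, d)) (F : 'M[K]_d),
  sysA S *m X + sysB S *m U = sysE S *m X *m F ->
  forall c : 'cV_d, col_mx (X *m c) (U *m c) \in V.

Lemma mxCB p q (M N : 'M[K]_(p, q)) : mxC (M - N) = mxC M - mxC N.
Proof. exact: map_mxB. Qed.

(** Along [e^(s t) (x, v)] dissipativity reads [Re (s h) <= Re (v^H y)] with [h = (E x)^H Y (E x)]
    real and nonnegative. As [x] may be complex when K = R, both conditions are first pulled back to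
    matrices [G1], [G2] over K and then extended to complex parameters. *)
Lemma kyp_eigensolution (x : 'cV[C]_n) (v : 'cV[C]_m) (s : C) : 0 < Re s ->
  Ac *m x + Bc *m v = s *: (Ec *m x) ->
  0 <= Re ((hadjC v *m (Cc *m x + Dc *m v)) ord0 ord0).
Proof.
move=> s0 eig; have [Y [YH [_ YP]]] := kyp.
have [d [X [U [F [c [data Xc Uc]]]]]] := eigensolution_data eig.
pose G1 := adjmx U *m (sysC S *m X + sysD S *m U) -
  adjmx (Y *m sysE S *m X) *m (sysA S *m X + sysB S *m U).
pose G2 := adjmx X *m adjmx (sysE S) *m (Y *m sysE S) *m X.
have G1pos : 0 <= Re (hformC (mxC G1) c c).
  apply: complexify_Re_ge0 => a; have [+ _] := YP _ _ (V_data data a).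
  rewrite KYP_lhsE subr_le0 -subr_ge0 -reKB; congr (0 <= reK _).
  rewrite /hform /G1 mulmxBr mulmxBl [RHS]mxE [X in _ = _ + X]mxE -adjmxE.
  have sumE p (M : 'M[K]_(p, n)) (P : 'M[K]_(p, m)) :
    M *m (X *m a) + P *m (U *m a) = (M *m X + P *m U) *m a.
    by rewrite mulmxDl !mulmxA.
  by rewrite !sumE !adjmxM !mulmxA.
have G2pos : 0 <= Re (hformC (mxC G2) c c).
  apply: complexify_Re_ge0 => a; have [_] := YP _ _ (V_data data a).
  rewrite -toC_ge0 => /Re_ge0; congr (0 <= Re (toC _)).
  by rewrite /hform /G2 -adjmxE !adjmxM !mulmxA.
set h := hformC (mxC Y) (Ec *m x) (Ec *m x).
have hE : hformC (mxC G2) c c = h.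
  by rewrite /h -Xc /hform /G2 !mxCM !mxC_adj !hadjM !mulmxA.
have hreal : complex.Im h = 0.
  have : conjC_rmorphism R h = h.
    by rewrite /h (hform_conj (@conjC_rmorphismK R)) -mxC_adj -YH.
  by move/(congr1 (@complex.Im R)); rewrite Im_conj; lra.
have : hformC (mxC G1) c c = (hadjC v *m (Cc *m x + Dc *m v)) ord0 ord0 - s * h.
  rewrite /G1 mxCB !mxCM !mxCD !mxCM !mxC_adj /hform mulmxBr mulmxBl.
  rewrite [LHS]mxE [X in _ + X = _]mxE; congr (_ - _).
    by rewrite -!mulmxA [_ *m c]mulmxDl -!mulmxA Xc Uc mulmxA -hadjM Uc.
  rewrite -!mulmxA [_ *m c]mulmxDl -!mulmxA Xc Uc eig -!scalemxAr mxE; congr (_ * _).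
  by rewrite mulmxA -hadjM !mxCM -!mulmxA Xc hadjM -mxC_adj -YH /h /hform !mulmxA.
move=> G1E; move: G1pos; rewrite G1E ReB subr_ge0; apply: le_trans.
by rewrite ReM hreal mulr0 subr0 mulr_ge0 ?(ltW s0) // -hE.
Qed.

Let num := transfer_num Ec Ac Bc Cc Dc.
Let den := \det (pencil Ec Ac).
Let quad (N : 'M[{poly C}]_m) (v : 'cV[C]_m) : {poly C} :=
  \sum_j \sum_i (conjC_rmorphism R (v i ord0) * v j ord0) *: N i j.

Lemma quad_horner N v s : (quad N v).[s] = hformC (map_mx (horner_eval s) N) v v.
Proof.
rewrite hformE horner_sum; apply: eq_bigr => j _; rewrite horner_sum; apply: eq_bigr => i _.
by rewrite hornerZ mxE /horner_eval mulrAC.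
Qed.

(** Multiplying by the conjugate of [den] instead of dividing by [den] keeps the inequality valid at
    the zeros of [den], which are the possible poles. *)
Lemma quad_num_ge0 v s : 0 < Re s ->
  0 <= Re ((quad num v).[s] * conjC_rmorphism R den.[s]).
Proof.
move=> s0; have [->|det0] := eqVneq den.[s] 0; first by rewrite rmorph0 mulr0.
have unit_s : s *: Ec - Ac \in unitmx.
  by rewrite unitmxE unitfE -det_pencil_horner.
set T := Cc *m invmx (s *: Ec - Ac) *m Bc + Dc.
have -> : (quad num v).[s] = den.[s] * hformC T v v.
  rewrite quad_horner -hform_scalem; congr (hform _ _ _ _); apply/matrixP => i j.
  by rewrite mxE [RHS]mxE /horner_eval transfer_num_horner.
rewrite mulrAC -[X in Re (X * _)](mulrC (conjC_rmorphism R _)) conjC_rmorphism_norm.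
rewrite -cabsE -rmorphXn /= ReM /= mul0r subr0 pmulr_rge0 ?exprn_gt0 ?cabs_gt0 //.
pose x := invmx (s *: Ec - Ac) *m (Bc *m v).
have -> : hformC T v v = (hadjC v *m (Cc *m x + Dc *m v)) ord0 ord0.
  by rewrite /hform /T /x -mulmxA mulmxDl !mulmxA.
apply: (kyp_eigensolution s0).
have : (s *: Ec - Ac) *m x = Bc *m v by rewrite /x mulKVmx.
by rewrite mulmxBl -scalemxAl => <-; rewrite addrC subrK.
Qed.

(** Each coefficient of the remainders modulo [P] forms a constant matrix whose quadratic form
    vanishes; by polarization the matrix is 0. *)
Lemma quad_dvd_entry (N : 'M[{poly C}]_m) (P : {poly C}) :
  (forall v, P %| quad N v) -> forall i j, P %| N i j.
Proof.
move=> dvd i j; apply/modp_eq0P/polyP => l; rewrite coef0.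
pose G : 'M[C]_m := \matrix_(i, j) (N i j %% P)`_l.
have G0 v : hformC G v v = 0.
  have /modp_eq0P/(congr1 (fun F : {poly C} => F`_l)) := dvd v.
  rewrite coef0 => <-; rewrite hformE /quad.
  rewrite (big_morph (fun F : {poly C} => F %% P) (fun x y => modpD P x y) (mod0p P)).
  rewrite coef_sum; apply: eq_bigr => b _.
  rewrite (big_morph (fun F : {poly C} => F %% P) (fun x y => modpD P x y) (mod0p P)).
  rewrite coef_sum; apply: eq_bigr => a _.
  by rewrite modpZl coefZ mxE mulrAC.
have : G i j = 0.
  rewrite (hform_entry (conjC_rmorphism R)) hformC_polarization !G0.
  by rewrite !subrr !mulr0 subrr mulr0.
by rewrite mxE.
Qed.

Lemma KYP_E_positive_real : positive_real S.
Proof.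
have den0 : den != 0 := det_pencil_neq0 reg.
(* The full power of [X - s0] in the denominator cancels against every numerator entry. *)
have key s0 : 0 < Re s0 -> exists a (D1 : {poly C}) (N1 : 'M[{poly C}]_m),
  [/\ ~~ root D1 s0, den = D1 * ('X - s0%:P) ^+ a &
      forall i j, num i j = N1 i j * ('X - s0%:P) ^+ a].
  move=> s0_gt0; have [a [D1 /implyP /(_ den0) D10 DE]] := multiplicity_XsubC den s0.
  exists a, D1, (\matrix_(i, j) (num i j %/ ('X - s0%:P) ^+ a)); split=> // i j.
  rewrite [in RHS]mxE divpK //; apply: quad_dvd_entry => v.
  by apply: (halfplane_mult _ s0_gt0 DE D10) => s; exact: quad_num_ge0.
(* [N1 / D1] and the reduced fraction agree; if the reduced denominator vanished at [s0], so would
   its numerator, against coprimality. *)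
have val s0 a (D1 : {poly C}) (N1 : 'M[{poly C}]_m) i j :
    ~~ root D1 s0 -> den = D1 * ('X - s0%:P) ^+ a ->
    num i j = N1 i j * ('X - s0%:P) ^+ a ->
    (ratden (transfer S i j)).[s0] != 0 /\
    (N1 i j).[s0] * (ratden (transfer S i j)).[s0] = (ratnum (transfer S i j)).[s0] * D1.[s0].
  move=> D10 DE NE; have [rel cop _] := transfer_fracP reg i j.
  have {}rel : N1 i j * ratden (transfer S i j) = ratnum (transfer S i j) * D1.
    have Xa0 : ('X - s0%:P) ^+ a != 0 by rewrite expf_neq0 // polyXsubC_eq0.
    by apply: (mulIf Xa0); rewrite mulrAC -NE rel -/den DE mulrA.
  have := congr1 (fun F : {poly C} => F.[s0]) rel; rewrite !hornerM => rels; split=> //.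
  apply/negP => /eqP q0; move: rels; rewrite q0 mulr0 => /esym/eqP.
  rewrite mulf_eq0 -[X in _ || X]rootE (negPf D10) orbF => /eqP p0.
  have p0r : root (ratnum (transfer S i j)) s0 by rewrite rootE p0.
  by have := coprimep_root cop p0r; rewrite q0 eqxx.
split=> s s_gt0; have [a [D1 [N1 [D10 DE NE]]]] := key s s_gt0.
  by move=> i j; have [q0 _] := val s a D1 N1 i j D10 DE (NE i j); exact/negP.
apply/psdmx_herm_sum => v; rewrite transfer_atE.
have D10' : D1.[s] != 0 by [].
have -> : \matrix_(i, j) ((ratnum (transfer S i j)).[s] / (ratden (transfer S i j)).[s]) =
    D1.[s]^-1 *: map_mx (horner_eval s) N1.
  apply/matrixP => i j; rewrite [LHS]mxE [RHS]mxE [in RHS]mxE /horner_eval.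
  have [q0 rels] := val s a D1 N1 i j D10 DE (NE i j).
  by apply/eqP; rewrite [X in _ == X]mulrC eqr_div // -rels.
rewrite hform_scalem -quad_horner invC_norm -mulrA.
have quadE : quad num v = quad N1 v * ('X - s%:P) ^+ a.
  rewrite /quad mulr_suml; apply: eq_bigr => j _; rewrite mulr_suml.
  by apply: eq_bigr => i _; rewrite NE scalerAl.
(* With equal multiplicities the limit gives the sign at [s] itself, also where the pencil is
   singular. *)
have := halfplane_limit (fun t => quad_num_ge0 v (s := t)) s_gt0 (oner_neq0 _)
  (leqnn a) quadE DE.
rewrite subnn expr0 mul1r mulrC => pos.
rewrite -cabsE -exprVn -fmorphV -rmorphXn /= ReM /= mul0r subr0.
by rewrite mulr_ge0 // exprn_ge0 // invr_ge0 cabs_ge0.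
Qed.

End KYPImpliesPositiveReal.

(** * Exponential curves *)

Section ExponentialSeries.
Context (R : realType).
Implicit Types s : nat -> R.

Definition exp_growth s : Prop :=
  exists c rho : R, 0 <= rho /\ forall k, `|s k| <= c * rho ^+ k.

(** The exponential generating function, whose derivative is that of the shifted sequence;
    [s k = M F^k c0] gives [M e^(t F) c0]. *)
Definition egf s (t : R) : R := limn (pseries (fun k => s k / k`!%:R) t).

Lemma egf_cvg s t : exp_growth s -> cvgn (pseries (fun k => s k / k`!%:R) t).
Proof.
move=> [c [rho [rho0 sP]]]; apply: normed_cvg.
have c0 : 0 <= c by have := sP 0%N; rewrite expr0 mulr1; exact: le_trans.
apply: (@series_le_cvg _ _ (fun k => c * exp_coeff (rho * `|t|) k)).
- by move=> k /=; exact: normr_ge0.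
- by move=> k; rewrite mulr_ge0 // exp_coeff_ge0 // mulr_ge0.
- move=> k; rewrite /exp_coeff /= !normrM normfV normrX (ger0_norm (ler0n R _)).
  rewrite exprMn !mulrA -[X in X <= _]mulrA [_^-1 * _]mulrC mulrA.
  by rewrite ler_wpM2r ?invr_ge0 // ler_wpM2r ?exprn_ge0.
rewrite (_ : [series _]_k = (fun n => c * series (exp_coeff (rho * `|t|)) n)).
  by apply: is_cvgMr; exact: is_cvg_series_exp_coeff.
by apply: funext => n; rewrite /series /= mulr_sumr.
Qed.

Lemma exp_growth_shift s : exp_growth s -> exp_growth (fun k => s k.+1).
Proof.
move=> [c [rho [rho0 sP]]]; exists (c * rho), rho; split=> // k.
by rewrite -mulrA -exprS.
Qed.

Lemma pseries_diffs_egf s :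
  pseries_diffs (fun k => s k / k`!%:R) = (fun k => s k.+1 / k`!%:R).
Proof.
apply: funext => k; rewrite /pseries_diffs factS natrM invfM.
by rewrite mulrCA mulVKf ?pnatr_eq0.
Qed.

Lemma is_derive_egf s (t : R) : exp_growth s ->
  is_derive t 1 (egf s) (egf (fun k => s k.+1) t).
Proof.
move=> gs; have gs1 := exp_growth_shift gs; have gs2 := exp_growth_shift gs1.
rewrite /egf -pseries_diffs_egf; apply: (@pseries_snd_diffs _ _ (`|t| + 1)).
- exact: egf_cvg.
- by rewrite pseries_diffs_egf; exact: egf_cvg.
- by rewrite !pseries_diffs_egf; exact: egf_cvg.
- by rewrite [ltRHS]ger0_norm ?addr_ge0 // ltrDl.
Qed.

Lemma derive1n_egf s j : exp_growth s ->
  derive1n j (egf s) = egf (fun k => s (k + j)%N).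
Proof.
elim: j s => [|j IH] s gs.
  by rewrite derive1n0; congr egf; apply: funext => k; rewrite addn0.
rewrite derive1Sn (_ : (egf s)^`()%classic = egf (fun k => s k.+1)).
  rewrite IH; first by congr egf; apply: funext => k; rewrite addnS.
  exact: exp_growth_shift.
by apply: funext => t; have D := is_derive_egf t gs; rewrite derive1E derive_val.
Qed.

Lemma exp_growth_shiftn s j : exp_growth s -> exp_growth (fun k => s (k + j)%N).
Proof.
elim: j s => [|j IH] s gs.
  by rewrite (_ : (fun k => _) = s) //; apply: funext => k; rewrite addn0.
rewrite (_ : (fun k => _) = fun k => (fun k => s k.+1) (k + j)%N).
  exact: (IH (fun k => s k.+1) (exp_growth_shift gs)).
by apply: funext => k; rewrite addnS.
Qed.

Lemma smooth_egf s : exp_growth s -> smooth (egf s).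
Proof.
move=> gs j t; rewrite derive1n_egf //.
by have [] := is_derive_egf t (exp_growth_shiftn j gs).
Qed.

Lemma egf0 s : egf s 0 = s 0%N.
Proof.
rewrite /egf; apply: cvg_lim => //; rewrite -cvg_shiftS.
rewrite (_ : [sequence _]_n = cst (s 0%N)); first exact: cvg_cst.
apply: funext => n; rewrite /pseries /series /= big_nat_recl // expr0 mulr1 fact0 divr1.
by rewrite big1_seq ?addr0 // => i _; rewrite exprS mul0r mulr0.
Qed.

Lemma egfD s1 s2 t : exp_growth s1 -> exp_growth s2 ->
  egf (fun k => s1 k + s2 k) t = egf s1 t + egf s2 t.
Proof.
move=> g1 g2; rewrite /egf -limD; [|exact: egf_cvg..].
congr (limn _); apply: funext => n; rewrite fctE /pseries /series /= -big_split /=.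
by apply: eq_bigr => i _; rewrite !mulrDl.
Qed.

Lemma egfZ a s t : exp_growth s -> egf (fun k => a * s k) t = a * egf s t.
Proof.
move=> gs; rewrite /egf; apply: cvg_lim => //.
rewrite (_ : pseries _ _ = (fun n => a * pseries (fun k => s k / k`!%:R) t n)).
  by apply: cvgM; [exact: cvg_cst | exact: egf_cvg].
apply: funext => n; rewrite /pseries /series /= mulr_sumr.
by apply: eq_bigr => i _; rewrite !mulrA.
Qed.

Lemma egf_zero t : egf (fun=> 0) t = 0.
Proof.
rewrite /egf (_ : pseries _ _ = cst 0) ?lim_cst //.
by apply: funext => n; rewrite /pseries /series /= big1 // => i _; rewrite !mul0r.
Qed.

End ExponentialSeries.

Section ScalarParts.
Context (R : realType) (k : scalar_kind).
Local Notation K := (base_field R k).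

Definition mkK (a b : R) : K :=
  match k return base_field R k with
  | RealScalars => a
  | ComplexScalars => (a +i* b)%C
  end.

Lemma reK_mkK a b : reK (mkK a b) = a.
Proof. by rewrite /mkK; case: k. Qed.

Lemma K_ext (z w : K) : reK z = reK w -> imK z = imK w -> z = w.
Proof.
move=> re im; apply: (fmorph_inj (@toC R k)).
exact: complex_ext.
Qed.

Lemma imKD (z w : K) : imK (z + w) = imK z + imK w.
Proof. by rewrite /imK rmorphD ImD. Qed.

Lemma reKM (z w : K) : reK (z * w) = reK z * reK w - imK z * imK w.
Proof. by rewrite /reK rmorphM ReM. Qed.

Lemma imKM (z w : K) : imK (z * w) = reK z * imK w + imK z * reK w.
Proof. by rewrite /imK rmorphM ImM. Qed.

Lemma reK0 : reK (0 : K) = 0.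
Proof. by rewrite /reK rmorph0. Qed.

Lemma imK0 : imK (0 : K) = 0.
Proof. by rewrite /imK rmorph0. Qed.

Lemma reK_le (z : K) : `|reK z| <= cabs (toC z).
Proof. exact: Re_cabs. Qed.

Lemma imK_le (z : K) : `|imK z| <= cabs (toC z).
Proof.
have -> : imK z = complex.Re (- 'i%C * toC z).
  by rewrite /imK; case: (toC z) => a b /=; ring.
apply: le_trans (Re_cabs _) _; rewrite cabsM cabsN.
suff -> : cabs ('i%C : R[i]%C) = 1 by rewrite mul1r.
by rewrite /cabs normc_def /= expr0n expr1n add0r sqrtr1.
Qed.

(** The ratio [rho] is fixed so that the bound is stable under linear combinations. *)
Definition kgrowth (rho : R) (z : nat -> K) : Prop :=
  exists c : R, forall i, cabs (toC (z i)) <= c * rho ^+ i.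

Context (rho : R) (rho_ge0 : 0 <= rho).

Lemma kgrowth_re z : kgrowth rho z -> exp_growth (fun i => reK (z i)).
Proof.
move=> [c zP]; exists c, rho; split=> // i; exact: le_trans (reK_le _) (zP i).
Qed.

Lemma kgrowth_im z : kgrowth rho z -> exp_growth (fun i => imK (z i)).
Proof.
move=> [c zP]; exists c, rho; split=> // i; exact: le_trans (imK_le _) (zP i).
Qed.

Lemma kgrowthD z w : kgrowth rho z -> kgrowth rho w -> kgrowth rho (fun i => z i + w i).
Proof.
move=> [c zP] [d wP]; exists (c + d) => i; rewrite rmorphD mulrDl.
by apply: le_trans (cabsD _ _) _; exact: lerD (zP i) (wP i).
Qed.

Lemma kgrowthZ a z : kgrowth rho z -> kgrowth rho (fun i => a * z i).
Proof.
move=> [c zP]; exists (cabs (toC a) * c) => i.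
by rewrite rmorphM cabsM -mulrA; apply: ler_wpM2l; [exact: cabs_ge0 | exact: zP].
Qed.

Lemma exp_growthZ a (s : nat -> R) : exp_growth s -> exp_growth (fun i => a * s i).
Proof.
move=> [c [r [r0 sP]]]; exists (`|a| * c), r; split=> // i.
by rewrite normrM -mulrA; apply: ler_wpM2l; [exact: normr_ge0 | exact: sP].
Qed.

Definition kegf (z : nat -> K) (t : R) : K :=
  mkK (egf (fun i => reK (z i)) t) (egf (fun i => imK (z i)) t).

Lemma reK_kegf z t : reK (kegf z t) = egf (fun i => reK (z i)) t.
Proof. exact: reK_mkK. Qed.

Lemma imK_kegf z t : imK (kegf z t) = egf (fun i => imK (z i)) t.
Proof.
rewrite /kegf /mkK; case: k z => z //=.
by rewrite /imK /= egf_zero.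
Qed.

Lemma kegfD z w t : kgrowth rho z -> kgrowth rho w ->
  kegf (fun i => z i + w i) t = kegf z t + kegf w t.
Proof.
move=> gz gw; apply: K_ext.
  rewrite reKD !reK_kegf -egfD; [|exact: kgrowth_re..].
  by congr egf; apply: funext => i; rewrite reKD.
rewrite imKD !imK_kegf -egfD; [|exact: kgrowth_im..].
by congr egf; apply: funext => i; rewrite imKD.
Qed.

Lemma kegfZ a z t : kgrowth rho z -> kegf (fun i => a * z i) t = a * kegf z t.
Proof.
move=> gz; have gr := kgrowth_re gz; have gi := kgrowth_im gz; apply: K_ext.
  rewrite reKM !reK_kegf imK_kegf -!egfZ // -mulN1r -egfZ; last exact: exp_growthZ.
  rewrite -egfD; [|by do ?apply: exp_growthZ..].
  by congr egf; apply: funext => i; rewrite reKM mulN1r.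
rewrite imKM !imK_kegf reK_kegf -!egfZ // -egfD; [|exact: exp_growthZ..].
by congr egf; apply: funext => i; rewrite imKM.
Qed.

Lemma kegf_zero t : kegf (fun=> 0) t = 0.
Proof.
apply: K_ext; first by rewrite reK_kegf !reK0; exact: egf_zero.
by rewrite imK_kegf !imK0; exact: egf_zero.
Qed.

Lemma kgrowth_lincomb (I : Type) (r : seq I) (a : I -> K) (z : I -> nat -> K) :
  (forall j, kgrowth rho (z j)) -> kgrowth rho (fun i => \sum_(j <- r) a j * z j i).
Proof.
move=> gz; elim: r => [|j r IH].
  by exists 0 => i; rewrite big_nil rmorph0 cabs0 mul0r.
have [c cP] := kgrowthD (kgrowthZ (a j) (gz j)) IH.
by exists c => i; rewrite big_cons; exact: cP.
Qed.

Lemma kegf_lincomb (I : Type) (r : seq I) (a : I -> K) (z : I -> nat -> K) t :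
  (forall j, kgrowth rho (z j)) ->
  kegf (fun i => \sum_(j <- r) a j * z j i) t = \sum_(j <- r) a j * kegf (z j) t.
Proof.
move=> gz; elim: r => [|j r IH].
  rewrite big_nil -[RHS](kegf_zero t); congr kegf.
  by apply: funext => i; rewrite big_nil.
rewrite big_cons -IH -kegfZ // -kegfD; [|exact: kgrowthZ|exact: kgrowth_lincomb].
by congr kegf; apply: funext => i; rewrite big_cons.
Qed.

End ScalarParts.

Section ExponentialCurves.
Context (R : realType) (k : scalar_kind) (d : nat).
Local Notation K := (base_field R k).
Context (F : 'M[K]_d) (c0 : 'cV[K]_d).

Let nu : R := \sum_i \sum_j cabs (toC (F i j)).

Definition state_coef (l : nat) : 'cV[K]_d := iter l (mulmx F) c0.

(** The curve [M e^(t F) c0]. *)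
Definition ecurve p (M : 'M[K]_(p, d)) (t : R) : 'cV[K]_p :=
  \col_i kegf (fun l => (M *m state_coef l) i ord0) t.

Lemma nu_ge0 : 0 <= nu.
Proof. by do 2![apply: sumr_ge0 => ? _]; exact: cabs_ge0. Qed.

Lemma state_coef_growth j : kgrowth nu (fun l => state_coef l j ord0).
Proof.
pose b := \sum_j cabs (toC (c0 j ord0)); exists b => l.
have b0 : 0 <= b by apply: sumr_ge0 => ? _; exact: cabs_ge0.
elim: l j => [|l IH] j.
  rewrite expr0 mulr1 /b (bigD1 j) //= lerDl.
  by apply: sumr_ge0 => ? _; exact: cabs_ge0.
rewrite /= mxE rmorph_sum; apply: le_trans (cabs_sum _ _ _) _.
apply: le_trans (_ : \sum_i cabs (toC (F j i)) * (b * nu ^+ l) <= _).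
  apply: ler_sum => i _; rewrite rmorphM cabsM.
  by apply: ler_wpM2l; [exact: cabs_ge0 | exact: IH].
rewrite -mulr_suml exprS mulrCA; apply: ler_wpM2l => //.
apply: ler_wpM2r; first by rewrite exprn_ge0 // nu_ge0.
rewrite /nu [X in _ <= X](bigD1 j) //= lerDl.
by do 2![apply: sumr_ge0 => ? _]; exact: cabs_ge0.
Qed.

Lemma output_growth p (M : 'M[K]_(p, d)) i :
  kgrowth nu (fun l => (M *m state_coef l) i ord0).
Proof.
have [c cP] := kgrowth_lincomb (index_enum 'I_d) (M i) state_coef_growth.
by exists c => l; rewrite mxE; exact: cP.
Qed.

Lemma ecurveM p q (N : 'M[K]_(q, p)) (M : 'M[K]_(p, d)) t :
  ecurve (N *m M) t = N *m ecurve M t.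
Proof.
apply/colP => i; rewrite !mxE.
transitivity (kegf (fun l => \sum_j N i j * (M *m state_coef l) j ord0) t).
  by congr kegf; apply: funext => l; rewrite -mulmxA mxE.
rewrite (kegf_lincomb nu_ge0); last by move=> j; exact: output_growth.
by apply: eq_bigr => j _; rewrite mxE.
Qed.

Lemma ecurveD p (M N : 'M[K]_(p, d)) t : ecurve (M + N) t = ecurve M t + ecurve N t.
Proof.
apply/colP => i; rewrite !mxE -(kegfD nu_ge0); [|exact: output_growth..].
by congr kegf; apply: funext => l; rewrite mulmxDl mxE.
Qed.

Lemma ecurve0 p (M : 'M[K]_(p, d)) : ecurve M 0 = M *m c0.
Proof.
apply/colP => i; rewrite mxE; apply: K_ext.
  by rewrite reK_kegf egf0.
by rewrite imK_kegf egf0.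
Qed.

Lemma ecurve_smooth p (M : 'M[K]_(p, d)) : coordwise (@smooth R) (ecurve M).
Proof.
move=> i; split.
  rewrite (_ : (fun t => _) = egf (fun l => reK ((M *m state_coef l) i ord0))).
    by apply: smooth_egf; apply: (kgrowth_re nu_ge0); exact: output_growth.
  by apply: funext => t; rewrite mxE reK_kegf.
rewrite (_ : (fun t => _) = egf (fun l => imK ((M *m state_coef l) i ord0))).
  by apply: smooth_egf; apply: (kgrowth_im nu_ge0); exact: output_growth.
by apply: funext => t; rewrite mxE imK_kegf.
Qed.

Lemma ecurve_derive p (M : 'M[K]_(p, d)) t :
  is_vderive (ecurve M) t (ecurve (M *m F) t).
Proof.
move=> i; have shiftE l : (M *m F *m state_coef l) i ord0 = (M *m state_coef l.+1) i ord0.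
  by rewrite -mulmxA.
split.
  rewrite (_ : (fun t => _) = egf (fun l => reK ((M *m state_coef l) i ord0))).
    have -> : reK (ecurve (M *m F) t i ord0) =
        egf (fun l => reK ((M *m state_coef l.+1) i ord0)) t.
      by rewrite mxE reK_kegf; congr egf; apply: funext => l; rewrite shiftE.
    exact: (is_derive_egf t (kgrowth_re nu_ge0 (output_growth M i))).
  by apply: funext => s; rewrite mxE reK_kegf.
rewrite (_ : (fun t => _) = egf (fun l => imK ((M *m state_coef l) i ord0))).
  have -> : imK (ecurve (M *m F) t i ord0) =
      egf (fun l => imK ((M *m state_coef l.+1) i ord0)) t.
    by rewrite mxE imK_kegf; congr egf; apply: funext => l; rewrite shiftE.
  exact: (is_derive_egf t (kgrowth_im nu_ge0 (output_growth M i))).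
by apply: funext => s; rewrite mxE imK_kegf.
Qed.

Lemma ecurve_solution n m (S : descriptor_system R k n m)
    (X : 'M[K]_(n, d)) (U : 'M[K]_(m, d)) :
  sysA S *m X + sysB S *m U = sysE S *m X *m F ->
  smooth_solution S (X *m c0) (ecurve X) (ecurve U) (ecurve (sysC S *m X + sysD S *m U)).
Proof.
move=> data; split; rewrite ?ecurve0 //; try exact: ecurve_smooth.
move=> t; split; last by rewrite ecurveD !ecurveM.
rewrite -!ecurveM -ecurveD data (_ : (fun s => _) = ecurve (sysE S *m X)).
  exact: ecurve_derive.
by apply: funext => s; rewrite ecurveM.
Qed.

End ExponentialCurves.

(** * The system space and passivity *)

Section RealAnalysis.
Context (R : realType).
Local Notation mu := (@lebesgue_measure R).
Implicit Types f g h : R -> R.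

Lemma derivable_continuous f : (forall t : R, derivable f t 1) -> continuous f.
Proof. by move=> df t; apply: differentiable_continuous; exact/derivable1_diffP. Qed.

Lemma continuous_integrable_itv f (a b : R) : continuous f ->
  mu.-integrable `[a, b] (EFin \o f).
Proof.
move=> cf; apply: continuous_compact_integrable; first exact: segment_compact.
exact: continuous_subspaceT.
Qed.

Lemma continuous_L2loc f : continuous f -> L2loc f.
Proof.
move=> cf; have cf2 : continuous (fun t => f t ^+ 2).
  move=> t; rewrite (_ : (fun s => _) = (fun s => f s * f s)); first by apply: cvgM; exact: cf.
  by apply: funext => s; rewrite expr2.
split; first exact: measurable_realfun.continuous_measurable_fun.
split; [exact: measurable_realfun.continuous_measurable_fun | exact: openT | move=> K _ cK].
have /integrableP [_] : mu.-integrable K (EFin \o (fun t => f t ^+ 2)).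
  by apply: continuous_compact_integrable => //; exact: continuous_subspaceT.
by [].
Qed.

Lemma C1_abs_cont f h : (forall t : R, is_derive t 1 f (h t)) -> continuous h -> abs_cont f.
Proof.
move=> fh ch a b e e0.
have cf : continuous f by apply: derivable_continuous => t; case: (fh t).
have [ab|ba] := leP a b; last first.
  exists 1 => // N l r lr _ _; case: N l r lr => [|N] l r lr; first by rewrite big_ord0.
  by have [al lr0 rb] := lr ord0; have := le_lt_trans (le_trans al (le_trans lr0 rb)) ba;
    rewrite ltxx.
have cah : {within `[a, b], continuous (fun t => `|h t|)}.
  apply: continuous_subspaceT => t; apply: continuous_comp; first exact: ch.
  exact: norm_continuous.
have [c _ cP] := EVT_max ab cah.
set M := `|h c|; have M1 : 0 < M + 1 by rewrite ltr_wpDl ?normr_ge0.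
exists (e / (M + 1)); first by rewrite divr_gt0.
move=> N l r lr _ sum_lt; apply: le_lt_trans (_ : \sum_i (M + 1) * (r i - l i) < e).
  apply: ler_sum => i _; have [al lri rb] := lr i.
  have [|c' c'in ->] := @MVT_segment R f h (l i) (r i) lri (fun t _ => fh t).
    exact: continuous_subspaceT.
  rewrite normrM [`|r i - _|]ger0_norm ?subr_ge0 // ler_wpM2r ?subr_ge0 //.
  apply: le_trans (_ : M <= _); last by rewrite lerDl.
  apply: cP; move: c'in; rewrite !in_itv /= => /andP [lc cr].
  by rewrite (le_trans al lc) (le_trans cr rb).
by rewrite -mulr_sumr mulrC -ltr_pdivlMr.
Qed.

Lemma abs_cont_continuous f : abs_cont f -> continuous f.
Proof.
move=> acf t; apply/cvgrPdist_lt => e e0.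
have [dl dl0 dlP] := acf (t - 1) (t + 1) e e0.
have step (x y : R) : t - 1 <= x -> x <= y -> y <= t + 1 -> y - x < dl -> `|f y - f x| < e.
  move=> tx xy yt yx; have := dlP 1%N (fun=> x) (fun=> y).
  rewrite !big_ord1; apply; last exact: yx; first by move=> i; split.
  by move=> i j _ _ _; rewrite (ord1 i) (ord1 j).
exists (Num.min dl 1) => /=; first by rewrite lt_min dl0 ltr01.
move=> s /=; rewrite lt_min => /andP [sd s1].
have [ts|st] := leP t s.
  rewrite distrC; apply: step => //; move: sd s1; rewrite ?gerBl //.
  - by rewrite distrC ger0_norm ?subr_ge0 // => _ /ltW; lra.
  - by rewrite distrC ger0_norm ?subr_ge0.
move: sd s1; rewrite gtr0_norm ?subr_gt0 // => sd s1.
by apply: step => //; lra.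
Qed.

Lemma ae_ball (P : R -> Prop) (t r : R) : {ae mu, forall s, P s} -> 0 < r ->
  exists2 s, ball t r s & P s.
Proof.
move=> [N [mN N0 PN]] r0; apply: contrapT => noP.
have bN : ball t r `<=` N.
  by move=> s bs; apply: PN => /= Ps; apply: noP; exists s.
have : (mu (ball t r) <= 0)%E.
  rewrite -[leRHS]N0; apply: le_measure; rewrite ?inE //.
  exact: measurable_realfun.measurable_ball.
rewrite [mu _](lebesgue_measure_ball t (ltW r0)) lee_fin leNgt.
by rewrite mulrn_wgt0.
Qed.

Lemma ae_continuous_eq0 f : continuous f -> {ae mu, forall t, f t = 0} ->
  forall t, f t = 0.
Proof.
move=> cf ae0 t; apply: contrapT => /eqP ft.
have /cvgrPdist_lt /(_ `|f t|) := cf t; rewrite normr_gt0 => /(_ ft).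
move=> /nbhs_ballP [r /= r0 br]; have [s bs fs] := ae_ball t ae0 r0.
by have := br _ bs; rewrite /= fs subr0 ltxx.
Qed.

Lemma Rintegral_derive f h (a b : R) : a <= b -> (forall t : R, is_derive t 1 f (h t)) ->
  continuous h -> \int[mu]_(t in `[a, b]) h t = f b - f a.
Proof.
rewrite le_eqVlt => /predU1P [<- _ _|ab fh ch].
  by rewrite set_itv1 Rintegral_set1 subrr.
have cf : continuous f by apply: derivable_continuous => t; case: (fh t).
rewrite /Rintegral (@continuous_FTC2 _ h f) //.
- exact: continuous_subspaceT.
- split; first by move=> t _; case: (fh t).
  + exact: cvg_at_right_filter (cf a).
  + exact: cvg_at_left_filter (cf b).
- by move=> t _; rewrite derive1E; have D := fh t; rewrite derive_val.
Qed.

Lemma integral_le_of_derive_le f h g (T : R) : 0 <= T ->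
  (forall t : R, is_derive t 1 f (h t)) -> continuous h -> continuous g ->
  (forall t, h t <= g t) -> f T - f 0 <= \int[mu]_(t in `[0, T]) g t.
Proof.
move=> T0 fh ch cg hg; rewrite -(Rintegral_derive T0 fh ch).
by apply: le_Rintegral => //; exact: continuous_integrable_itv.
Qed.

(** If [h 0 > g 0], then [h - g] exceeds half of that gap on a short interval, which contradicts the
    integral inequality there. *)
Lemma derive_le_of_integral_le f h g :
  (forall t : R, is_derive t 1 f (h t)) -> continuous h -> continuous g ->
  (forall T, 0 <= T -> f T - f 0 <= \int[mu]_(t in `[0, T]) g t) -> h 0 <= g 0.
Proof.
move=> fh ch cg fg; rewrite leNgt; apply/negP => gh.
pose e := (h 0 - g 0) / 2; have e0 : 0 < e by rewrite divr_gt0 // subr_gt0.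
have chg : continuous (fun t => h t - g t).
  by move=> t; apply: continuousB; [exact: ch | exact: cg].
have /cvgrPdist_lt /(_ e e0) := chg 0; move=> /nbhs_ballP [r /= r0 br].
pose T := r / 2; have T0 : 0 < T by rewrite divr_gt0.
have hgT t : `[0, T]%classic t -> e <= h t - g t.
  rewrite /= in_itv /= => /andP [t0 tT].
  have /br : ball 0 r t.
    by rewrite /ball /= sub0r normrN ger0_norm //; rewrite /T in tT; lra.
  by rewrite /= ltr_norml => /andP [_]; rewrite /e; lra.
have := fg T (ltW T0); rewrite -(Rintegral_derive (ltW T0) fh ch) -subr_le0.
rewrite -RintegralB //; [|exact: continuous_integrable_itv..].
apply/negP; rewrite -ltNge; apply: lt_le_trans (_ : \int[mu]_(t in `[0, T]) e <= _).
  have muT : mu `[0, T]%classic = T%:E.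
    have := @lebesgue_measure_itv R `[0, T]%R.
    by rewrite /= lte_fin T0 oppr0 adde0.
  rewrite Rintegral_cst // (_ : fine _ = T); first by rewrite mulr_gt0.
  exact: (congr1 (@fine R) muT).
apply: le_Rintegral => //.
- by apply: continuous_integrable_itv => t; exact: cvg_cst.
- exact: continuous_integrable_itv.
Qed.

End RealAnalysis.

Section VectorCalculus.
Context (R : realType) (k : scalar_kind).
Local Notation K := (base_field R k).
Local Notation mu := (@lebesgue_measure R).

Definition vcont p (f : R -> 'cV[K]_p) : Prop :=
  coordwise (fun g : R -> R => continuous g) f.

Lemma sum_continuous (I : Type) (r : seq I) (g : I -> R -> R) :
  (forall i, continuous (g i)) -> continuous (fun t => \sum_(i <- r) g i t).
Proof.
move=> cg; elim: r => [|i r IH] t.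
  by under eq_fun do rewrite big_nil; exact: cvg_cst.
by under eq_fun do rewrite big_cons; apply: cvgD; [exact: cg | exact: IH].
Qed.

Lemma reK_sum (I : Type) (r : seq I) (F : I -> K) :
  reK (\sum_(i <- r) F i) = \sum_(i <- r) reK (F i).
Proof. by apply: (big_morph _ (@reKD R k) (@reK0 R k)). Qed.

Lemma imK_sum (I : Type) (r : seq I) (F : I -> K) :
  imK (\sum_(i <- r) F i) = \sum_(i <- r) imK (F i).
Proof. by apply: (big_morph _ (@imKD R k) (@imK0 R k)). Qed.

Lemma vcont_mulmx p q (M : 'M[K]_(q, p)) f : vcont f -> vcont (fun t => M *m f t).
Proof.
move=> cf i; split.
  rewrite (_ : (fun t => _) = fun t => \sum_j (reK (M i j) * reK (f t j ord0) -
     imK (M i j) * imK (f t j ord0))).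
    apply: sum_continuous => j t; have [cr ci] := cf j.
    by apply: cvgB; apply: cvgM; [exact: cvg_cst|exact: cr|exact: cvg_cst|exact: ci].
  by apply: funext => t; rewrite mxE reK_sum; apply: eq_bigr => j _; rewrite reKM.
rewrite (_ : (fun t => _) = fun t => \sum_j (reK (M i j) * imK (f t j ord0) +
     imK (M i j) * reK (f t j ord0))).
  apply: sum_continuous => j t; have [cr ci] := cf j.
  by apply: cvgD; apply: cvgM; [exact: cvg_cst|exact: ci|exact: cvg_cst|exact: cr].
by apply: funext => t; rewrite mxE imK_sum; apply: eq_bigr => j _; rewrite imKM.
Qed.

Lemma vcontD p (f g : R -> 'cV[K]_p) : vcont f -> vcont g -> vcont (fun t => f t + g t).
Proof.
move=> cf cg i; have [fr fi] := cf i; have [gr gi] := cg i; split.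
  rewrite (_ : (fun t => _) = fun t => reK (f t i ord0) + reK (g t i ord0)).
    by move=> t; apply: cvgD; [exact: fr | exact: gr].
  by apply: funext => t; rewrite mxE reKD.
rewrite (_ : (fun t => _) = fun t => imK (f t i ord0) + imK (g t i ord0)).
  by move=> t; apply: cvgD; [exact: fi | exact: gi].
by apply: funext => t; rewrite mxE imKD.
Qed.

Lemma vcont_col_mx p q (f : R -> 'cV[K]_p) (g : R -> 'cV[K]_q) :
  vcont f -> vcont g -> vcont (fun t => col_mx (f t) (g t)).
Proof.
move=> cf cg i; case: (split_ordP i) => j ->.
  have [fr fi] := cf j; split.
    rewrite (_ : (fun t => _) = fun t => reK (f t j ord0)) //.
    by apply: funext => t; rewrite col_mxEu.
  rewrite (_ : (fun t => _) = fun t => imK (f t j ord0)) //.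
  by apply: funext => t; rewrite col_mxEu.
have [gr gi] := cg j; split.
  rewrite (_ : (fun t => _) = fun t => reK (g t j ord0)) //.
  by apply: funext => t; rewrite col_mxEd.
rewrite (_ : (fun t => _) = fun t => imK (g t j ord0)) //.
by apply: funext => t; rewrite col_mxEd.
Qed.

Lemma coordwise_impl p (P Q : (R -> R) -> Prop) (f : R -> 'cV[K]_p) :
  (forall g, P g -> Q g) -> coordwise P f -> coordwise Q f.
Proof. by move=> PQ Pf i; have [? ?] := Pf i; split; exact: PQ. Qed.

Lemma smooth_vcont p (f : R -> 'cV[K]_p) : coordwise (@smooth R) f -> vcont f.
Proof.
apply: coordwise_impl => g sg; apply: derivable_continuous => t.
exact: (sg 0%N t).
Qed.

Lemma is_derive_sum_cst (I : Type) (r : seq I) (a : I -> R) (g : I -> R -> R)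
    (dg : I -> R) (t : R) :
  (forall i, is_derive t 1 (g i) (dg i)) ->
  is_derive t 1 (fun s => \sum_(i <- r) a i * g i s) (\sum_(i <- r) a i * dg i).
Proof.
move=> dgP; elim: r => [|i r IH].
  rewrite big_nil (_ : (fun s => _) = cst 0); first exact: is_derive_cst.
  by apply: funext => s; rewrite big_nil.
rewrite big_cons (_ : (fun s => _) = (a i \*: g i) \+ (fun s => \sum_(i <- r) a i * g i s)).
  by apply: is_deriveD; exact: is_deriveZ.
by apply: funext => s; rewrite big_cons.
Qed.

Lemma is_vderive_mulmx p q (M : 'M[K]_(q, p)) f t v :
  is_vderive f t v -> is_vderive (fun s => M *m f s) t (M *m v).
Proof.
move=> df i; split.
  rewrite (_ : (fun s => _) = (fun s => \sum_j reK (M i j) * reK (f s j ord0)) -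
     (fun s => \sum_j imK (M i j) * imK (f s j ord0))).
    rewrite mxE reK_sum (_ : \sum_j _ = \sum_j reK (M i j) * reK (v j ord0) -
       \sum_j imK (M i j) * imK (v j ord0)); last first.
      by rewrite -sumrB; apply: eq_bigr => j _; rewrite reKM.
    by apply: is_deriveB; apply: is_derive_sum_cst => j; have [] := df j.
  apply: funext => s; rewrite mxE reK_sum !fctE -sumrB; apply: eq_bigr => j _.
  by rewrite reKM.
rewrite (_ : (fun s => _) = (fun s => \sum_j reK (M i j) * imK (f s j ord0)) +
     (fun s => \sum_j imK (M i j) * reK (f s j ord0))).
  rewrite mxE imK_sum (_ : \sum_j _ = \sum_j reK (M i j) * imK (v j ord0) +
       \sum_j imK (M i j) * reK (v j ord0)); last first.
    by rewrite -big_split; apply: eq_bigr => j _; rewrite imKM.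
  by apply: is_deriveD; apply: is_derive_sum_cst => j; have [] := df j.
apply: funext => s; rewrite mxE imK_sum !fctE -big_split; apply: eq_bigr => j _.
by rewrite imKM.
Qed.

Lemma vcont_ae_eq0 p (f : R -> 'cV[K]_p) : vcont f ->
  {ae mu, forall t, f t = 0} -> forall t, f t = 0.
Proof.
move=> cf f0 t; have F := ae_filter_ringOfSetsType mu.
apply/colP => i; rewrite mxE; have [cr ci] := cf i; apply: K_ext; rewrite ?reK0 ?imK0.
  by apply: (ae_continuous_eq0 cr); apply: filterS f0 => s ->; rewrite mxE reK0.
by apply: (ae_continuous_eq0 ci); apply: filterS f0 => s ->; rewrite mxE imK0.
Qed.

Lemma is_vderive_zero p (f : R -> 'cV[K]_p) t v : (forall s, f s = 0) ->
  is_vderive f t v -> v = 0.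
Proof.
move=> f0 df; apply/colP => i; rewrite mxE; have [dr di] := df i.
apply: K_ext; rewrite ?reK0 ?imK0.
  have [_ <-] := dr; rewrite (_ : (fun s => _) = cst 0).
    exact: derive_cst.
  by apply: funext => s; rewrite f0 mxE reK0.
have [_ <-] := di; rewrite (_ : (fun s => _) = cst 0).
  exact: derive_cst.
by apply: funext => s; rewrite f0 mxE imK0.
Qed.

End VectorCalculus.

Section ImageFunctionals.
Context (K : fieldType).

Lemma image_annihilator p d (L : 'M[K]_(p, d)) : exists N : 'M[K]_p,
  N *m L = 0 /\ forall q (Z : 'M[K]_(p, q)), N *m Z = 0 -> exists F, Z = L *m F.
Proof.
exists (cokermx L^T)^T; split=> [|q Z NZ].
  by apply: trmx_inj; rewrite trmx_mul trmxK mulmx_coker trmx0.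
have /submxP [Y YZ] : (Z^T <= L^T)%MS.
  by rewrite submxE -[_ *m _]trmxK trmx_mul trmxK NZ trmx0.
by exists Y^T; rewrite -[Z]trmxK YZ trmx_mul trmxK.
Qed.

Lemma vspace_basis_mx p (V : {vspace 'cV[K]_p}) : exists d (M : 'M[K]_(p, d)),
  forall v, v \in V <-> exists c, v = M *m c.
Proof.
exists (\dim V), (\matrix_(i, j) ((vbasis V)`_j) i ord0) => v.
have ME (c : 'cV_(\dim V)) : \matrix_(i, j) ((vbasis V)`_j) i ord0 *m c =
    \sum_j c j ord0 *: (vbasis V)`_j.
  apply/colP => i; rewrite mxE summxE; apply: eq_bigr => j _.
  by rewrite !mxE mulrC.
split=> [vV|[c ->]].
  exists (\col_j coord (vbasis V) j v); rewrite ME {1}(coord_vbasis vV).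
  by apply: eq_bigr => j _; rewrite mxE.
rewrite ME; apply: memv_suml => j _; rewrite memvZ // vbasis_mem //.
by rewrite mem_nth // size_tuple.
Qed.

End ImageFunctionals.

Section SystemSpace.
Context (R : realType) (k : scalar_kind) (n m : nat)
  (S : descriptor_system R k n m).
Local Notation K := (base_field R k).
Local Notation mu := (@lebesgue_measure R).
Local Notation E := (sysE S).
Local Notation A := (sysA S).
Local Notation B := (sysB S).

Lemma smooth_solution_L2loc x0 x u y : smooth_solution S x0 x u y -> L2loc_solution S x u.
Proof.
move=> [sx su sy _ sol].
have cx := smooth_vcont sx; have cu := smooth_vcont su.
have cz : vcont (fun t => A *m x t + B *m u t) by apply: vcontD; exact: vcont_mulmx.
have L2 p (f : R -> 'cV[K]_p) : vcont f -> coordwise (@L2loc R) f.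
  by apply: coordwise_impl => g; exact: continuous_L2loc.
split; [exact: L2 | exact: L2 | |].
  move=> i; have [cr ci] := cz i.
  split; [apply: C1_abs_cont cr => t | apply: C1_abs_cont ci => t].
    by have [dE _] := sol t; have [] := dE i.
  by have [dE _] := sol t; have [] := dE i.
exists (fun t => A *m x t + B *m u t); split; first exact: L2.
  by apply: aeW => t; have [] := sol t.
by apply: aeW.
Qed.

(** Membership in [V] is the vanishing of a linear map, which along smooth solutions is continuous
    and zero almost everywhere, hence everywhere. *)
Lemma smooth_solution_mem (V : {vspace 'cV[K]_(n + m)}) x0 x u y :
  contains_solutions S V -> smooth_solution S x0 x u y ->
  forall t, col_mx (x t) (u t) \in V.
Proof.
move=> HV sol t; have [sx su _ _ _] := sol.
have [d [M MP]] := vspace_basis_mx V; have [N [NM NP]] := image_annihilator M.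
have cv := vcont_mulmx N (vcont_col_mx (smooth_vcont sx) (smooth_vcont su)).
have F := ae_filter_ringOfSetsType mu.
have ae0 : {ae mu, forall s, N *m col_mx (x s) (u s) = 0}.
  apply: filterS (HV _ _ (smooth_solution_L2loc sol)) => s /MP [c ->].
  by rewrite mulmxA NM mul0mx.
by apply/MP; apply: NP; exact: (vcont_ae_eq0 cv ae0).
Qed.

Lemma data_mem (V : {vspace 'cV[K]_(n + m)}) : contains_solutions S V ->
  forall d (X : 'M[K]_(n, d)) (U : 'M[K]_(m, d)) (F : 'M[K]_d),
  A *m X + B *m U = E *m X *m F -> forall c : 'cV_d, col_mx (X *m c) (U *m c) \in V.
Proof.
move=> HV d X U F data c.
have := smooth_solution_mem HV (ecurve_solution c data) 0.
by rewrite !ecurve0.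
Qed.

(** Minimality of [V] gives [V <= W] for the subspace [W] below, so the range of [A X0 + B U0] lies
    in that of [E X0]; this is where [F] comes from. *)
Lemma parametrizes_exists (V : {vspace 'cV[K]_(n + m)}) : is_system_space S V ->
  exists d (X0 : 'M[K]_(n, d)) (U0 : 'M[K]_(m, d)) (F : 'M[K]_d), parametrizes S V X0 U0 F.
Proof.
move=> [HV minV]; have [d [M MP]] := vspace_basis_mx V.
pose X0 : 'M[K]_(n, d) := usubmx M; pose U0 : 'M[K]_(m, d) := dsubmx M.
have ME c : M *m c = col_mx (X0 *m c) (U0 *m c) by rewrite -mul_col_mx vsubmxK.
have [N [NL NP]] := image_annihilator (E *m X0).
(* N E x vanishes along solutions, hence so does N (A x + B u). *)
pose W := (V :&: lker (linfun (mulmx (N *m row_mx A B))))%VS.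
have WP x u : col_mx x u \in W = (col_mx x u \in V) && (N *m (A *m x + B *m u) == 0).
  by rewrite memv_cap memv_ker lfunE /= -mulmxA mul_row_col.
have HW : contains_solutions S W.
  move=> x u sol; have [_ _ acE [z [_ dz zE]]] := sol.
  have F := ae_filter_ringOfSetsType mu.
  have cE : vcont (fun t => E *m x t).
    by apply: coordwise_impl acE => g; exact: abs_cont_continuous.
  have NE0 : forall t, N *m (E *m x t) = 0.
    apply: (vcont_ae_eq0 (vcont_mulmx N cE)).
    apply: filterS (HV _ _ sol) => t /MP [c]; rewrite ME => /eq_col_mx [-> _].
    by rewrite [E *m _]mulmxA mulmxA NL mul0mx.
  apply: (@filterS3 _ _ F _ _ _ _ _ (HV _ _ sol) dz zE) => t tV dt zt.
  rewrite WP tV /= -zt; apply/eqP.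
  exact: (is_vderive_zero NE0 (is_vderive_mulmx N dt)).
have /subvP VW := minV _ HW.
have NAB : N *m (A *m X0 + B *m U0) = 0.
  apply: mulmx_col_eq0 => c; rewrite -mulmxA mulmxDl -!mulmxA; apply/eqP.
  have : col_mx (X0 *m c) (U0 *m c) \in W by apply: VW; apply/MP; exists c; rewrite ME.
  by rewrite WP => /andP [].
have [F FE] := NP _ _ NAB; exists d, X0, U0, F; split=> //.
  by move=> c; apply/MP; exists c; rewrite ME.
by move=> x u /MP [c]; rewrite ME => /eq_col_mx [-> ->]; exists c.
Qed.

End SystemSpace.

Section ScalarCalculus.
Context (R : realType) (k : scalar_kind).
Local Notation K := (base_field R k).
Local Notation cj := (conjK_rmorphism R k).

Definition kcont (f : R -> K) : Prop :=
  continuous (fun t => reK (f t)) /\ continuous (fun t => imK (f t)).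

Definition kderive (f : R -> K) (t : R) (d : K) : Prop :=
  is_derive t 1 (fun s => reK (f s)) (reK d) /\
  is_derive t 1 (fun s => imK (f s)) (imK d).

Lemma imK_conj (z : K) : imK (cj z) = - imK z.
Proof. by rewrite /imK toC_conj Im_conj. Qed.

Lemma kcontM f g : kcont f -> kcont g -> kcont (fun t => f t * g t).
Proof.
move=> [fr fi] [gr gi]; split=> t.
  under eq_fun do rewrite reKM.
  by apply: cvgB; apply: cvgM; [exact: fr|exact: gr|exact: fi|exact: gi].
under eq_fun do rewrite imKM.
by apply: cvgD; apply: cvgM; [exact: fr|exact: gi|exact: fi|exact: gr].
Qed.

Lemma kcont_conj f : kcont f -> kcont (fun t => cj (f t)).
Proof.
move=> [fr fi]; split=> t.
  by under eq_fun do rewrite reK_conj; exact: fr.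
by under eq_fun do rewrite imK_conj; apply: cvgN; exact: fi.
Qed.

Lemma kcont_cst (a : K) : kcont (fun=> a).
Proof. by split=> t; exact: cvg_cst. Qed.

Lemma kcont_sum (I : Type) (r : seq I) (f : I -> R -> K) :
  (forall i, kcont (f i)) -> kcont (fun t => \sum_(i <- r) f i t).
Proof.
move=> cf; split.
  rewrite (_ : (fun t => _) = fun t => \sum_(i <- r) reK (f i t)).
    by apply: sum_continuous => i; have [] := cf i.
  by apply: funext => t; rewrite reK_sum.
rewrite (_ : (fun t => _) = fun t => \sum_(i <- r) imK (f i t)).
  by apply: sum_continuous => i; have [] := cf i.
by apply: funext => t; rewrite imK_sum.
Qed.

Lemma kcont_hform p (G : 'M[K]_p) f g : vcont f -> vcont g ->
  kcont (fun t => hform cj G (f t) (g t)).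
Proof.
move=> cf cg; rewrite (_ : (fun t => _) =
  fun t => \sum_j \sum_i cj (f t i ord0) * G i j * g t j ord0).
  apply: kcont_sum => j; apply: kcont_sum => i; apply: kcontM; last exact: cg.
  by apply: kcontM; [apply: kcont_conj; exact: cf | exact: kcont_cst].
by apply: funext => t; rewrite hformE.
Qed.

Lemma kderive_cst a t : kderive (fun=> a) t 0.
Proof. by split; rewrite ?reK0 ?imK0; exact: is_derive_cst. Qed.

Lemma kderiveD f g t a b : kderive f t a -> kderive g t b ->
  kderive (fun s => f s + g s) t (a + b).
Proof.
move=> [fr fi] [gr gi]; split.
  rewrite reKD (_ : (fun s => _) = (fun s => reK (f s)) + (fun s => reK (g s))).
    exact: is_deriveD.
  by apply: funext => s; rewrite reKD.
rewrite imKD (_ : (fun s => _) = (fun s => imK (f s)) + (fun s => imK (g s))).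
  exact: is_deriveD.
by apply: funext => s; rewrite imKD.
Qed.

Lemma kderiveM f g t a b : kderive f t a -> kderive g t b ->
  kderive (fun s => f s * g s) t (a * g t + f t * b).
Proof.
move=> [fr fi] [gr gi]; split.
  rewrite (_ : (fun s => _) = (fun s => reK (f s)) * (fun s => reK (g s)) -
     (fun s => imK (f s)) * (fun s => imK (g s))).
    apply: is_derive_eq.
    rewrite reKD !reKM /GRing.scale /=; ring.
  by apply: funext => s; rewrite reKM.
rewrite (_ : (fun s => _) = (fun s => reK (f s)) * (fun s => imK (g s)) +
   (fun s => imK (f s)) * (fun s => reK (g s))).
  apply: is_derive_eq.
  rewrite imKD !imKM /GRing.scale /=; ring.
by apply: funext => s; rewrite imKM.
Qed.

Lemma kderive_conj f t a : kderive f t a -> kderive (fun s => cj (f s)) t (cj a).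
Proof.
move=> [fr fi]; split.
  rewrite reK_conj (_ : (fun s => _) = (fun s => reK (f s))) //.
  by apply: funext => s; rewrite reK_conj.
rewrite imK_conj (_ : (fun s => _) = - (fun s => imK (f s))); first exact: is_deriveN.
by apply: funext => s; rewrite imK_conj.
Qed.

Lemma kderive_sum (I : Type) (r : seq I) (f : I -> R -> K) t (a : I -> K) :
  (forall i, kderive (f i) t (a i)) ->
  kderive (fun s => \sum_(i <- r) f i s) t (\sum_(i <- r) a i).
Proof.
move=> df; elim: r => [|i r IH].
  rewrite big_nil (_ : (fun s => _) = fun=> 0); first exact: kderive_cst.
  by apply: funext => s; rewrite big_nil.
rewrite big_cons (_ : (fun s => _) = fun s => f i s + \sum_(i <- r) f i s).
  exact: kderiveD.
by apply: funext => s; rewrite big_cons.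
Qed.

Lemma kderive_hform p (G : 'M[K]_p) f g t (v w : 'cV[K]_p) :
  is_vderive f t v -> is_vderive g t w ->
  kderive (fun s => hform cj G (f s) (g s)) t (hform cj G v (g t) + hform cj G (f t) w).
Proof.
move=> df dg; rewrite (_ : (fun s => _) =
  fun s => \sum_j \sum_i cj (f s i ord0) * G i j * g s j ord0); last first.
  by apply: funext => s; rewrite hformE.
rewrite !hformE -big_split /=; apply: kderive_sum => j.
rewrite -big_split /=; apply: kderive_sum => i.
have d1 : kderive (fun s => cj (f s i ord0) * G i j) t (cj (v i ord0) * G i j).
  have := kderiveM (kderive_conj (df i)) (kderive_cst (G i j) t).
  by rewrite mulr0 addr0.
exact: kderiveM d1 (dg j).
Qed.

End ScalarCalculus.

Section Passivity.
Context (R : realType) (k : scalar_kind) (n m : nat)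
  (S : descriptor_system R k n m) (V : {vspace 'cV[base_field R k]_(n + m)}).
Local Notation K := (base_field R k).
Local Notation cj := (conjK_rmorphism R k).
Hypothesis HV : contains_solutions S V.

Lemma reK_half (z : K) : reK (2^-1 * z) = 2^-1 * reK z.
Proof.
have half : toC (2^-1 : K) = ((2^-1)%:C)%C by rewrite !fmorphV !rmorph_nat.
by rewrite reKM /reK /imK half /= mul0r subr0.
Qed.

Lemma hform_outer (y u : 'cV[K]_m) : (adjmx y *m u) ord0 ord0 = hform cj 1%:M y u.
Proof. by rewrite /hform mulmx1. Qed.

Lemma reK_supply (y u : 'cV[K]_m) :
  reK ((adjmx y *m u) ord0 ord0) = reK ((adjmx u *m y) ord0 ord0).
Proof. by rewrite -reK_adj adjmxM adjmxK. Qed.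

(** [G] need not be Hermitian; the real part sees only its Hermitian part. *)
Lemma kderive_half_hform p (G : 'M[K]_p) f t v : is_vderive f t v ->
  is_derive t 1 (fun s => reK (2^-1 * hform cj G (f s) (f s)))
    (reK (hform cj (2^-1 *: (G + adjmx G)) (f t) v)).
Proof.
move=> df; have [D _] := kderive_hform G df df.
have -> : (fun s => reK (2^-1 * hform cj G (f s) (f s))) =
    (2^-1 : R) \*: (fun s => reK (hform cj G (f s) (f s))).
  by apply: funext => s; rewrite reK_half.
have -> : reK (hform cj (2^-1 *: (G + adjmx G)) (f t) v) =
    2^-1 *: reK (hform cj G v (f t) + hform cj G (f t) v).
  rewrite reKD -(reK_conj (hform _ _ v _)).
  have -> : conjK (hform cj G v (f t)) = hform cj (adjmx G) (f t) v.
    exact: (hform_conj (@conjK_rmorphismK R k)).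
  rewrite -reKD /GRing.scale /= -reK_half; congr reK.
  rewrite /hform -scalemxAr -scalemxAl [LHS]mxE mulmxDr mulmxDl [in LHS]mxE.
  by rewrite addrC.
exact: is_deriveZ.
Qed.

Lemma KYP_E_passive : KYP_E S V -> passive S.
Proof.
move=> [Y [YH [EH YP]]]; exists (Y *m sysE S) => T T0 x0 _ x u y sol.
have mem := smooth_solution_mem HV sol.
have [sx su sy _ dyn] := sol.
have storE t : storage S (Y *m sysE S) (x t) =
    toC (2^-1 * hform cj Y (sysE S *m x t) (sysE S *m x t)).
  congr (toC (2^-1 * _)).
  by rewrite /hform -adjmxE !adjmxM -YH !mulmxA.
have stor_ge0 t : 0 <= storage S (Y *m sysE S) (x t).
  have [_ +] := YP _ _ (mem t); rewrite storE toC_ge0 => h0.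
  rewrite mulr_ge0 ?invr_ge0 ?ler0n //; move: h0; congr (0 <= _).
  by rewrite /hform -adjmxE !adjmxM !mulmxA.
split; last exact: stor_ge0.
pose f t := reK (2^-1 * hform cj Y (sysE S *m x t) (sysE S *m x t)).
have fE t : storage S (Y *m sysE S) (x t) = ((f t)%:C)%C.
  by rewrite storE toC_ge0E // -toC_ge0 -storE.
rewrite !fE -rmorphB lecR.
pose v t := sysA S *m x t + sysB S *m u t.
have cv : vcont v.
  by apply: vcontD; apply: vcont_mulmx; exact: smooth_vcont.
have cE : vcont (fun t => sysE S *m x t) by apply: vcont_mulmx; exact: smooth_vcont.
have halfY : 2^-1 *: (Y + adjmx Y) = Y.
  by rewrite -YH -mulr2n -(scaler_nat 2 Y) scalerA mulVf ?scale1r // pnatr_eq0.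
apply: (@integral_le_of_derive_le _ f (fun t => reK (hform cj Y (sysE S *m x t) (v t)))) => //.
- move=> t; have [dE _] := dyn t.
  by have := kderive_half_hform Y dE; rewrite halfY.
- by have [] := kcont_hform Y cE cv.
- under eq_fun do rewrite hform_outer.
  by have [] := kcont_hform 1%:M (smooth_vcont sy) (smooth_vcont su).
move=> t; have [+ _] := YP _ _ (mem t); rewrite KYP_lhsE subr_le0 reK_supply.
have [_ ->] := dyn t; apply: le_trans.
by rewrite /hform -adjmxE !adjmxM -YH !mulmxA.
Qed.

Lemma passive_KYP_E d (X0 : 'M[K]_(n, d)) (U0 : 'M[K]_(m, d)) (F : 'M[K]_d) :
  parametrizes S V X0 U0 F -> passive S -> KYP_E S V.
Proof.
move=> VP [Q QP].
pose G0 := adjmx X0 *m adjmx Q *m sysE S *m X0.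
(* [Q] is arbitrary, so [G0] may fail to be Hermitian. Passivity at [T = 0] makes its values
   nonnegative, and its Hermitian part then has the same values. *)
pose G := 2^-1 *: (G0 + adjmx G0).
have sol c := ecurve_solution c (param_eq VP).
have storE c : storage S Q (X0 *m c) = toC (2^-1 * hform cj G0 c c).
  congr (toC (2^-1 * _)); by rewrite /hform -adjmxE /G0 !adjmxM !mulmxA.
have G0pos c : 0 <= hform cj G0 c c.
  have cons : consistent S (X0 *m c) by do 3!eexists; exact: sol c.
  have [_] := QP 0 (lexx 0) _ cons _ _ _ (sol c).
  rewrite ecurve0 storE toC_ge0 pmulr_rge0 // invr_gt0 ltr0n //.
have cj2 : cj 2^-1 = 2^-1 by rewrite fmorphV rmorph_nat.
have Gval c : hform cj G c c = hform cj G0 c c.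
  have -> : hform cj G c c = 2^-1 * (hform cj G0 c c + cj (hform cj G0 c c)).
    rewrite (hform_conj (@conjK_rmorphismK R k)) /G /hform -scalemxAr -scalemxAl.
    by rewrite [LHS]mxE mulmxDr mulmxDl [in LHS]mxE.
  by rewrite (cj_real (@conjK_rmorphism_norm R k)) //; field.
have Gpsd : hpsd cj G.
  split; last by move=> c; rewrite Gval.
  by rewrite hadjZ cj2 hadjD -!adjmxE adjmxK addrC.
apply: (KYP_E_of_form VP Gpsd) => c.
  move=> Ec0; rewrite Gval /hform /G0 -!mulmxA [sysE S *m _]mulmxA Ec0.
  by rewrite !mulmx0 mxE.
have [sx su sy _ _] := sol c.
pose cc := ecurve F c (1%:M : 'M[K]_d).
have xE t : ecurve F c X0 t = X0 *m cc t by rewrite -ecurveM mulmx1.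
have dcc t : is_vderive cc t (F *m cc t).
  by rewrite /cc -ecurveM mulmx1 -{3}(mul1mx F); exact: ecurve_derive.
have ccc : vcont cc by apply: smooth_vcont; exact: ecurve_smooth.
pose f t := reK (2^-1 * hform cj G0 (cc t) (cc t)).
pose h t := reK (hform cj G (cc t) (F *m cc t)).
(* The dissipation inequality along the exponential curve is differentiated at time 0, where the
   curve passes through the parameter [c]. *)
have := @derive_le_of_integral_le _ f h
  (fun t => reK ((adjmx (ecurve F c (sysC S *m X0 + sysD S *m U0) t) *m
     ecurve F c U0 t) ord0 ord0)).
have cc0 : cc 0 = c by rewrite /cc ecurve0 mul1mx.
rewrite /h cc0 !ecurve0 reK_supply => main; apply: le_trans (main _ _ _ _) _.
- by move=> t; exact: kderive_half_hform.
- by have [] := kcont_hform G ccc (vcont_mulmx F ccc).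
- under eq_fun do rewrite hform_outer.
  by have [] := kcont_hform 1%:M (smooth_vcont sy) (smooth_vcont su).
- move=> T T0; have cons : consistent S (X0 *m c) by do 3!eexists; exact: sol c.
  have [+ _] := QP T T0 _ cons _ _ _ (sol c).
  by rewrite !xE !storE lecE => /andP [_]; rewrite ReB.
by rewrite mulmxDl !mulmxA.
Qed.

End Passivity.

Theorem corollary2p7 (R : realType) (k : scalar_kind) (n m : nat)
    (S : descriptor_system R k n m)
    (Vsys : {vspace 'cV[base_field R k]_(n + m)})
    (reg : regular S) (HV : is_system_space S Vsys) :
  [/\ passive S <-> KYP S Vsys,
      KYP S Vsys <-> KYP_E S Vsys,
      KYP_E S Vsys -> positive_real S &
      behaviorally_controllable S -> positive_real S -> passive S].
Proof.
have [contV _] := HV.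
have [d [X0 [U0 [F VP]]]] := parametrizes_exists HV.
have pa_kypE := passive_KYP_E VP; have kypE_pa := KYP_E_passive contV.
have kyp_kypE := KYP_to_KYP_E VP; have kypE_kyp := @KYP_E_KYP _ _ _ _ S Vsys.
split.
- by split=> [/pa_kypE /kypE_kyp|/kyp_kypE].
- by split.
- by move=> kyp; exact: (KYP_E_positive_real reg kyp (data_mem contV)).
- by move=> ctrl pr; apply: kypE_pa; exact: (positive_real_KYP_E reg VP).
Qed.
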